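(* Let $\varphi\in C(\overset{\cdot}{\mathbb{R}})$ and suppose that the operator $I+\mathbf{H}(\varphi)$ is invertible in the space $L_2^+(\mathbb{R})$. Then the finite section method is applicable in $L_2^+(\mathbb{R})$ to the infinite system of linear algebraic equations $$a_m+\sum_{k=0}^{\infty}\frac{(-1)^{k+m+1}}{2\pi}\,a_k\int_{-\infty}^{\infty}\frac{\varphi(\tau)z^{k+m+1}(\tau)}{\frac14+\tau^2}\,d\tau=\frac{(-1)^m}{2\pi}\int_{-\infty}^{\infty}\frac{\varphi(\tau)z^{m+1}(\tau)}{\frac12+i\tau}\,d\tau,\qquad m=0,1,\ldots,$$ which is the coordinate form of the equation $(I+\mathbf{H}(\varphi))y=-\mathbf{H}(\varphi)(1)$ with $y(\rho)=\sum_{n\ge 0}(-1)^n a_n\frac{z^n(\rho)}{\frac12-i\rho}$.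
   Context: $\overset{\cdot}{\mathbb{R}}=\mathbb{R}\cup\{\infty\}$ is the one-point compactification of the real line, and $C(\overset{\cdot}{\mathbb{R}})$ is the set of continuous functions on it. $L_2^+(\mathbb{R})$ is the Hardy space of $L_2(\mathbb{R})$ boundary values of functions analytic in the upper half-plane. Put $z(\rho)=\frac{\frac12+i\rho}{\frac12-i\rho}$. Every $f\in L_2^+(\mathbb{R})$ can be written as $f(\rho)=\sum_{k=0}^\infty f_k\frac{z^k(\rho)}{\frac12-i\rho}$ with $\sum|f_k|^2<\infty$. The Hankel operator with symbol $\varphi$ is $$(\mathbf{H}(\varphi)y)(\rho)=\lim_{\varepsilon\to0+}\frac{1}{2\pi i}\int_{-\infty}^\infty\frac{\varphi(\tau)y(\tau)}{\tau+\rho+i\varepsilon}\,d\tau,\qquad \rho\in\mathbb{R}.$$ $P_n$ is the projection $(P_nf)(\rho)=\sum_{k=0}^{n-1}f_k\frac{z^k(\rho)}{\frac12-i\rho}$. Applicability of the finite section method in a space $X$ means: for all sufficiently large $n$ the truncated operator $P_n(I+\mathbf{H}(\varphi))P_n$ (i.e. the matrix of the system truncated to $0\le k,m\le n-1$) is invertible on $P_nX$, the norms of the inverses are uniformly bounded in $n$, and for every right-hand side $f\in X$ the solutions of the truncated equations, $(P_n(I+\mathbf{H}(\varphi))P_n)^{-1}P_nf$, converge in $X$ to $(I+\mathbf{H}(\varphi))^{-1}f$ as $n\to\infty$. Here $X=L_2^+(\mathbb{R})$.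
   Formalization: The coordinate-form claim is stated for φ whose right-hand-side integrals exist as Lebesgue integrals; for general continuous φ, e.g. φ(τ)=τ/(√(1+τ²)log(2+τ²)), these integrals and H(φ)(1) diverge. Applicability of the finite section method is stated for all φ. *)

(* Defs.v *)
From HB Require Import structures.
From mathcomp Require Import all_boot all_order all_algebra.
From mathcomp Require Import complex.
From mathcomp Require Import all_classical all_reals all_analysis.

Set Implicit Arguments.
Unset Strict Implicit.
Unset Printing Implicit Defensive.
Import Order.TTheory GRing.Theory Num.Theory.
Import numFieldNormedType.Exports.

Local Open Scope classical_set_scope.
Local Open Scope complex_scope.
Local Open Scope ring_scope.

(* [complex R] carries no topology in the library; this is the usual one,
   given by the modulus. *)
#[warnings="-redundant-canonical-projection"]
HB.instance Definition _ (R : realType) := NormedModule.copy R[i] R[i]^o.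

(* Complex-valued functions on the line. Elements of L_2 are represented by
   functions; everything below identifies them up to [ae_same]. *)

Definition ae_same (R : realType) (f g : R -> R[i]) : Prop :=
  {ae @lebesgue_measure R, forall x, f x = g x}.

Definition cmeasurable (R : realType) (f : R -> R[i]) : Prop :=
  measurable_fun [set: R] (fun x => complex.Re (f x)) /\
  measurable_fun [set: R] (fun x => complex.Im (f x)).

Definition cintegrable (R : realType) (f : R -> R[i]) : Prop :=
  (@lebesgue_measure R).-integrable [set: R]
    (EFin \o (fun x => complex.Re (f x))) /\
  (@lebesgue_measure R).-integrable [set: R]
    (EFin \o (fun x => complex.Im (f x))).

Definition cintegral (R : realType) (f : R -> R[i]) : R[i] :=
  (\int[@lebesgue_measure R]_(x in [set: R]) complex.Re (f x)) +i*
  (\int[@lebesgue_measure R]_(x in [set: R]) complex.Im (f x)).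

Definition L2norm (R : realType) (f : R -> R[i]) : \bar R :=
  Lnorm (@lebesgue_measure R) 2%:E (fun x => (Normc.normc (f x))%:E).

Definition L2 (R : realType) : set (R -> R[i]) :=
  [set f | cmeasurable f /\ (L2norm f < +oo)%E].

(* [F] is only required to be holomorphic on the open upper half-plane; its
   other values are irrelevant. *)
Definition L2plus (R : realType) : set (R -> R[i]) :=
  [set f | L2 f /\
    exists F : R[i] -> R[i],
      [/\ forall w : R[i], 0 < complex.Im w -> derivable F w 1,
          exists M : R, forall y : R, 0 < y ->
            (L2norm (fun x => F (x +i* y)) <= M%:E)%E &
          L2norm (fun x => F (x +i* y) - f x) @[y --> (0 : R)^'+] --> 0%E]].

Definition zmap (R : realType) (rho : R) : R[i] :=
  (2^-1 +i* rho) / (2^-1 -i* rho).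

Definition basis_fun (R : realType) (k : nat) (rho : R) : R[i] :=
  zmap rho ^+ k / (2^-1 -i* rho).

Definition expansion (R : realType) (f : R -> R[i]) (c : nat -> R[i]) : Prop :=
  (\sum_(0 <= k <oo) (Normc.normc (c k) ^+ 2)%:E < +oo)%E /\
  L2norm (fun x => f x - \sum_(k < n) c k * basis_fun k x)
    @[n --> \oo] --> 0%E.

(* The sequence (f_k), picked by choice: it exists and is unique for [f] in
   [L2plus R]. *)
Definition coeffs (R : realType) (f : R -> R[i]) : nat -> R[i] :=
  xget (fun=> 0) [set c | expansion f c].

Definition section_proj (R : realType) (n : nat) (f : R -> R[i]) : R -> R[i] :=
  fun rho => \sum_(k < n) coeffs f k * basis_fun k rho.

(* The limit is taken pointwise in [rho]; it exists for almost every [rho]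
   when [y] is in [L2plus R] and [phi] is continuous, and the value of [lim]
   on the exceptional null set is irrelevant. The point at infinity is [None]
   in [one_point_compactification R]. *)
Definition hankel (R : realType) (phi : one_point_compactification R -> R[i])
    (y : R -> R[i]) : R -> R[i] :=
  fun rho => lim (((2 * pi)%:C * 'i%C)^-1 *
    cintegral (fun tau => phi (Some tau) * y tau / ((tau + rho) +i* eps))
      @[eps --> (0 : R)^'+]).

Definition id_plus_hankel (R : realType)
    (phi : one_point_compactification R -> R[i]) (y : R -> R[i]) : R -> R[i] :=
  fun rho => y rho + hankel phi y rho.

(* [A] is invertible as an operator on [E], modulo null sets, and the norm of
   the inverse is at most [M]. *)
Definition invertible_on (R : realType) (E : set (R -> R[i]))
    (A : (R -> R[i]) -> (R -> R[i])) (M : R) : Prop :=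
  [/\ forall y, E y -> E (A y),
      forall f, E f -> exists2 y, E y & ae_same (A y) f,
      forall y1 y2, E y1 -> E y2 -> ae_same (A y1) (A y2) -> ae_same y1 y2 &
      forall y, E y -> (L2norm y <= M%:E * L2norm (A y))%E].

Definition finite_section_applicable (R : realType) (E : set (R -> R[i]))
    (P : nat -> (R -> R[i]) -> (R -> R[i]))
    (A : (R -> R[i]) -> (R -> R[i])) : Prop :=
  exists (M : R) (N : nat),
    (forall n, (N <= n)%N ->
       invertible_on (P n @` E) (P n \o A \o P n) M) /\
    (forall (f y : R -> R[i]) (u : nat -> R -> R[i]),
       E f -> E y -> ae_same (A y) f ->
       (forall n, (N <= n)%N ->
          (P n @` E) (u n) /\ ae_same (P n (A (P n (u n)))) (P n f)) ->
       L2norm (fun x => u n x - y x) @[n --> \oo] --> 0%E).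

Definition system_coef (R : realType)
    (phi : one_point_compactification R -> R[i]) (m k : nat) : R[i] :=
  (-1) ^+ (k + m + 1) / (2 * pi)%:C *
  cintegral (fun tau => phi (Some tau) * zmap tau ^+ (k + m + 1) /
                        (4^-1 + tau ^+ 2)%:C).

Definition system_rhs_integrand (R : realType)
    (phi : one_point_compactification R -> R[i]) (m : nat) : R -> R[i] :=
  fun tau => phi (Some tau) * zmap tau ^+ (m + 1) / (2^-1 +i* tau).

Definition system_rhs (R : realType)
    (phi : one_point_compactification R -> R[i]) (m : nat) : R[i] :=
  (-1) ^+ m / (2 * pi)%:C * cintegral (system_rhs_integrand phi m).

Definition solves_system (R : realType)
    (phi : one_point_compactification R -> R[i]) (a : nat -> R[i]) : Prop :=
  forall m, a m + \sum_(0 <= k < n) system_coef phi m k * a k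
    @[n --> \oo] --> system_rhs phi m.

(* Main.v *)
(* Write e_k = z^k / (1/2 - i rho), an orthogonal family with |e_k|^2 = 1 / (1/4 + rho^2),
   and z = -1 + e_0. By partial fractions the kernel 1 / (t + w) expands into the products
   e_k(t) e_k(w), so H(phi) y has the coefficients -(1 / 2 pi) \int phi y e_k, which are
   square summable by Bessel, and the boundary values exist almost everywhere because the
   Cauchy transform equals a Poisson integral. Conversely a function of L_2^+ is orthogonal
   to the conjugates of the e_k (Cauchy's theorem on rectangles, with no assumption on the
   complex derivative beyond its existence), hence is the sum of its series.

   Since z extends to a homeomorphism of the compactified line onto the circle, phi is a
   uniform limit of Laurent polynomials in z. The Hankel operator of such a polynomial has
   finitely many nonzero rows, so the tails (I - P_n) H(phi) tend to 0 in norm, and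
   P_n (I + H) inherits from I + H a lower bound on the range of P_n for large n. An injective
   square matrix is invertible, which gives the sections their inverses and the bound; the
   convergence follows by comparing the solution u_n with P_n y.

   For the right-hand side, the constant 1 is not in L_2, but partial fractions give
   H(phi) 1 = b_0 + (1/2 + i rho) H(phi) e_0 with b_0 = -(1 / 2 pi) \int phi e_0.
   Multiplying by e_0 turns the equation into one between L_2 functions, whose
   coefficients can be compared. *)
Require Import Defs.
From HB Require Import structures.
From mathcomp Require Import all_boot all_order all_algebra.
From mathcomp Require Import complex.
From mathcomp Require Import all_classical all_reals all_analysis.
From mathcomp Require Import measurable_realfun ring lra.
Set Implicit Arguments.
Unset Strict Implicit.
Unset Printing Implicit Defensive.
Import Order.TTheory GRing.Theory Num.Theory.
Import numFieldNormedType.Exports.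
Local Open Scope classical_set_scope.
Local Open Scope ring_scope.
Local Notation normc := Normc.normc.

(** * Complex-valued integrals and the space L_2 *)

(** The obstacle is that [hankel] is a pointwise limit and that [L2plus] only offers a holomorphic
    extension converging in norm, whereas the finite section argument lives on coefficients. Both
    bridges are Poisson integrals. The pairings of g with e_k, without conjugate, give the series of
    the Cauchy transform of g; and if they all vanish for some h in L_2, the Poisson integral of h
    has the Fourier series of h as its series. So two such functions with the same coefficients have
    the same Poisson integral, hence agree almost everywhere, and a Cauchy transform whose
    coefficients are those of such an h has boundary values h.

    The e_k have norm sqrt(2 pi) and are not normalized, which explains the factors 2 pi throughout.
    If M >= 1 bounds the inverse of I + H, tails below 1 / (2 M) can be absorbed into the left-hand
    side of the lower bound, and the sections for large n keep the bound 2 M. *)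

Section ComplexModulus.
Context {R : realType}.
Implicit Types (a b z : R[i]) (r : R).

Lemma ReD a b : complex.Re (a + b) = complex.Re a + complex.Re b.
Proof. by case: a; case: b. Qed.

Lemma ImD a b : complex.Im (a + b) = complex.Im a + complex.Im b.
Proof. by case: a; case: b. Qed.

Lemma ReN a : complex.Re (- a) = - complex.Re a.
Proof. by case: a. Qed.

Lemma ImN a : complex.Im (- a) = - complex.Im a.
Proof. by case: a. Qed.

Lemma ReM a b :
  complex.Re (a * b) = complex.Re a * complex.Re b - complex.Im a * complex.Im b.
Proof. by case: a; case: b. Qed.

Lemma ImM a b :
  complex.Im (a * b) = complex.Re a * complex.Im b + complex.Im a * complex.Re b.
Proof. by case: a; case: b. Qed.

Lemma normc_sqrE z : normc z ^+ 2 = complex.Re z ^+ 2 + complex.Im z ^+ 2.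
Proof. by case: z => x y /=; rewrite sqr_sqrtr// addr_ge0 ?sqr_ge0. Qed.

Lemma normc_ge0 z : 0 <= normc z.
Proof. by case: z => x y /=; rewrite sqrtr_ge0. Qed.
Hint Resolve normc_ge0 : core.

Lemma normrE z : `|z| = (normc z)%:C%C.
Proof. by []. Qed.

Lemma normc_Re z : `|complex.Re z| <= normc z.
Proof.
rewrite -(ler_pXn2r (n := 2))// ?nnegrE// normc_sqrE real_normK ?num_real//.
by rewrite lerDl sqr_ge0.
Qed.

Lemma normc_Im z : `|complex.Im z| <= normc z.
Proof.
rewrite -(ler_pXn2r (n := 2))// ?nnegrE// normc_sqrE real_normK ?num_real//.
by rewrite lerDr sqr_ge0.
Qed.

Lemma normc_le_ReIm z : normc z <= `|complex.Re z| + `|complex.Im z|.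
Proof.
rewrite -(ler_pXn2r (n := 2)) ?nnegrE ?addr_ge0 ?normc_ge0// normc_sqrE.
rewrite sqrrD !real_normK ?num_real// -addrA lerD2l lerDr.
by rewrite mulrn_wge0 ?mulr_ge0.
Qed.

Lemma normc_conj z : normc (conjc z) = normc z.
Proof. by case: z => x y /=; rewrite sqrrN. Qed.

Lemma normc_real r : normc r%:C%C = `|r|.
Proof. by rewrite /= expr0n addr0 sqrtr_sqr. Qed.

Lemma normcX z n : normc (z ^+ n) = normc z ^+ n.
Proof.
elim: n => [|n IH]; first by rewrite !expr0 Normc.normc1.
by rewrite !exprS Normc.normcM IH.
Qed.

Lemma normc_sum (I : Type) (s : seq I) (P : pred I) (F : I -> R[i]) :
  normc (\sum_(i <- s | P i) F i) <= \sum_(i <- s | P i) normc (F i).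
Proof.
elim/big_ind2: _ => [|x1 x2 y1 y2 h1 h2|//]; first by rewrite Normc.normc0.
exact: le_trans (le_normcD _ _) (lerD h1 h2).
Qed.

Lemma le_normcB a b : normc (a - b) <= normc a + normc b.
Proof. by rewrite (le_trans (le_normcD _ _))// normcN. Qed.

Lemma normc_dist a b : `|normc a - normc b| <= normc (a - b).
Proof.
have h (x y : R[i]) : normc x - normc y <= normc (x - y).
  by rewrite lerBlDr -{1}(subrK y x) le_normcD.
by rewrite ler_norml h andbT lerNl opprB (le_trans (h _ _))// -opprB normcN.
Qed.

Lemma normc_eq0 z : (normc z == 0) = (z == 0).
Proof.
apply/eqP/eqP => [/Normc.eq0_normc//|->]; exact: Normc.normc0.
Qed.

Lemma normc_gt0 z : (0 < normc z) = (z != 0).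
Proof. by rewrite lt_neqAle normc_ge0 andbT eq_sym normc_eq0. Qed.

Lemma mul_conjc z : z * (conjc z) = (normc z ^+ 2)%:C%C.
Proof.
rewrite normc_sqrE; case: z => x y /=; apply/eqP; rewrite eq_complex /=.
by apply/andP; split; apply/eqP; ring.
Qed.

Lemma Re_conj z : complex.Re (conjc z) = complex.Re z.
Proof. by case: z. Qed.

Lemma Im_conj z : complex.Im (conjc z) = - complex.Im z.
Proof. by case: z. Qed.

Lemma conjcM a b : conjc (a * b) = conjc a * conjc b.
Proof. exact: rmorphM. Qed.

Lemma conjcX a n : conjc (a ^+ n) = conjc a ^+ n.
Proof. exact: rmorphXn. Qed.

Lemma conjcD a b : conjc (a + b) = conjc a + conjc b.
Proof. exact: rmorphD. Qed.

Lemma conjcB a b : conjc (a - b) = conjc a - conjc b.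
Proof. exact: rmorphB. Qed.

Lemma conjc_sum (I : Type) (s : seq I) (P : pred I) (F : I -> R[i]) :
  conjc (\sum_(i <- s | P i) F i) = \sum_(i <- s | P i) conjc (F i).
Proof. exact: rmorph_sum. Qed.

End ComplexModulus.
#[local] Hint Resolve normc_ge0 : core.

Section ComplexIntegral.
Context {R : realType}.
Local Notation mu := (@lebesgue_measure R).
Implicit Types (f g : R -> R[i]) (h : R -> R).

Lemma aeS (P Q : R -> Prop) : (forall x, P x -> Q x) ->
  {ae mu, forall x, P x} -> {ae mu, forall x, Q x}.
Proof. by move=> PQ; apply: negligibleS => x /=; apply: contra_not => /PQ. Qed.

Lemma aeI (P Q : R -> Prop) :
  {ae mu, forall x, P x} -> {ae mu, forall x, Q x} ->
  {ae mu, forall x, P x /\ Q x}.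
Proof.
move=> hP hQ; apply: negligibleS (negligibleU hP hQ) => x /= /not_andP[]; tauto.
Qed.

Lemma aeT (P : R -> Prop) : (forall x, P x) -> {ae mu, forall x, P x}.
Proof.
move=> hP; apply: negligibleS (negligible_set0 _) => x /=; exact.
Qed.

Definition rintegrable h := mu.-integrable [set: R] (EFin \o h).

Lemma rintegrable_le h k : measurable_fun [set: R] h ->
  (forall x, `|h x| <= k x) -> rintegrable k -> rintegrable h.
Proof.
move=> mh hk ik; apply: le_integrable ik => //; first exact/measurable_EFinP.
by move=> x _ /=; rewrite lee_fin (le_trans (hk x))// ler_norm.
Qed.

Lemma rintegrable_measurable h : rintegrable h -> measurable_fun [set: R] h.
Proof. by move=> /integrableP[/measurable_EFinP]. Qed.

Lemma rintegrableD h k : rintegrable h -> rintegrable k ->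
  rintegrable (fun x => h x + k x).
Proof. by move=> ih ik; exact: (integrableD measurableT ih ik). Qed.

Lemma rintegrableZ (r : R) h : rintegrable h -> rintegrable (fun x => r * h x).
Proof. by move=> ih; exact: (integrableZl measurableT r ih). Qed.

Lemma rintegrableN h : rintegrable h -> rintegrable (fun x => - h x).
Proof.
by move=> /(rintegrableZ (-1)); under eq_fun do rewrite mulN1r.
Qed.

Lemma rintegrableB h k : rintegrable h -> rintegrable k ->
  rintegrable (fun x => h x - k x).
Proof. by move=> ih ik; apply: rintegrableD => //; exact: rintegrableN. Qed.

Lemma rintegrable_norm h : rintegrable h -> rintegrable (fun x => `|h x|).
Proof. by move=> ih; exact: integrable_norm ih. Qed.

Lemma rintegralE h : rintegrable h ->
  (\int[mu]_(x in [set: R]) h x)%:E = (\int[mu]_(x in [set: R]) (h x)%:E)%E.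
Proof. by move=> ih; rewrite /Rintegral fineK// integrable_fin_num. Qed.

Lemma ae_rintegral h k : measurable_fun [set: R] h -> measurable_fun [set: R] k ->
  {ae mu, forall x, h x = k x} ->
  \int[mu]_(x in [set: R]) h x = \int[mu]_(x in [set: R]) k x.
Proof.
move=> mh mk hk; rewrite /Rintegral; congr fine; apply: ae_eq_integral => //;
  try exact/measurable_EFinP.
by apply: aeS hk => x hkx _ /=; rewrite hkx.
Qed.

Lemma cmeasurableD f g : cmeasurable f -> cmeasurable g ->
  cmeasurable (fun x => f x + g x).
Proof.
move=> [mf1 mf2] [mg1 mg2]; split.
  by under eq_fun do rewrite ReD; exact: measurable_funD.
by under eq_fun do rewrite ImD; exact: measurable_funD.
Qed.

Lemma cmeasurableM f g : cmeasurable f -> cmeasurable g ->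
  cmeasurable (fun x => f x * g x).
Proof.
move=> [mf1 mf2] [mg1 mg2]; split.
  under eq_fun do rewrite ReM.
  by apply: measurable_funB; exact: measurable_funM.
under eq_fun do rewrite ImM.
by apply: measurable_funD; exact: measurable_funM.
Qed.

Lemma cmeasurable_cst (c : R[i]) : cmeasurable (fun=> c).
Proof. by split; exact: measurable_cst. Qed.

Lemma cmeasurableZ (c : R[i]) f : cmeasurable f -> cmeasurable (fun x => c * f x).
Proof. by move=> mf; apply: cmeasurableM => //; exact: cmeasurable_cst. Qed.

Lemma cmeasurableN f : cmeasurable f -> cmeasurable (fun x => - f x).
Proof.
by move=> /(cmeasurableZ (-1)); under eq_fun do rewrite mulN1r.
Qed.

Lemma cmeasurableB f g : cmeasurable f -> cmeasurable g ->
  cmeasurable (fun x => f x - g x).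
Proof. by move=> mf mg; apply: cmeasurableD => //; exact: cmeasurableN. Qed.

Lemma cmeasurable_sum (I : Type) (s : seq I) (F : I -> R -> R[i]) :
  (forall i, cmeasurable (F i)) -> cmeasurable (fun x => \sum_(i <- s) F i x).
Proof.
move=> mF; elim: s => [|i s IH].
  by under eq_fun do rewrite big_nil; exact: cmeasurable_cst.
by under eq_fun do rewrite big_cons; exact: cmeasurableD.
Qed.

Lemma cmeasurable_conj f : cmeasurable f -> cmeasurable (fun x => conjc (f x)).
Proof.
move=> [m1 m2]; split; first by under eq_fun do rewrite Re_conj.
by under eq_fun do rewrite Im_conj; exact: measurable_funN.
Qed.

Lemma measurable_normc f : cmeasurable f ->
  measurable_fun [set: R] (fun x => normc (f x)).
Proof.
move=> [m1 m2].
have -> : (fun x => normc (f x)) =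
    Num.sqrt \o (fun x => complex.Re (f x) ^+ 2 + complex.Im (f x) ^+ 2).
  by apply/funext => x /=; rewrite -normc_sqrE sqrtr_sqr ger0_norm.
apply: measurableT_comp.
  exact: (continuous_measurable_fun (@sqrt_continuous R)).
by apply: measurable_funD; exact: measurable_funX.
Qed.

Lemma cintegrable_measurable f : cintegrable f -> cmeasurable f.
Proof. by move=> [i1 i2]; split; exact: rintegrable_measurable. Qed.

Lemma cintegrable_le f h : cmeasurable f -> (forall x, normc (f x) <= h x) ->
  rintegrable h -> cintegrable f.
Proof.
move=> [m1 m2] fh ih; split; apply: rintegrable_le ih => // x.
  exact: le_trans (normc_Re _) (fh x).
exact: le_trans (normc_Im _) (fh x).
Qed.

Lemma cintegrable_normc f : cintegrable f -> rintegrable (fun x => normc (f x)).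
Proof.
move=> fi; have [i1 i2] := fi.
apply: (@rintegrable_le _ (fun x => `|complex.Re (f x)| + `|complex.Im (f x)|)).
- by apply: measurable_normc; exact: cintegrable_measurable.
- by move=> x; rewrite (ger0_norm (normc_ge0 _)) normc_le_ReIm.
- by apply: rintegrableD; exact: rintegrable_norm.
Qed.

Lemma cintegrableD f g : cintegrable f -> cintegrable g ->
  cintegrable (fun x => f x + g x).
Proof.
move=> fi gi; apply: (@cintegrable_le _ (fun x => normc (f x) + normc (g x))).
- by apply: cmeasurableD; exact: cintegrable_measurable.
- by move=> x; exact: le_normcD.
- by apply: rintegrableD; exact: cintegrable_normc.
Qed.

Lemma cintegrableZ (c : R[i]) f : cintegrable f -> cintegrable (fun x => c * f x).
Proof.
move=> fi; apply: (@cintegrable_le _ (fun x => normc c * normc (f x))).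
- by apply: cmeasurableZ; exact: cintegrable_measurable.
- by move=> x; rewrite Normc.normcM.
- by apply: rintegrableZ; exact: cintegrable_normc.
Qed.

Lemma cintegrableN f : cintegrable f -> cintegrable (fun x => - f x).
Proof. by move=> /(cintegrableZ (-1)); under eq_fun do rewrite mulN1r. Qed.

Lemma cintegrableB f g : cintegrable f -> cintegrable g ->
  cintegrable (fun x => f x - g x).
Proof. by move=> fi gi; apply: cintegrableD => //; exact: cintegrableN. Qed.

Lemma cintegrable0 : cintegrable (fun=> 0 : R[i]).
Proof. by split; exact: integrable0. Qed.

Lemma cintegrable_sum (I : Type) (s : seq I) (F : I -> R -> R[i]) :
  (forall i, cintegrable (F i)) -> cintegrable (fun x => \sum_(i <- s) F i x).
Proof.
move=> iF; elim: s => [|i s IH].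
  by under eq_fun do rewrite big_nil; exact: cintegrable0.
by under eq_fun do rewrite big_cons; exact: cintegrableD.
Qed.

Lemma eq_cintegral f g : (forall x, f x = g x) -> cintegral f = cintegral g.
Proof. by move=> fg; congr cintegral; exact/funext. Qed.

Lemma cintegral0 : cintegral (fun=> 0 : R[i]) = 0.
Proof.
by rewrite /cintegral /= /Rintegral integral0.
Qed.

Lemma cintegralD f g : cintegrable f -> cintegrable g ->
  cintegral (fun x => f x + g x) = cintegral f + cintegral g.
Proof.
move=> [f1 f2] [g1 g2]; rewrite /cintegral; apply/eqP; rewrite eq_complex /=.
apply/andP; split; apply/eqP.
  by under eq_fun do rewrite ReD; rewrite RintegralD.
by under eq_fun do rewrite ImD; rewrite RintegralD.
Qed.

Lemma cintegralZ (c : R[i]) f : cintegrable f ->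
  cintegral (fun x => c * f x) = c * cintegral f.
Proof.
move=> [f1 f2]; rewrite /cintegral; apply/eqP; rewrite eq_complex.
apply/andP; split; apply/eqP; case: c => a b /=.
  under eq_fun do rewrite ReM /=.
  by rewrite RintegralB ?RintegralZl//; exact: rintegrableZ.
under eq_fun do rewrite ImM /=.
by rewrite RintegralD ?RintegralZl//; exact: rintegrableZ.
Qed.

Lemma cintegralN f : cintegrable f -> cintegral (fun x => - f x) = - cintegral f.
Proof.
by move=> fi; under eq_fun do rewrite -mulN1r; rewrite cintegralZ// mulN1r.
Qed.

Lemma cintegralB f g : cintegrable f -> cintegrable g ->
  cintegral (fun x => f x - g x) = cintegral f - cintegral g.
Proof.
move=> fi gi; rewrite cintegralD ?cintegralN//; exact: cintegrableN.
Qed.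

Lemma cintegral_sum (I : Type) (s : seq I) (F : I -> R -> R[i]) :
  (forall i, cintegrable (F i)) ->
  cintegral (fun x => \sum_(i <- s) F i x) = \sum_(i <- s) cintegral (F i).
Proof.
move=> iF; elim: s => [|i s IH].
  by under eq_fun do rewrite big_nil; rewrite big_nil cintegral0.
under eq_fun do rewrite big_cons.
by rewrite big_cons cintegralD// ?IH//; exact: cintegrable_sum.
Qed.

Lemma cintegrable_conj f : cintegrable f -> cintegrable (fun x => conjc (f x)).
Proof.
move=> fi; apply: (cintegrable_le _ _ (cintegrable_normc fi)).
  exact/cmeasurable_conj/cintegrable_measurable.
by move=> x; rewrite normc_conj.
Qed.

Lemma cintegral_conj f : cintegrable f ->
  cintegral (fun x => conjc (f x)) = conjc (cintegral f).
Proof.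
move=> [f1 f2]; rewrite /cintegral /=; apply/eqP; rewrite eq_complex /=.
apply/andP; split; apply/eqP.
  by under eq_fun do rewrite Re_conj.
under eq_fun do rewrite Im_conj -mulN1r.
by rewrite RintegralZl// mulN1r.
Qed.

(* Rotate the integral to the positive real axis and compare real parts. *)
Lemma normc_cintegral f : cintegrable f ->
  normc (cintegral f) <= \int[mu]_(x in [set: R]) normc (f x).
Proof.
move=> fi; set I := cintegral f.
have [I0|I0] := eqVneq I 0.
  by rewrite I0 Normc.normc0; apply: Rintegral_ge0 => x _; exact: normc_ge0.
have nI : 0 < normc I by rewrite normc_gt0.
have gi := cintegrableZ (conjc I) fi.
have eI : \int[mu]_(x in [set: R]) complex.Re ((conjc I) * f x) = normc I ^+ 2.
  rewrite -[LHS]/(complex.Re (cintegral (fun x => (conjc I) * f x))).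
  by rewrite cintegralZ// -/I mulrC mul_conjc.
rewrite -(ler_pM2l nI) -expr2 -eI.
rewrite -RintegralZl//; last exact: cintegrable_normc.
apply: le_Rintegral => //; first by case: gi.
  exact/rintegrableZ/cintegrable_normc.
move=> x _; rewrite (le_trans (ler_norm _))// (le_trans (normc_Re _))//.
by rewrite Normc.normcM normc_conj.
Qed.

End ComplexIntegral.

Section L2Space.
Context {R : realType}.
Local Notation mu := (@lebesgue_measure R).
Implicit Types (f g : R -> R[i]).

(** The real-valued counterpart of [L2norm], squared. It is meaningful on [L2] only ([L2normE]): an
    infinite integral is sent to 0 by [fine]. *)
Definition sqint f := \int[mu]_(x in [set: R]) (normc (f x) ^+ 2).

Definition nrm f := Num.sqrt (sqint f).

Lemma sqint_ge0 f : 0 <= sqint f.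
Proof. by apply: Rintegral_ge0 => x _; exact: sqr_ge0. Qed.

Lemma nrm_ge0 f : 0 <= nrm f.
Proof. exact: sqrtr_ge0. Qed.

Lemma sqr_nrm f : nrm f ^+ 2 = sqint f.
Proof. by rewrite sqr_sqrtr// sqint_ge0. Qed.

Lemma measurable_sqr_normc f : cmeasurable f ->
  measurable_fun [set: R] (fun x => normc (f x) ^+ 2).
Proof. by move=> mf; apply: measurable_funX; exact: measurable_normc. Qed.

Lemma L2norm_poweR f : cmeasurable f ->
  L2norm f = ((\int[mu]_(x in [set: R]) (normc (f x) ^+ 2)%:E) `^ 2^-1)%E.
Proof.
move=> mf; rewrite /L2norm Lnorm.unlock; congr poweR.
apply: eq_integral => x _ /=.
by rewrite ger0_norm ?normc_ge0// powR_mulrn ?normc_ge0.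
Qed.

Lemma L2P f : L2 f <->
  cmeasurable f /\ rintegrable (fun x => normc (f x) ^+ 2).
Proof.
have key : cmeasurable f -> (L2norm f < +oo)%E <->
    (\int[mu]_(x in [set: R]) (normc (f x) ^+ 2)%:E < +oo)%E.
  move=> mf; rewrite L2norm_poweR//.
  have : (0 <= \int[mu]_(x in [set: R]) (normc (f x) ^+ 2)%:E)%E.
    by apply: integral_ge0 => x _; rewrite lee_fin sqr_ge0.
  case: (\int[mu]_(x in [set: R]) _)%E => //= [r|] _.
    by rewrite !ltry.
  by rewrite invr_eq0 pnatr_eq0.
split=> [[mf /(key mf) fi]|[mf /integrableP[_ fi]]]; split=> //.
  apply/integrableP; split; first by apply/measurable_EFinP; exact: measurable_sqr_normc.
  under eq_integral do rewrite /= ger0_norm ?sqr_ge0//.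
  exact: fi.
apply/(key mf); apply: le_lt_trans fi.
rewrite le_eqVlt; apply/orP; left; apply/eqP; apply: eq_integral => x _ /=.
by rewrite ger0_norm ?sqr_ge0.
Qed.

Lemma L2_cmeasurable f : L2 f -> cmeasurable f.
Proof. by case. Qed.

Lemma L2_rintegrable f : L2 f -> rintegrable (fun x => normc (f x) ^+ 2).
Proof. by move=> /L2P[]. Qed.

Lemma L2normE f : L2 f -> L2norm f = (nrm f)%:E.
Proof.
move=> Lf; rewrite L2norm_poweR; last exact: L2_cmeasurable.
rewrite -rintegralE; last exact: L2_rintegrable.
by rewrite poweR_EFin powR12_sqrt ?sqint_ge0.
Qed.

Lemma L2_le f g : cmeasurable f -> L2 g ->
  (forall x, normc (f x) <= normc (g x)) -> L2 f.
Proof.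
move=> mf Lg fg; apply/L2P; split => //.
apply: rintegrable_le (L2_rintegrable Lg); first exact: measurable_sqr_normc.
by move=> x; rewrite ger0_norm ?sqr_ge0// lerXn2r// nnegrE normc_ge0.
Qed.

Lemma nrm_le f g : cmeasurable f -> L2 g ->
  (forall x, normc (f x) <= normc (g x)) -> nrm f <= nrm g.
Proof.
move=> mf Lg fg; rewrite ler_sqrt ?sqint_ge0//.
apply: le_Rintegral => //; [exact: L2_rintegrable (L2_le mf Lg fg)|
  exact: L2_rintegrable|].
by move=> x _; rewrite lerXn2r// nnegrE normc_ge0.
Qed.

Lemma L2Z (c : R[i]) f : L2 f -> L2 (fun x => c * f x).
Proof.
move=> Lf; apply/L2P; split; first exact/cmeasurableZ/L2_cmeasurable.
under eq_fun do rewrite Normc.normcM exprMn.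
exact/rintegrableZ/L2_rintegrable.
Qed.

Lemma nrmZ (c : R[i]) f : L2 f -> nrm (fun x => c * f x) = normc c * nrm f.
Proof.
move=> Lf; rewrite /nrm /sqint.
under eq_Rintegral do rewrite Normc.normcM exprMn.
rewrite RintegralZl//; last exact: L2_rintegrable.
by rewrite sqrtrM ?sqr_ge0// sqrtr_sqr ger0_norm ?normc_ge0.
Qed.

Lemma L2D f g : L2 f -> L2 g -> L2 (fun x => f x + g x).
Proof.
move=> Lf Lg; apply/L2P; split.
  by apply: cmeasurableD; exact: L2_cmeasurable.
apply: (@rintegrable_le _ _ (fun x => 2 * (normc (f x) ^+ 2 + normc (g x) ^+ 2))).
- by apply: measurable_sqr_normc; apply: cmeasurableD; exact: L2_cmeasurable.
- move=> x; rewrite ger0_norm ?sqr_ge0//.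
  apply: (@le_trans _ _ ((normc (f x) + normc (g x)) ^+ 2)).
    by rewrite lerXn2r ?nnegrE ?addr_ge0 ?normc_ge0// le_normcD.
  have := sqr_ge0 (normc (f x) - normc (g x)); nra.
- by apply/rintegrableZ/rintegrableD; exact: L2_rintegrable.
Qed.

Lemma L2N f : L2 f -> L2 (fun x => - f x).
Proof. by move=> /(L2Z (-1)); under eq_fun do rewrite mulN1r. Qed.

Lemma L2B f g : L2 f -> L2 g -> L2 (fun x => f x - g x).
Proof. by move=> Lf Lg; apply: L2D => //; exact: L2N. Qed.

Lemma L2_0 : L2 (fun=> 0 : R[i]).
Proof.
apply/L2P; split; first exact: cmeasurable_cst.
under eq_fun do rewrite Normc.normc0 expr0n.
exact: integrable0.
Qed.

Lemma nrm0 : nrm (fun=> 0 : R[i]) = 0.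
Proof.
rewrite /nrm /sqint; under eq_Rintegral do rewrite Normc.normc0 expr0n.
by rewrite /Rintegral integral0 sqrtr0.
Qed.

Lemma L2_sum (I : Type) (s : seq I) (F : I -> R -> R[i]) :
  (forall i, L2 (F i)) -> L2 (fun x => \sum_(i <- s) F i x).
Proof.
move=> LF; elim: s => [|i s IH].
  by under eq_fun do rewrite big_nil; exact: L2_0.
by under eq_fun do rewrite big_cons; exact: L2D.
Qed.

Lemma L2_conj f : L2 f -> L2 (fun x => conjc (f x)).
Proof.
move=> Lf; apply: (L2_le _ Lf) => [|x]; last by rewrite normc_conj.
exact/cmeasurable_conj/L2_cmeasurable.
Qed.

Lemma nrm_conj f : nrm (fun x => conjc (f x)) = nrm f.
Proof.
by rewrite /nrm /sqint; under eq_Rintegral do rewrite normc_conj.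
Qed.

Lemma nrmN f : nrm (fun x => - f x) = nrm f.
Proof. by rewrite /nrm /sqint; under eq_Rintegral do rewrite normcN. Qed.

Lemma nrm_distC f g : nrm (fun x => f x - g x) = nrm (fun x => g x - f x).
Proof. by rewrite -nrmN; under eq_fun do rewrite opprB. Qed.

Lemma L2_bounded (b : R -> R[i]) (M : R) f : cmeasurable b ->
  (forall x, normc (b x) <= M) -> L2 f -> L2 (fun x => b x * f x).
Proof.
move=> mb bM Lf; have M0 : 0 <= M := le_trans (normc_ge0 _) (bM 0).
apply: (L2_le _ (L2Z M%:C%C Lf)) => [|x].
  by apply: cmeasurableM => //; exact: L2_cmeasurable.
by rewrite !Normc.normcM normc_real ger0_norm// ler_wpM2r ?normc_ge0.
Qed.

Lemma nrm_bounded (b : R -> R[i]) (M : R) f : cmeasurable b ->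
  (forall x, normc (b x) <= M) -> L2 f -> nrm (fun x => b x * f x) <= M * nrm f.
Proof.
move=> mb bM Lf; have M0 : 0 <= M := le_trans (normc_ge0 _) (bM 0).
rewrite -[M in M * _](ger0_norm M0) -normc_real -nrmZ//.
apply: (nrm_le _ (L2Z M%:C%C Lf)) => [|x].
  by apply: cmeasurableM => //; exact: L2_cmeasurable.
by rewrite !Normc.normcM normc_real ger0_norm// ler_wpM2r ?normc_ge0.
Qed.

Lemma L2_mul_rintegrable f g : L2 f -> L2 g ->
  rintegrable (fun x => normc (f x) * normc (g x)).
Proof.
move=> Lf Lg.
apply: (@rintegrable_le _ _ (fun x => normc (f x) ^+ 2 + normc (g x) ^+ 2)).
- by apply: measurable_funM; apply: measurable_normc; exact: L2_cmeasurable.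
- move=> x; rewrite ger0_norm ?mulr_ge0 ?normc_ge0//.
  have := normc_ge0 (f x); have := normc_ge0 (g x).
  have := sqr_ge0 (normc (f x) - normc (g x)); nra.
- by apply: rintegrableD; exact: L2_rintegrable.
Qed.

Lemma L2_mul_cintegrable f g : L2 f -> L2 g -> cintegrable (fun x => f x * g x).
Proof.
move=> Lf Lg; apply: (cintegrable_le _ _ (L2_mul_rintegrable Lf Lg)).
  by apply: cmeasurableM; exact: L2_cmeasurable.
by move=> x; rewrite Normc.normcM.
Qed.

(** Integrates 2ab <= t a^2 + b^2 / t and then optimizes the parameter t > 0. An error [e] is
    allowed so that the degenerate cases need no division by a zero norm. *)
Lemma cauchy_schwarz_real f g : L2 f -> L2 g ->
  \int[mu]_(x in [set: R]) (normc (f x) * normc (g x)) <= nrm f * nrm g.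
Proof.
move=> Lf Lg; set I := \int[mu]_(x in _) _.
have key t : 0 < t -> 2 * I <= t * sqint f + t^-1 * sqint g.
  move=> t0.
  rewrite /I /sqint -!RintegralZl//;
    [|exact: L2_rintegrable|exact: L2_rintegrable|exact: L2_mul_rintegrable].
  rewrite -RintegralD//; [|exact/rintegrableZ/L2_rintegrable..].
  apply: le_Rintegral => //; [exact/rintegrableZ/L2_mul_rintegrable|
    by apply: rintegrableD; exact/rintegrableZ/L2_rintegrable|].
  move=> x _; set a := normc (f x); set b := normc (g x).
  rewrite -subr_ge0; have -> : t * a ^+ 2 + t^-1 * b ^+ 2 - 2 * (a * b) =
    t^-1 * (t * a - b) ^+ 2 by field; rewrite gt_eqF.
  by rewrite mulr_ge0 ?sqr_ge0// invr_ge0 ltW.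
have I0 : 0 <= I by apply: Rintegral_ge0 => x _; rewrite mulr_ge0 ?normc_ge0.
rewrite -!sqr_nrm in key.
have [a0 b0] := (nrm_ge0 f, nrm_ge0 g).
set a := nrm f in key a0 *; set b := nrm g in key b0 *.
apply/ler_addgt0Pl => e e0.
have [aeq|ane] := eqVneq a 0.
  rewrite aeq mul0r addr0.
  (* When [f] has norm 0 only b^2 / t remains on the right, and a large t makes it at most [e]. *)
  have t0 : 0 < (b ^+ 2 + 1) / e by rewrite divr_gt0// ltr_wpDl ?sqr_ge0.
  have := key _ t0; rewrite aeq expr0n/= mulr0 add0r invf_div mulrAC.
  have : e * b ^+ 2 / (b ^+ 2 + 1) <= e.
    by rewrite ler_pdivrMr ?ltr_wpDl ?sqr_ge0// ler_pM2l// lerDl.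
  move=> h1 h2; lra.
have agt : 0 < a by rewrite lt_neqAle eq_sym ane.
(* The optimal t is b / a; the term e / a keeps it positive when b = 0 and turns t a^2 into a b +
   e. *)
have t0 : 0 < (b + e / a) / a by rewrite divr_gt0// ltr_wpDl// divr_gt0.
have := key _ t0.
have e1 : (b + e / a) / a * a ^+ 2 = a * b + e by field.
have e2 : ((b + e / a) / a)^-1 * b ^+ 2 <= a * b.
  have p : 0 < a * b + e by rewrite ltr_wpDl ?mulr_ge0// ltW.
  have -> : ((b + e / a) / a)^-1 = a ^+ 2 / (a * b + e).
    by field; rewrite ane gt_eqF.
  rewrite mulrAC ler_pdivrMr// -exprMn expr2 ler_wpM2l ?mulr_ge0//.
  by rewrite lerDl ltW.
rewrite e1 => h; lra.
Qed.

Lemma cauchy_schwarz f g : L2 f -> L2 g ->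
  normc (cintegral (fun x => f x * g x)) <= nrm f * nrm g.
Proof.
move=> Lf Lg; apply: le_trans (cauchy_schwarz_real Lf Lg).
apply: le_trans (normc_cintegral (L2_mul_cintegrable Lf Lg)) _.
by under eq_Rintegral do rewrite Normc.normcM.
Qed.

Lemma nrmD f g : L2 f -> L2 g -> nrm (fun x => f x + g x) <= nrm f + nrm g.
Proof.
move=> Lf Lg; rewrite -(ler_pXn2r (n := 2)) ?nnegrE ?addr_ge0 ?nrm_ge0//.
rewrite sqrrD !sqr_nrm.
apply: (@le_trans _ _ (sqint f + sqint g +
    2 * \int[mu]_(x in [set: R]) (normc (f x) * normc (g x)))).
  rewrite /sqint -RintegralZl//; last exact: L2_mul_rintegrable.
  rewrite -RintegralD//; [|exact: L2_rintegrable|exact: L2_rintegrable].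
  rewrite -RintegralD//; [|by apply: rintegrableD; exact: L2_rintegrable|
    exact/rintegrableZ/L2_mul_rintegrable].
  apply: le_Rintegral => //; [exact: L2_rintegrable (L2D Lf Lg)|
    apply: rintegrableD; [by apply: rintegrableD; exact: L2_rintegrable|
    exact/rintegrableZ/L2_mul_rintegrable]|].
  move=> x _; apply: (@le_trans _ _ ((normc (f x) + normc (g x)) ^+ 2)).
    by rewrite lerXn2r ?nnegrE ?addr_ge0 ?normc_ge0// le_normcD.
  lra.
have := cauchy_schwarz_real Lf Lg; lra.
Qed.

Lemma nrm_triangle g f h : L2 f -> L2 g -> L2 h ->
  nrm (fun x => f x - h x) <= nrm (fun x => f x - g x) + nrm (fun x => g x - h x).
Proof.
move=> Lf Lg Lh; have := nrmD (L2B Lf Lg) (L2B Lg Lh).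
by under eq_fun do rewrite addrA subrK.
Qed.

Lemma ae_nrm f g : cmeasurable f -> cmeasurable g -> ae_same f g -> nrm f = nrm g.
Proof.
move=> mf mg fg; congr Num.sqrt; apply: ae_rintegral;
  try exact: measurable_sqr_normc.
by apply: aeS fg => x ->.
Qed.

Lemma nrm_eq0_ae f g : L2 f -> L2 g -> nrm (fun x => f x - g x) = 0 ->
  ae_same f g.
Proof.
move=> Lf Lg /eqP; have Lfg := L2B Lf Lg.
rewrite sqrtr_eq0 le_eqVlt ltNge sqint_ge0 orbF => /eqP s0.
have : (sqint (fun x => f x - g x))%:E = 0%E by rewrite s0.
rewrite rintegralE; last exact: L2_rintegrable.
have -> : (\int[mu]_(x in [set: R]) (normc (f x - g x) ^+ 2)%:E =
   \int[mu]_(x in [set: R]) `|(normc (f x - g x) ^+ 2)%:E|)%E.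
  by apply: eq_integral => x _ /=; rewrite ger0_norm ?sqr_ge0.
move/(ae_eq_integral_abs mu measurableT) => h.
have := h ltac:(apply/measurable_EFinP; apply: measurable_sqr_normc; exact: L2_cmeasurable).
apply: aeS => x /(_ I) /= [] /eqP.
by rewrite sqrf_eq0 normc_eq0 subr_eq0 => /eqP.
Qed.

Lemma ae_same_nrm f g : cmeasurable f -> cmeasurable g -> ae_same f g ->
  nrm (fun x => f x - g x) = 0.
Proof.
move=> mf mg fg.
rewrite (@ae_nrm _ (fun=> 0)); [|exact: cmeasurableB|exact: cmeasurable_cst|].
  exact: nrm0.
by apply: aeS fg => x ->; rewrite subrr.
Qed.

Lemma ae_sameC f g : ae_same f g -> ae_same g f.
Proof. exact: aeS. Qed.

End L2Space.

(** * Improper integrals over the whole line *)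

Section LineFTC.
Context {R : realType}.
Local Notation mu := (@lebesgue_measure R).

(** The half-line statement is used twice, on the left half after the reflection x -> -x, where the
    antiderivative becomes -F(-x). Nonnegativity of [f] stands in for integrability, which is thus
    obtained rather than assumed. *)
Lemma ge0_continuous_FTC_line (f F : R -> R) (l l' : R) :
  (forall x, 0 <= f x) -> continuous f ->
  (forall x : R, is_derive x 1 F (f x)) ->
  F x @[x --> +oo] --> l -> F x @[x --> -oo] --> l' ->
  (\int[mu]_(x in [set: R]) (f x)%:E = (l - l')%:E)%E.
Proof.
move=> f0 cf dF Fl Fl'.
have mf : measurable_fun [set: R] f by exact: continuous_measurable_fun.
have cF : continuous F.
  by move=> x; apply/differentiable_continuous/derivable1_diffP; case: (dF x).
have mpos : measurable [set x : R | 0 <= x] by rewrite -set_itvcy.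
rewrite -(setUv [set x : R | 0 <= x]) ge0_integral_setU//= ; last 4 first.
  exact: measurableC.
  by apply/measurable_EFinP; rewrite setUv.
  by move=> x _; rewrite lee_fin.
  exact/disj_setPCl.
rewrite -set_itvcy// setCitvr.
rewrite integral_itv_bndo_bndc; last exact/measurable_EFinP/measurable_funTS.
rewrite -{2}oppr0 ge0_integration_by_substitutionNy//; last 1 first.
- exact: continuous_subspaceT.
rewrite (@ge0_continuous_FTC2y R f F 0 l)//; last 3 first.
- exact: continuous_subspaceT.
- by apply: cvg_at_right_filter; exact: cF.
- by move=> x _; rewrite derive1E derive_val.
have dG (x : R) : is_derive x 1 (fun x => - F (- x)) (f (- x)).
  have h : is_derive (- x) 1 F (f (- x)) := dF (- x).
  have := @is_derive1_comp R F (@GRing.opp R) x (f (- x)) (- 1) h.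
  move=> /(_ (@is_deriveNid R _ _ _)) h2.
  apply: is_derive_eq (is_deriveN h2) _; by rewrite mulrN1 opprK.
rewrite (@ge0_continuous_FTC2y R _ (fun x => - F (- x)) 0 (- l'))//.
- by rewrite oppr0 -!EFinD; congr EFin; lra.
- by move=> x _ /=.
- apply: continuous_subspaceT => x.
  by apply: continuous_comp; [exact: opp_continuous|exact: cf].
- by apply: cvgN; move/cvgNy_compNP : Fl'.
- apply: cvg_at_right_filter; apply: cvgN; apply: continuous_comp.
    exact: opp_continuous.
  exact: cF.
- by move=> x _; rewrite derive1E derive_val.
Qed.

End LineFTC.

(** * The functions e_k *)

Section BasisFunctions.
Context {R : realType}.

(* The basis functions are restrictions to the line of the rational functions
   [ebasis k], holomorphic on the upper half-plane. *)
Definition den (w : R[i]) : R[i] := 2^-1%:C%C - 'i%C * w.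
(** The Cayley transform of the upper half-plane onto the unit disc, in the form 1/d - 1 with the
    single denominator d = [den w]; [cayleyE] gives the usual quotient. *)
Definition cayley (w : R[i]) : R[i] := (den w)^-1 - 1.
Definition ebasis (k : nat) (w : R[i]) : R[i] := cayley w ^+ k / den w.

Definition upt (x y : R) : R[i] := (x +i* y)%C.

Lemma den_upt x y : den (upt x y) = Complex (2^-1 + y) (- x).
Proof. by apply/eqP; rewrite eq_complex /=; apply/andP; split; apply/eqP; ring. Qed.

Lemma normc_den x y : normc (den (upt x y)) ^+ 2 = (2^-1 + y) ^+ 2 + x ^+ 2.
Proof. by rewrite den_upt normc_sqrE /= sqrrN. Qed.

Lemma den_neq0 x y : 0 <= y -> den (upt x y) != 0.
Proof.
move=> y0; rewrite den_upt eq_complex /= negb_and; apply/orP; left.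
by rewrite gt_eqF// ltr_wpDr// invr_gt0.
Qed.

Lemma cayleyE w : den w != 0 -> cayley w = (2^-1%:C%C + 'i%C * w) / den w.
Proof.
move=> d0; apply: (mulIf d0); rewrite /cayley mulrBl mulVf// mul1r mulfVK//.
have -> : (1 : R[i]) = 2^-1%:C%C + 2^-1%:C%C.
  by apply/eqP; rewrite eq_complex /=; apply/andP; split; apply/eqP; field.
by rewrite /den; ring.
Qed.

Lemma zmapE x : zmap x = cayley (upt x 0).
Proof.
rewrite cayleyE ?den_neq0// den_upt addr0 /zmap; congr (_ / _).
by apply/eqP; rewrite eq_complex /=; apply/andP; split; apply/eqP; ring.
Qed.

Lemma basis_funE k x : basis_fun k x = ebasis k (upt x 0).
Proof. by rewrite /basis_fun zmapE /ebasis den_upt addr0. Qed.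

Lemma le_normc_den x y : 0 <= y -> normc (den (upt x 0)) <= normc (den (upt x y)).
Proof.
move=> y0; rewrite -(ler_pXn2r (n := 2)) ?nnegrE ?normc_ge0// !normc_den addr0.
by rewrite lerD2r lerXn2r ?nnegrE ?addr_ge0 ?invr_ge0// lerDl.
Qed.

Lemma normc_den_ge x y : 0 <= y -> 2^-1 + y <= normc (den (upt x y)).
Proof.
move=> y0; rewrite -(ler_pXn2r (n := 2)) ?nnegrE ?addr_ge0 ?normc_ge0 ?invr_ge0//.
by rewrite normc_den lerDl sqr_ge0.
Qed.

Lemma normc_cayley x y : 0 <= y ->
  normc (cayley (upt x y)) ^+ 2 =
  ((2^-1 - y) ^+ 2 + x ^+ 2) / ((2^-1 + y) ^+ 2 + x ^+ 2).
Proof.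
move=> y0; rewrite cayleyE ?den_neq0// Normc.normcM Normc.normcV exprMn exprVn.
by rewrite normc_den normc_sqrE /=; congr (_ / _); ring.
Qed.

Lemma normc_cayley_le1 x y : 0 <= y -> normc (cayley (upt x y)) <= 1.
Proof.
move=> y0; rewrite -(ler_pXn2r (n := 2)) ?nnegrE ?normc_ge0// normc_cayley//.
have p : 0 < (2^-1 + y) ^+ 2 + x ^+ 2.
  by rewrite ltr_wpDr ?sqr_ge0// exprn_gt0// ltr_wpDr.
by rewrite expr1n ler_pdivrMr// mul1r; nra.
Qed.

Lemma normc_cayley_lt1 x y : 0 < y -> normc (cayley (upt x y)) < 1.
Proof.
move=> y0; rewrite -(ltr_pXn2r (n := 2)) ?nnegrE ?normc_ge0// normc_cayley ?ltW//.
have p : 0 < (2^-1 + y) ^+ 2 + x ^+ 2.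
  by rewrite ltr_wpDr ?sqr_ge0// exprn_gt0// ltr_wpDr// ltW.
by rewrite expr1n ltr_pdivrMr// mul1r; nra.
Qed.

Lemma normc_zmap (x : R) : normc (zmap x) = 1.
Proof.
apply/eqP; rewrite -(eqrXn2 (n := 2)) ?normc_ge0// zmapE normc_cayley//.
rewrite subr0 addr0 expr1n divff// gt_eqF//.
by rewrite ltr_wpDr ?sqr_ge0// exprn_gt0// invr_gt0.
Qed.

Lemma conj_zmap (x : R) : conjc (zmap x) = (zmap x)^-1.
Proof.
have z0 : zmap x != 0 by rewrite -normc_eq0 normc_zmap oner_eq0.
by apply: (mulfI z0); rewrite mul_conjc normc_zmap expr1n divff.
Qed.

Lemma zmap_neq0 (x : R) : zmap x != 0.
Proof. by rewrite -normc_eq0 normc_zmap oner_eq0. Qed.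

(** One majorant for all [k] and all heights: |[cayley]| is at most 1, and |[den]| can only grow
    with the height. *)
Lemma normc_ebasis_le k x y : 0 <= y ->
  normc (ebasis k (upt x y)) <= normc (basis_fun 0 x).
Proof.
move=> y0; rewrite basis_funE /ebasis expr0 mul1r Normc.normcM normcX Normc.normcV.
rewrite -[leRHS]mul1r ler_pM ?exprn_ge0 ?invr_ge0 ?normc_ge0//.
  by rewrite exprn_ile1 ?normc_ge0 ?normc_cayley_le1.
rewrite Normc.normcV lef_pV2 ?posrE ?le_normc_den// normc_gt0 den_neq0//.
Qed.

Lemma normc_basis_fun k (x : R) : normc (basis_fun k x) = normc (basis_fun 0 x).
Proof.
by rewrite /basis_fun !Normc.normcM !normcX normc_zmap !expr1n.
Qed.

Lemma sqr_normc_basis_fun k (x : R) :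
  normc (basis_fun k x) ^+ 2 = (4^-1 + x ^+ 2)^-1.
Proof.
rewrite normc_basis_fun basis_funE /ebasis expr0 mul1r Normc.normcV exprVn.
by rewrite normc_den addr0; congr (_ ^-1); field.
Qed.

Lemma zmap_basis0 (x : R) : 1 + zmap x = basis_fun 0 x.
Proof. by rewrite zmapE basis_funE /ebasis /cayley expr0 mul1r; ring. Qed.

Lemma basis_funS k (x : R) : basis_fun k.+1 x = zmap x * basis_fun k x.
Proof. by rewrite /basis_fun exprS mulrA. Qed.

End BasisFunctions.

(** * Orthogonality of the e_k by explicit antiderivatives *)

Section Orthogonality.
Context {R : realType}.
Local Notation mu := (@lebesgue_measure R).

(* The library instances are stated for the ring of functions; these forms
   apply to pointwise expressions and leave the derivative to be matched. *)
Lemma is_deriveD_pt (f g : R -> R) (x a b c : R) : is_derive x 1 f a ->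
  is_derive x 1 g b -> a + b = c -> is_derive x 1 (fun t => f t + g t) c.
Proof. by move=> df dg <-; exact: (is_deriveD df dg). Qed.

Lemma is_deriveB_pt (f g : R -> R) (x a b c : R) : is_derive x 1 f a ->
  is_derive x 1 g b -> a - b = c -> is_derive x 1 (fun t => f t - g t) c.
Proof. by move=> df dg <-; exact: (is_deriveB df dg). Qed.

Lemma is_deriveM_pt (f g : R -> R) (x a b c : R) : is_derive x 1 f a ->
  is_derive x 1 g b -> f x * b + g x * a = c ->
  is_derive x 1 (fun t => f t * g t) c.
Proof. by move=> df dg <-; exact: (is_deriveM df dg). Qed.

Lemma is_deriveZ_pt (k : R) (f : R -> R) (x a c : R) : is_derive x 1 f a ->
  k * a = c -> is_derive x 1 (fun t => k * f t) c.
Proof. by move=> df <-; exact: (is_deriveZ k df). Qed.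

(** Besides being the common value of |e_k|^2, this is the density of arc length on the circle
    pulled back by [zmap]: if z = exp(i theta), then d theta = [qker] dx, with theta = 2
    atan(2x). *)
Definition qker (x : R) : R := (4^-1 + x ^+ 2)^-1.

Lemma qker_gt0 x : 0 < qker x.
Proof. by rewrite invr_gt0 ltr_wpDr ?sqr_ge0// invr_gt0. Qed.

Lemma qker_ge0 x : 0 <= qker x.
Proof. exact/ltW/qker_gt0. Qed.

Lemma qkerN x : qker (- x) = qker x.
Proof. by rewrite /qker sqrrN. Qed.

Lemma qden_neq0 (x : R) : 4^-1 + x ^+ 2 != 0.
Proof. by rewrite gt_eqF// -invr_gt0 qker_gt0. Qed.

Lemma qden4_neq0 (x : R) : 1 + x ^+ 2 * 4 != 0.
Proof. by rewrite gt_eqF// ltr_wpDr// mulr_ge0 ?sqr_ge0. Qed.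

Lemma zmap_qker (x : R) : zmap x = Complex (qker x / 2 - 1) (x * qker x).
Proof.
have q0 := qden_neq0 x.
rewrite zmapE /cayley den_upt addr0 /qker.
have q1 : (2^-1 ^+ 2 + (- x) ^+ 2 : R) = 4^-1 + x ^+ 2 by field.
apply/eqP; rewrite eq_complex /= q1.
by apply/andP; split; apply/eqP; field; exact: qden4_neq0.
Qed.

Lemma is_derive_qker (x : R) : is_derive x 1 qker (- 2 * x * qker x ^+ 2).
Proof.
have q0 := qden_neq0 x.
have h : is_derive x 1 (fun x : R => 4^-1 + x ^+ 2) (2 * x).
  apply: (is_deriveD_pt (is_derive_cst _ _ _)
    (is_deriveM_pt (is_derive_id _ _) (is_derive_id _ _) erefl)).
  by rewrite add0r /=; ring.
have h2 := is_deriveV (f := fun x : R => 4^-1 + x ^+ 2) q0 h; apply: is_derive_eq h2 _.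
by rewrite /GRing.scale /= /qker; field; exact: qden4_neq0.
Qed.

Lemma Re_zmapXS k (x : R) : complex.Re (zmap x ^+ k.+1) =
  (qker x / 2 - 1) * complex.Re (zmap x ^+ k) -
  (x * qker x) * complex.Im (zmap x ^+ k).
Proof. by rewrite exprS ReM zmap_qker. Qed.

Lemma Im_zmapXS k (x : R) : complex.Im (zmap x ^+ k.+1) =
  (qker x / 2 - 1) * complex.Im (zmap x ^+ k) +
  (x * qker x) * complex.Re (zmap x ^+ k).
Proof. by rewrite exprS ImM zmap_qker. Qed.

(** In complex form, (z^k)' = i k [qker] z^k. Both parts are proved together because multiplication
    by z mixes them. *)
Lemma is_derive_zmapX k (x : R) :
  is_derive x 1 (fun x => complex.Re (zmap x ^+ k))
    (- k%:R * complex.Im (zmap x ^+ k) * qker x) /\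
  is_derive x 1 (fun x => complex.Im (zmap x ^+ k))
    (k%:R * complex.Re (zmap x ^+ k) * qker x).
Proof.
have q0 := qden_neq0 x.
have qE : qker x * (4^-1 + x ^+ 2) = 1 by rewrite mulVf.
have da : is_derive x 1 (fun x : R => qker x / 2 - 1) (- (x * qker x) * qker x).
  apply: (@is_deriveB_pt (fun t => qker t / 2) (fun=> 1)).
  - exact: (is_deriveM_pt (is_derive_qker x) (is_derive_cst (2^-1 : R) _ _) erefl).
  - by rewrite /=; field.
have db : is_derive x 1 (fun x : R => x * qker x) ((qker x / 2 - 1) * qker x).
  apply: (is_deriveM_pt (is_derive_id x 1) (is_derive_qker x)) => /=.
  move: qE; set q := qker x => qE.
  have -> : x * (- 2 * x * q ^+ 2) + q * 1 =
    - 2 * (q * (4^-1 + x ^+ 2)) * q + q + 2^-1 * q ^+ 2 by field.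
  by rewrite qE; field.
elim: k => [|k [IA IB]].
  under eq_fun do rewrite expr0; under [X in _ /\ is_derive _ _ X _]eq_fun do rewrite expr0.
  by rewrite oppr0 !mul0r; split; exact: is_derive_cst.
rewrite Re_zmapXS Im_zmapXS; under eq_fun do rewrite Re_zmapXS.
under [X in _ /\ is_derive _ _ X _]eq_fun do rewrite Im_zmapXS.
split.
  apply: (is_deriveB_pt (is_deriveM_pt da IA erefl) (is_deriveM_pt db IB erefl)).
  by rewrite -natr1; ring.
apply: (is_deriveD_pt (is_deriveM_pt da IB erefl) (is_deriveM_pt db IA erefl)).
by rewrite -natr1; ring.
Qed.

Lemma continuous_Re_zmapX k : continuous (fun x : R => complex.Re (zmap x ^+ k)).
Proof.
move=> x; apply/differentiable_continuous/derivable1_diffP.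
by case: (is_derive_zmapX k x) => -[].
Qed.

Lemma continuous_Im_zmapX k : continuous (fun x : R => complex.Im (zmap x ^+ k)).
Proof.
move=> x; apply/differentiable_continuous/derivable1_diffP.
by case: (is_derive_zmapX k x) => _ [].
Qed.

Lemma continuous_qker : continuous qker.
Proof.
move=> x; apply/differentiable_continuous/derivable1_diffP.
by case: (is_derive_qker x).
Qed.

Lemma qker_cvgy : qker x @[x --> +oo] --> (0 : R) /\ x * qker x @[x --> +oo] --> (0 : R).
Proof.
have iv : x^-1 @[x --> +oo] --> (0 : R).
  by apply/gtr0_cvgV0 => //; exact: nbhs_pinfty_gt.
have h : x * qker x @[x --> +oo] --> (0 : R).
  apply: (@squeeze_cvgr _ _ _ _ (fun=> 0) (fun x => x^-1)) => //; last exact: cvg_cst.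
  near=> x; have x0 : 0 < x by near: x; exact: nbhs_pinfty_gt.
  apply/andP; split; first by rewrite mulr_ge0 ?qker_ge0.
  rewrite /qker ler_pdivrMr; last by rewrite -invr_gt0 qker_gt0.
  by rewrite mulrDr expr2 mulrA mulVf ?gt_eqF// mul1r ler_wpDl// mulr_ge0 ?invr_ge0 ?ltW.
split=> //.
have -> : (0 : R) = 0 * 0 by rewrite mulr0.
apply: cvg_trans (cvgM iv h); apply: near_eq_cvg; near=> x.
by rewrite /= mulrA mulVf ?mul1r// gt_eqF//; near: x; exact: nbhs_pinfty_gt.
Unshelve. all: by end_near. Qed.

Lemma zmapX_cvgy k :
  complex.Re (zmap x ^+ k) @[x --> +oo] --> ((-1) ^+ k : R) /\
  complex.Im (zmap x ^+ k) @[x --> +oo] --> (0 : R).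
Proof.
have [q0 xq0] := qker_cvgy.
elim: k => [|k [IA IB]].
  by split; under eq_fun do rewrite expr0 /=; exact: cvg_cst.
have ca : (fun x => qker x / 2 - 1) x @[x --> +oo] --> (-1 : R).
  have := cvgB (cvgM q0 (cvg_cst (2^-1 : R))) (cvg_cst (1 : R)).
  by rewrite mul0r add0r; apply.
split.
  under eq_fun do rewrite Re_zmapXS.
  have -> : (-1) ^+ k.+1 = -1 * (-1) ^+ k - 0 * 0 :> R.
    by rewrite exprS mulr0 subr0.
  by apply: cvgB; apply: cvgM.
under eq_fun do rewrite Im_zmapXS.
have -> : 0 = -1 * 0 + 0 * (-1) ^+ k :> R by rewrite mulr0 mul0r addr0.
by apply: cvgD; apply: cvgM.
Qed.

Lemma zmapN (x : R) : zmap (- x) = conjc (zmap x).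
Proof. by rewrite !zmap_qker qkerN /= mulNr. Qed.

Lemma zmapX_cvgNy k :
  complex.Re (zmap x ^+ k) @[x --> -oo] --> ((-1) ^+ k : R) /\
  complex.Im (zmap x ^+ k) @[x --> -oo] --> (0 : R).
Proof.
have [h1 h2] := zmapX_cvgy k; split; apply/cvgNy_compNP.
  rewrite (_ : _ \o _ = fun x : R => complex.Re (zmap x ^+ k))//.
  by apply/funext => x /=; rewrite zmapN -conjcX Re_conj.
rewrite (_ : _ \o _ = fun x : R => - complex.Im (zmap x ^+ k)); last first.
  by apply/funext => x /=; rewrite zmapN -conjcX Im_conj.
by have := cvgN h2; rewrite oppr0; apply.
Qed.

Lemma is_derive_atan2 (x : R) : is_derive x 1 (fun x : R => 2 * atan (2 * x)) (qker x).
Proof.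
have h : is_derive x 1 (fun x : R => 2 * x) 2.
  by apply: (is_deriveZ_pt (is_derive_id x 1)); rewrite mulr1.
have := @is_derive1_comp R atan (fun x : R => 2 * x) x _ _ (is_derive1_atan (2 * x)) h.
move=> h2; apply: (is_deriveZ_pt h2); rewrite /qker.
have q0 := qden_neq0 x.
by field; exact: qden4_neq0.
Qed.

Lemma atan2_cvg : (fun x : R => 2 * atan (2 * x)) x @[x --> +oo] --> pi /\
  (fun x : R => 2 * atan (2 * x)) x @[x --> -oo] --> - pi.
Proof.
have h : (fun x : R => 2 * atan (2 * x)) x @[x --> +oo] --> pi.
  have -> : (pi : R) = 2 * (pi / 2) by field.
  apply: cvgMr; apply: (@cvg_comp _ _ _ (fun x : R => 2 * x) atan _ +oo); last exact: cvgy_atan.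
  exact: gt0_cvgMry.
split=> //; apply/cvgNy_compNP.
rewrite (_ : _ \o _ = fun x : R => - (2 * atan (2 * x))); first exact: cvgN.
by apply/funext => x /=; rewrite mulrN atanN mulrN.
Qed.

(** Adding 1 to [h] makes the integrand nonnegative, so that the fundamental theorem on the line
    applies to 2 atan(2x) + H. As [H] has the same limit at both ends, only the arctangent
    contributes. *)
Lemma integral_qker_comb (h H : R -> R) (l : R) : continuous h ->
  (forall x, `|h x| <= 1) ->
  (forall x : R, is_derive x 1 H (h x * qker x)) ->
  H x @[x --> +oo] --> l -> H x @[x --> -oo] --> l ->
  (\int[mu]_(x in [set: R]) ((1 + h x) * qker x)%:E = (2 * pi)%:E)%E.
Proof.
move=> ch h1 dH Hl Hl'; have [c1 c2] := atan2_cvg.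
have -> : 2 * pi = (pi + l) - (- pi + l) by ring.
apply: (@ge0_continuous_FTC_line _ _ (fun x : R => 2 * atan (2 * x) + H x)).
- move=> x; rewrite mulr_ge0 ?qker_ge0//.
  by have := h1 x; rewrite ler_norml => /andP[]; lra.
- move=> x; apply: cvgM; last exact: continuous_qker.
  by apply: cvgD; [exact: cvg_cst|exact: ch].
- move=> x; have d1 := is_derive_atan2 x; have d2 := dH x.
  by apply: (is_deriveD_pt d1 d2); rewrite mulrDl mul1r.
- exact: cvgD.
- exact: cvgD.
Qed.

Lemma rintegrable_qker : rintegrable qker /\ \int[mu]_(x in [set: R]) qker x = 2 * pi.
Proof.
have := @integral_qker_comb (fun=> 0) (fun=> 0) 0.
have c0 : continuous (fun _ : R => 0 : R) by move=> x; exact: cst_continuous.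
move=> /(_ c0) H.
have {}H := H ltac:(by move=> x; rewrite normr0) ltac:(by move=> x; rewrite mul0r; exact: is_derive_cst) (cvg_cst _) (cvg_cst _).
have {}H : (\int[mu]_(x in [set: R]) (qker x)%:E = (2 * pi)%:E)%E.
  by rewrite -H; apply: eq_integral => x _; rewrite addr0 mul1r.
split; last by rewrite /Rintegral H.
apply/integrableP; split.
  apply/measurable_EFinP; exact: (continuous_measurable_fun continuous_qker).
rewrite (_ : (\int[mu]_x _)%E = (2 * pi)%:E) ?ltry// -H.
by apply: eq_integral => x _ /=; rewrite ger0_norm// ltW// qker_gt0.
Qed.

Lemma integral_qker_osc (h H : R -> R) (l : R) : continuous h ->
  (forall x, `|h x| <= 1) ->
  (forall x : R, is_derive x 1 H (h x * qker x)) ->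
  H x @[x --> +oo] --> l -> H x @[x --> -oo] --> l ->
  \int[mu]_(x in [set: R]) (h x * qker x) = 0.
Proof.
move=> ch h1 dH Hl Hl'; have := integral_qker_comb ch h1 dH Hl Hl'.
have [iq qE] := rintegrable_qker.
have ih : rintegrable (fun x => h x * qker x).
  apply: (rintegrable_le _ _ iq) => [|x].
    apply: continuous_measurable_fun => x.
    by apply: cvgM; [exact: ch|exact: continuous_qker].
  by rewrite normrM (ger0_norm (qker_ge0 x)) ler_piMl ?qker_ge0.
have e : (fun x => (1 + h x) * qker x) = (fun x => qker x + h x * qker x).
  by apply/funext => x; rewrite mulrDl mul1r.
rewrite (_ : (\int[mu]_x _)%E = (\int[mu]_(x in [set: R]) (qker x + h x * qker x))%:E).
  by move=> []; rewrite RintegralD// qE; lra.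
by rewrite rintegralE; [under eq_integral do rewrite mulrDl mul1r|exact: rintegrableD].
Qed.

Lemma cmeasurable_zmapX k : cmeasurable (fun x : R => zmap x ^+ k).
Proof.
by split; apply: continuous_measurable_fun;
  [exact: continuous_Re_zmapX|exact: continuous_Im_zmapX].
Qed.

Lemma measurable_qker : measurable_fun [set: R] qker.
Proof. exact: continuous_measurable_fun continuous_qker. Qed.

Lemma cmeasurable_real (h : R -> R) : measurable_fun [set: R] h ->
  cmeasurable (fun x => (h x)%:C%C).
Proof. by move=> mh; split => //; exact: measurable_cst. Qed.

Lemma cintegrable_bounded_qker (f : R -> R[i]) (M : R) : cmeasurable f ->
  (forall x, normc (f x) <= M) -> cintegrable (fun x => f x * (qker x)%:C%C).
Proof.
move=> mf fM; apply: (@cintegrable_le _ _ (fun x => M * qker x)).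
- by apply: cmeasurableM => //; apply: cmeasurable_real; exact: measurable_qker.
- move=> x; rewrite Normc.normcM normc_real ger0_norm ?qker_ge0//.
  by rewrite ler_pM2r ?qker_gt0.
- by apply: rintegrableZ; case: rintegrable_qker.
Qed.

Lemma normc_zmapX k (x : R) : normc (zmap x ^+ k) = 1.
Proof. by rewrite normcX normc_zmap expr1n. Qed.

Lemma cintegrable_zmapX k : cintegrable (fun x : R => zmap x ^+ k * (qker x)%:C%C).
Proof.
apply: (@cintegrable_bounded_qker _ 1); first exact: cmeasurable_zmapX.
by move=> x; rewrite normc_zmapX.
Qed.

(** For positive [k] the antiderivative z^k / (i k) has equal limits at both ends of the line, since
    z tends to -1 at each of them. *)
Lemma cintegral_zmapX k : cintegral (fun x : R => zmap x ^+ k * (qker x)%:C%C) =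
  (2 * pi * (k == 0)%:R)%:C%C.
Proof.
case: k => [|k].
  rewrite /cintegral; apply/eqP; rewrite eq_complex/= mulr1; apply/andP; split; apply/eqP.
    have [_ <-] := rintegrable_qker; apply: eq_Rintegral => x _ /=.
    by rewrite mul0r subr0 mul1r.
  rewrite /Rintegral (_ : (\int[mu]_x _)%E = 0%E)//.
  by apply: integral0_eq => x _ /=; rewrite mul0r mulr0 addr0.
have k0 : (k.+1%:R : R) != 0 by rewrite pnatr_eq0.
have [a1 b1] := zmapX_cvgy k.+1; have [a2 b2] := zmapX_cvgNy k.+1.
rewrite /cintegral mulr0; congr Complex.
  under eq_Rintegral do rewrite ReM /= mulr0 subr0.
  apply: (@integral_qker_osc _ (fun x => k.+1%:R^-1 * complex.Im (zmap x ^+ k.+1)) (k.+1%:R^-1 * 0)).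
  - exact: continuous_Re_zmapX.
  - by move=> x; rewrite (le_trans (normc_Re _))// normc_zmapX.
  - move=> x; have [_ d] := is_derive_zmapX k.+1 x.
    by apply: (is_deriveZ_pt d); rewrite -mulrA mulKf.
  - exact: cvgMr.
  - exact: cvgMr.
under eq_Rintegral do rewrite ImM /= mulr0 add0r.
apply: (@integral_qker_osc _ (fun x => - k.+1%:R^-1 * complex.Re (zmap x ^+ k.+1)) (- k.+1%:R^-1 * (-1) ^+ k.+1)).
- exact: continuous_Im_zmapX.
- by move=> x; rewrite (le_trans (normc_Im _))// normc_zmapX.
- move=> x; have [d _] := is_derive_zmapX k.+1 x.
  by apply: (is_deriveZ_pt d); rewrite !mulNr mulrN opprK -mulrA mulKf.
- exact: cvgMr.
- exact: cvgMr.
Qed.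

(** The additional factor z comes from 1 / (1/2 - i x)^2 = z(x) / (1/4 + x^2). It is the origin of
    the exponents k + m + 1 in the system. *)
Lemma basis_fun_mul k m (x : R) :
  basis_fun k x * basis_fun m x = zmap x ^+ (k + m + 1) * (qker x)%:C%C.
Proof.
have q0 := qden_neq0 x.
have zq : zmap x * (qker x)%:C%C = (den (upt x 0))^-1 * (den (upt x 0))^-1.
  have q1 : (2^-1 ^+ 2 + (- x) ^+ 2 : R) = 4^-1 + x ^+ 2 by field.
  rewrite zmap_qker den_upt addr0 /qker.
  apply/eqP; rewrite eq_complex /= q1.
  by apply/andP; split; apply/eqP; field; exact: qden4_neq0.
rewrite [RHS](_ : _ = zmap x ^+ k * zmap x ^+ m * (zmap x * (qker x)%:C%C)).
  by rewrite zq !basis_funE /ebasis -zmapE; ring.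
by rewrite !exprD expr1 !mulrA.
Qed.

Lemma basis_fun_mul_conj k m (x : R) :
  basis_fun (k + m) x * conjc (basis_fun m x) = zmap x ^+ k * (qker x)%:C%C.
Proof.
rewrite /basis_fun exprD -!mulrA [X in _ * X]mulrA.
have -> : zmap x ^+ m / (2^-1 -i* x)%C * conjc (zmap x ^+ m / (2^-1 -i* x)%C) =
  (qker x)%:C%C; last by [].
rewrite -[X in X * _]/(basis_fun m x) mul_conjc.
by rewrite sqr_normc_basis_fun.
Qed.

Lemma L2_basis_fun k : L2 (@basis_fun R k).
Proof.
have mb : cmeasurable (@basis_fun R k).
  have -> : @basis_fun R k = fun x => zmap x ^+ k * (1 + zmap x).
    by apply/funext => x; rewrite zmap_basis0 /basis_fun expr0 mul1r.
  apply: cmeasurableM; first exact: cmeasurable_zmapX.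
  apply: cmeasurableD; first exact: cmeasurable_cst.
  by have := cmeasurable_zmapX 1; under eq_fun do rewrite expr1.
apply/L2P; split=> //; under eq_fun do rewrite sqr_normc_basis_fun.
by case: rintegrable_qker.
Qed.

Definition dotp (f g : R -> R[i]) := cintegral (fun x => f x * conjc (g x)).

Lemma dotp_basis k m :
  dotp (basis_fun k) (basis_fun m) = (2 * pi * (k == m)%:R)%:C%C.
Proof.
rewrite /dotp; have [km|km] := leqP m k.
  have -> : (fun x : R => basis_fun k x * conjc (basis_fun m x)) =
      fun x => zmap x ^+ (k - m) * (qker x)%:C%C.
    by apply/funext => x; rewrite -(basis_fun_mul_conj _ m) subnK.
  by rewrite cintegral_zmapX subn_eq0 eqn_leq km andbT.
have -> : (fun x : R => basis_fun k x * conjc (basis_fun m x)) =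
    fun x => conjc (zmap x ^+ (m - k) * (qker x)%:C%C).
  apply/funext => x; rewrite -(basis_fun_mul_conj _ k) subnK ?(ltnW km)//.
  by rewrite conjcM conjcK mulrC.
rewrite cintegral_conj; last exact: cintegrable_zmapX.
by rewrite cintegral_zmapX subn_eq0 leqNgt km (ltn_eqF km) mulr0 /= oppr0.
Qed.

(** Without conjugation the exponent k + m + 1 is never 0, so every e_k is orthogonal to every
    conjugate of e_m. This vanishing is what will single out L_2^+ inside L_2. *)
Lemma cintegral_basis_mul k m :
  cintegral (fun x : R => basis_fun k x * basis_fun m x) = 0.
Proof.
under eq_fun do rewrite basis_fun_mul.
by rewrite cintegral_zmapX addn1 mulr0.
Qed.

End Orthogonality.

(** * Completeness and orthogonal expansions *)

Section LimitHelpers.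
Context {R : realType}.

Lemma cvg0_seqP (u : R^nat) : (forall n, 0 <= u n) ->
  u n @[n --> \oo] --> (0 : R) <->
  forall e, 0 < e -> exists N, forall n, (N <= n)%N -> u n < e.
Proof.
move=> u0; split=> [/cvgrPdist_lt h e e0|h].
  have [N _ hN] := h e e0; exists N => n Nn.
  by have := hN n Nn; rewrite /= sub0r normrN ger0_norm.
apply/cvgrPdist_lt => e e0; have [N hN] := h e e0.
by exists N => // n /= Nn; rewrite sub0r normrN ger0_norm// hN.
Qed.

Lemma bounded_variation_cvg (r : R^nat) (B : R) :
  (forall n, \sum_(0 <= j < n) `|r j.+1 - r j| <= B) -> cvgn r.
Proof.
move=> hB; have : cvgn (series (telescope r)).
  apply: normed_cvg.
  have : cvgn (fun n => \sum_(0 <= j < n) `|r j.+1 - r j|); last by [].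
  apply: nondecreasing_is_cvgn.
    by apply/nondecreasing_seqP => n; rewrite big_nat_recr//= lerDl.
  by exists B => _ [n _ <-]; exact: hB.
move=> /cvg_ex[l hl]; apply/cvg_ex; exists (r 0%N + l).
have h : r 0%N + series (telescope r) n @[n --> \oo] --> r 0%N + l.
  by apply: cvgD => //; exact: cvg_cst.
by apply: cvg_trans h; apply: near_eq_cvg; apply: nearW => n; exact/esym/eq_sum_telescope.
Qed.

Lemma sum_half n : \sum_(0 <= j < n) (2^-1 : R) ^+ j = 2 - 2 * 2^-1 ^+ n.
Proof.
elim: n => [|n IH]; first by rewrite big_nil expr0; ring.
by rewrite big_nat_recr//= IH exprS; field.
Qed.

End LimitHelpers.

(** * Completeness of L_2 for fast Cauchy sequences *)

Section RieszFischer.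
Context {R : realType}.
Local Notation mu := (@lebesgue_measure R).
Variable u : nat -> R -> R[i].
Hypothesis Lu : forall n, L2 (u n).
Hypothesis u_fast : forall n, nrm (fun x => u n.+1 x - u n x) <= 2^-1 ^+ n.

Let d j x := normc (u j.+1 x - u j x).
Let g n x := \sum_(0 <= j < n) d j x.
(** The square of the total increment at [x], possibly infinite on a null set. It serves as the
    dominating function for |h - u_n|^2. *)
Let K x := limn (fun n => (g n x ^+ 2)%:E).
(** An upper limit is measurable without any convergence; where [K] is finite it is the true limit,
    and elsewhere its value does not matter. *)
Let h x := Complex (fine (limn_esup (fun n => (complex.Re (u n x))%:E)))
                   (fine (limn_esup (fun n => (complex.Im (u n x))%:E))).

Let g_ge0 n x : 0 <= g n x.
Proof. by apply: sumr_ge0 => j _; exact: normc_ge0. Qed.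

Let g_le n m x : (n <= m)%N -> g n x <= g m x.
Proof.
move=> nm; rewrite /g (big_cat_nat (leq0n n) nm)//= lerDl.
by apply: sumr_ge0 => j _; exact: normc_ge0.
Qed.

Let g_L2 n : L2 (fun x => (g n x)%:C%C) /\ nrm (fun x => (g n x)%:C%C) <= 2 - 2 * 2^-1 ^+ n.
Proof.
have Ld j : L2 (fun x => (d j x)%:C%C) /\ nrm (fun x => (d j x)%:C%C) <= 2^-1 ^+ j.
  have L := L2B (Lu j.+1) (Lu j).
  have m : cmeasurable (fun x => (d j x)%:C%C).
    by apply: cmeasurable_real; apply: measurable_normc; exact: L2_cmeasurable.
  have e x : normc (d j x)%:C%C <= normc (u j.+1 x - u j x).
    by rewrite normc_real ger0_norm ?normc_ge0.
  by split; [exact: L2_le L e|exact: le_trans (nrm_le m L e) (u_fast j)].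
rewrite -sum_half; elim: n => [|n [IL IN]].
  rewrite big_nil /g; under eq_fun do rewrite big_nil.
  split; first exact: L2_0.
  by rewrite (nrm0 : nrm (fun=> 0%:C%C) = 0).
have -> : (fun x => (g n.+1 x)%:C%C) = fun x => (g n x)%:C%C + (d n x)%:C%C.
  by apply/funext => x; rewrite /g big_nat_recr//= rmorphD.
have [Ln Nn] := Ld n; split; first exact: L2D.
rewrite big_nat_recr//=; exact: le_trans (nrmD IL Ln) (lerD IN Nn).
Qed.

Let K_ge n x : ((g n x ^+ 2)%:E <= K x)%E.
Proof.
have nd : {homo (fun n => (g n x ^+ 2)%:E) : n m / (n <= m)%N >-> (n <= m)%E}.
  by move=> a b ab; rewrite lee_fin lerXn2r ?nnegrE// g_le.
have /(cvg_lim (@ereal_hausdorff R)) := ereal_nondecreasing_cvgn nd.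
by rewrite /K => ->; apply: ereal_sup_ubound; exists n.
Qed.

(** Monotone convergence: the partial sums [g n] have norm at most 1 + 1/2 + 1/4 + ... = 2, whence
    the 4. *)
Let mK : measurable_fun [set: R] K /\ (\int[mu]_(x in [set: R]) K x <= 4%:E)%E.
Proof.
have mg n : measurable_fun [set: R] (fun x => (g n x ^+ 2)%:E).
  apply/measurable_EFinP; apply: measurable_funX.
  have [/L2_cmeasurable[m _] _] := g_L2 n; exact: m.
have nd x : {homo (fun n => (g n x ^+ 2)%:E) : n m / (n <= m)%N >-> (n <= m)%E}.
  by move=> a b ab; rewrite lee_fin lerXn2r ?nnegrE// g_le.
split.
  have -> : K = fun x => limn_esup (fun n => (g n x ^+ 2)%:E).
    apply/funext => x; rewrite /K is_cvg_limn_esupE//.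
    exact: ereal_nondecreasing_is_cvgn.
  exact: measurable_fun_limn_esup.
have g20 n x : [set: R] x -> (0 <= (g n x ^+ 2)%:E)%E.
  by move=> _; rewrite lee_fin sqr_ge0.
have nd' x : [set: R] x ->
  {homo (fun n => (g n x ^+ 2)%:E) : n m / (n <= m)%N >-> (n <= m)%E} by move=> _; exact: nd.
have c := @cvg_monotone_convergence _ _ _ mu _ measurableT _ mg g20 nd'.
rewrite (monotone_convergence mu measurableT mg g20 nd').
apply: lime_le; first by apply: cvgP c.
apply: nearW => n; have [Lg Ng] := g_L2 n.
have -> : (\int[mu]_(x in [set: R]) (g n x ^+ 2)%:E =
    \int[mu]_(x in [set: R]) (normc (g n x)%:C%C ^+ 2)%:E)%E.
  by apply: eq_integral => x _; rewrite normc_real ger0_norm.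
rewrite -rintegralE; last exact: L2_rintegrable.
rewrite lee_fin -[X in X <= _]/(sqint _) -sqr_nrm.
rewrite (_ : 4 = 2 ^+ 2); last by rewrite -natrX.
rewrite lerXn2r ?nnegrE ?nrm_ge0// (le_trans Ng)// gerBl mulr_ge0// exprn_ge0//.
Qed.

Let iK : mu.-integrable [set: R] K.
Proof.
have [m i] := mK; apply/integrableP; split=> //.
apply: le_lt_trans (ltry 4); apply: le_trans i.
rewrite le_eqVlt; apply/orP; left; apply/eqP; apply: eq_integral => x _.
by rewrite gee0_abs// (le_trans _ (K_ge 0 x))// lee_fin sqr_ge0.
Qed.

Let good x : K x \is a fin_num ->
  [/\ complex.Re (u n x) @[n --> \oo] --> complex.Re (h x),
      complex.Im (u n x) @[n --> \oo] --> complex.Im (h x) &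
      forall n m, normc (u n x - u m x) <= Num.sqrt (fine (K x))].
Proof.
move=> fK; have gB n : g n x <= Num.sqrt (fine (K x)).
  rewrite -[leLHS](ger0_norm (g_ge0 _ _)) -sqrtr_sqr ler_sqrt.
    by rewrite -lee_fin fineK.
  by rewrite -lee_fin fineK// (le_trans _ (K_ge 0 x))// lee_fin sqr_ge0.
have key (p : R[i] -> R) : (forall a b, p (a - b) = p a - p b) ->
    (forall a, `|p a| <= normc a) ->
    (fun n => p (u n x)) n @[n --> \oo] -->
      fine (limn_esup (fun n => (p (u n x))%:E)).
  move=> pB pN; have cv : cvgn (fun n => p (u n x)).
    apply: (@bounded_variation_cvg _ _ (Num.sqrt (fine (K x)))) => n.
    apply: le_trans (gB n); apply: ler_sum => j _.
    by rewrite -pB pN.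
  have /cvg_ex[l hl] := cv.
  have hE : (p (u n x))%:E @[n --> \oo] --> l%:E by apply/cvg_EFin => //; exact: nearW.
  rewrite is_cvg_limn_esupE; last by apply/cvg_ex; exists l%:E.
  by rewrite (cvg_lim _ hE).
split.
- by apply: key normc_Re => a b; rewrite ReD ReN.
- by apply: key normc_Im => a b; rewrite ImD ImN.
move=> n m; wlog nm : n m / (n <= m)%N.
  move=> H; have [/H//|/ltnW/H] := leqP n m.
  by rewrite -normcN opprB.
apply: le_trans (gB m).
have -> : u n x - u m x = - \sum_(n <= j < m) (u j.+1 x - u j x).
  by rewrite telescope_sumr// opprB.
rewrite normcN (le_trans (normc_sum _ _ _))// /g (big_cat_nat (leq0n n) nm)//= lerDr.
by apply: sumr_ge0 => j _; exact: normc_ge0.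
Qed.

(** [K] has a finite integral, so it is finite almost everywhere; there the increments are summable,
    [u n] converges to [h], and [K] dominates |h - u_n|^2. Dominated convergence then gives
    convergence in norm. *)
Lemma L2_complete_fast :
  exists2 f, L2 f & nrm (fun x => f x - u n x) @[n --> \oo] --> (0 : R).
Proof.
have mh : cmeasurable h.
  split; apply: (measurableT_comp (fine_measurable _)) => //;
    apply: measurable_fun_limn_esup => n; apply/measurable_EFinP;
    by have /L2_cmeasurable[] := Lu n.
have mhu n : measurable_fun [set: R] (fun x => (normc (h x - u n x) ^+ 2)%:E).
  apply/measurable_EFinP; apply: measurable_sqr_normc.
  by apply: cmeasurableB => //; exact: L2_cmeasurable.
have aeK : {ae mu, forall x, K x \is a fin_num}.
  by apply: aeS (integrable_ae measurableT iK) => x; exact.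
have K0 x : (0 <= K x)%E by rewrite (le_trans _ (K_ge 0 x))// lee_fin sqr_ge0.
have cvgh x : K x \is a fin_num -> normc (h x - u n x) @[n --> \oo] --> (0 : R).
  move=> /good[hr hi _].
  have hr' : complex.Re (h x) - complex.Re (u n x) @[n --> \oo] --> (0 : R).
    by have := cvgB (cvg_cst (complex.Re (h x))) hr; rewrite subrr; apply.
  have hi' : complex.Im (h x) - complex.Im (u n x) @[n --> \oo] --> (0 : R).
    by have := cvgB (cvg_cst (complex.Im (h x))) hi; rewrite subrr; apply.
  apply: (@squeeze_cvgr _ _ _ _ (fun=> 0) (fun n =>
    `|complex.Re (h x) - complex.Re (u n x)| + `|complex.Im (h x) - complex.Im (u n x)|)).
  - apply: nearW => n; rewrite normc_ge0 -!ReN -!ImN -ReD -ImD.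
    exact: normc_le_ReIm.
  - exact: cvg_cst.
  - by have := cvgD (cvg_norm hr') (cvg_norm hi'); rewrite normr0 addr0; apply.
have bnd x n : K x \is a fin_num -> ((normc (h x - u n x) ^+ 2)%:E <= K x)%E.
  move=> fK; have [_ _ hB] := good fK.
  rewrite -[leRHS]fineK// lee_fin -[fine (K x)]sqr_sqrtr; last by rewrite fine_ge0.
  rewrite lerXn2r ?nnegrE ?normc_ge0 ?sqrtr_ge0//.
  apply/ler_addgt0Pl => e e0.
  have /(cvg0_seqP (fun n => normc_ge0 (h x - u n x)))/(_ e e0)[m hm] := cvgh x fK.
  rewrite -(subrK (u m x) (h x)) -addrA (le_trans (le_normcD _ _))//.
  by rewrite lerD ?hB// ltW// hm.
have cvgh2 : {ae mu, forall x, [set: R] x ->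
    (normc (h x - u n x) ^+ 2)%:E @[n --> \oo] --> 0%E}.
  apply: aeS aeK => x fK _; apply/cvg_EFin; first exact: nearW.
  have c := cvgh x fK.
  have : normc (h x - u n x) * normc (h x - u n x) @[n --> \oo] --> (0 * 0 : R).
    by apply: cvgM.
  by rewrite mulr0.
have bnd2 : {ae mu, forall x, forall n, [set: R] x ->
    (`|(normc (h x - u n x) ^+ 2)%:E| <= K x)%E}.
  by apply: aeS aeK => x fK n _; rewrite gee0_abs ?lee_fin ?sqr_ge0// bnd.
have [_ dc _] := @dominated_convergence _ _ _ mu _ measurableT
  (fun n x => (normc (h x - u n x) ^+ 2)%:E) (fun=> 0%E) K mhu
  (@measurable_cst _ _ _ _ _ _) cvgh2 iK bnd2.
have Lhu n : L2 (fun x => h x - u n x).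
  apply/L2P; split; first by apply: cmeasurableB => //; exact: L2_cmeasurable.
  apply/integrableP; split; first exact: mhu.
  apply: le_lt_trans (ltry 4); apply: le_trans mK.2.
  apply: ae_ge0_le_integral => //;
    try by [apply/measurableT_comp => //; exact: mhu|case: mK].
  by apply: aeS bnd2 => x H _; exact: H.
exists h.
  have := L2D (Lhu 0%N) (Lu 0%N); under eq_fun do rewrite subrK; exact.
apply/cvg0_seqP => [n|e e0]; first exact: nrm_ge0.
have : sqint (fun x => h x - u n x) @[n --> \oo] --> (0 : R).
  move/fine_cvgP : dc => [_].
  apply: cvg_trans; apply: near_eq_cvg; apply: nearW => n /=.
  rewrite /sqint /Rintegral; congr fine; apply: eq_integral => x _ /=.
  by rewrite subr0 ger0_norm ?sqr_ge0.
move/(cvg0_seqP (fun n => sqint_ge0 _))/(_ (e ^+ 2) (exprn_gt0 _ e0)) => [N hN].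
exists N => n /hN; rewrite -sqr_nrm ltr_pXn2r ?nnegrE ?nrm_ge0//; exact: ltW.
Qed.

End RieszFischer.

(** * Fourier coefficients, Bessel's inequality and the Riesz-Fischer theorem *)

Section Expansions.
Context {R : realType}.
Local Notation mu := (@lebesgue_measure R).
Implicit Types (f g : R -> R[i]) (c : nat -> R[i]).

Lemma twopi_gt0 : 0 < 2 * pi :> R.
Proof. by rewrite mulr_gt0// pi_gt0. Qed.

Lemma twopiC_neq0 : (2 * pi)%:C%C != 0 :> R[i].
Proof. by rewrite -normc_eq0 normc_real normr_eq0 gt_eqF// twopi_gt0. Qed.

Lemma L2norm_cvg0 (T : Type) (F : set_system T) {FF : Filter F}
    (g : T -> R -> R[i]) : (\forall y \near F, L2 (g y)) ->
  L2norm (g y) @[y --> F] --> 0%E <-> nrm (g y) @[y --> F] --> (0 : R).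
Proof.
move=> Lg; have e : \forall y \near F, L2norm (g y) = (nrm (g y))%:E.
  by apply: filterS Lg => y /L2normE.
split=> h.
  have {}h : (nrm (g y))%:E @[y --> F] --> 0%E.
    by apply: cvg_trans h; apply: near_eq_cvg; apply: filterS e => y ->.
  by move/fine_cvgP : h => [_].
have {}h : (nrm (g y))%:E @[y --> F] --> 0%E.
  by apply/cvg_EFin => //; exact: nearW.
by apply: cvg_trans h; apply: near_eq_cvg; apply: filterS e => y ->.
Qed.

Lemma L2_dotp f g : L2 f -> L2 g -> cintegrable (fun x => f x * conjc (g x)).
Proof. by move=> Lf Lg; apply: L2_mul_cintegrable => //; exact: L2_conj. Qed.

Lemma dotpZ (a : R[i]) f g : L2 f -> L2 g ->
  dotp (fun x => a * f x) g = a * dotp f g.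
Proof.
move=> Lf Lg; rewrite /dotp; under eq_fun do rewrite -mulrA.
by rewrite cintegralZ//; exact: L2_dotp.
Qed.

Lemma dotpB f f' g : L2 f -> L2 f' -> L2 g ->
  dotp (fun x => f x - f' x) g = dotp f g - dotp f' g.
Proof.
move=> Lf Lf' Lg; rewrite /dotp; under eq_fun do rewrite mulrBl.
by rewrite cintegralB//; exact: L2_dotp.
Qed.

Lemma dotp_sum (I : Type) (s : seq I) (F : I -> R -> R[i]) g :
  (forall i, L2 (F i)) -> L2 g ->
  dotp (fun x => \sum_(i <- s) F i x) g = \sum_(i <- s) dotp (F i) g.
Proof.
move=> LF Lg; rewrite /dotp; under eq_fun do rewrite mulr_suml.
by rewrite cintegral_sum// => i; exact: L2_dotp.
Qed.

Lemma dotpC f g : L2 f -> L2 g -> dotp g f = conjc (dotp f g).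
Proof.
move=> Lf Lg; rewrite /dotp -cintegral_conj; last exact: L2_dotp.
by congr cintegral; apply/funext => x; rewrite conjcM conjcK mulrC.
Qed.

Lemma dotp_self f : dotp f f = (sqint f)%:C%C.
Proof.
rewrite /dotp /cintegral; apply/eqP; rewrite eq_complex; apply/andP; split; apply/eqP.
  by apply: eq_Rintegral => x _; rewrite mul_conjc.
rewrite /Rintegral /= (_ : (\int[mu]_x _)%E = 0%E)//.
by apply: integral0_eq => x _; rewrite mul_conjc.
Qed.

Lemma normc_dotp f g : L2 f -> L2 g -> normc (dotp f g) <= nrm f * nrm g.
Proof. by move=> Lf Lg; rewrite -(nrm_conj g); apply: cauchy_schwarz => //; exact: L2_conj. Qed.

Definition comb c (n m : nat) (x : R) : R[i] :=
  \sum_(n <= k < m) c k * basis_fun k x.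

Lemma L2_comb c n m : L2 (comb c n m).
Proof. by apply: L2_sum => k; apply: L2Z; exact: L2_basis_fun. Qed.

Lemma comb_recr c n x : comb c 0 n.+1 x = comb c 0 n x + c n * basis_fun n x.
Proof. by rewrite /comb big_nat_recr. Qed.

Lemma comb_cat c n m x : (n <= m)%N -> comb c 0 m x - comb c 0 n x = comb c n m x.
Proof.
by move=> nm; rewrite /comb (big_cat_nat (leq0n n) nm)//= addrAC subrr add0r.
Qed.

Lemma dotp_comb c n m j :
  dotp (comb c n m) (basis_fun j) = (2 * pi)%:C%C * (c j *+ ((n <= j) && (j < m))%N).
Proof.
rewrite /comb dotp_sum; [|by move=> k; apply: L2Z; exact: L2_basis_fun|exact: L2_basis_fun].
have e k : dotp (fun x => c k * basis_fun k x) (basis_fun j) =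
    (2 * pi)%:C%C * c j *+ (k == j).
  rewrite dotpZ; [|exact: L2_basis_fun|exact: L2_basis_fun].
  rewrite dotp_basis; case: eqVneq => [->|_]; first by rewrite mulr1 mulrC.
  by rewrite mulr0 mulr0.
rewrite (eq_bigr _ (fun k _ => e k)).
have [nj|nj] := boolP ((n <= j) && (j < m))%N.
  rewrite (bigD1_seq j) ?mem_index_iota ?iota_uniq//=.
  by rewrite eqxx mulr1n big1 ?addr0// => k kj; rewrite (negPf kj) mulr0n.
rewrite mulr0n mulr0 big_seq big1// => k; rewrite mem_index_iota => knm.
by case: eqVneq => [kj|//]; rewrite -kj knm in nj.
Qed.

Lemma sqint_comb c n m : sqint (comb c n m) = 2 * pi * \sum_(n <= k < m) normc (c k) ^+ 2.
Proof.
apply: complexI; rewrite -dotp_self {1}/comb.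
rewrite dotp_sum; [|by move=> k; apply: L2Z; exact: L2_basis_fun|exact: L2_comb].
rewrite rmorphM/= rmorph_sum/= mulr_sumr big_seq [RHS]big_seq; apply: eq_bigr => k.
rewrite mem_index_iota => knm; rewrite dotpZ; [|exact: L2_basis_fun|exact: L2_comb].
rewrite dotpC; [|exact: L2_comb|exact: L2_basis_fun].
by rewrite dotp_comb knm mulr1n conjcM conjc_real mulrCA mul_conjc.
Qed.

(** Division by 2 pi, the squared norm of each e_k. *)
Definition fcoef f k : R[i] := ((2 * pi)^-1)%:C%C * dotp f (basis_fun k).

Lemma fcoefE f k : (2 * pi)%:C%C * fcoef f k = dotp f (basis_fun k).
Proof.
by rewrite /fcoef mulrA -rmorphM divff ?mul1r// gt_eqF// twopi_gt0.
Qed.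

(** The partial sum S satisfies (S, f) = |S|^2, so Cauchy-Schwarz yields |S| <= |f|. *)
Lemma bessel f n : L2 f ->
  2 * pi * \sum_(0 <= k < n) normc (fcoef f k) ^+ 2 <= sqint f.
Proof.
move=> Lf; set S := comb (fcoef f) 0 n; rewrite -sqint_comb -/S.
have LS : L2 S by exact: L2_comb.
have e : dotp S f = (sqint S)%:C%C.
  rewrite {1}/S /comb dotp_sum//; last by move=> k; apply: L2Z; exact: L2_basis_fun.
  rewrite sqint_comb rmorphM/= rmorph_sum/= mulr_sumr; apply: eq_bigr => k _.
  rewrite dotpZ//; last exact: L2_basis_fun.
  rewrite (dotpC (f := f))//; last exact: L2_basis_fun.
  by rewrite -fcoefE conjcM conjc_real mulrCA mul_conjc.
have := normc_dotp LS Lf; rewrite e normc_real ger0_norm ?sqint_ge0//.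
rewrite -!sqr_nrm expr2; have [->|n0] := eqVneq (nrm S) 0.
  by rewrite mul0r sqr_ge0.
have Spos : 0 < nrm S by rewrite lt_neqAle eq_sym n0 nrm_ge0.
by rewrite ler_pM2l// => h; rewrite expr2 ler_pM ?nrm_ge0.
Qed.

Definition represents f c := nrm (fun x => f x - comb c 0 n x) @[n --> \oo] --> (0 : R).

Lemma represents_fcoef f c : L2 f -> represents f c -> forall k, c k = fcoef f k.
Proof.
move=> Lf h k; apply: (mulfI twopiC_neq0); rewrite fcoefE.
apply/eqP; rewrite eq_sym -subr_eq0 -normc_eq0 eq_le normc_ge0 andbT.
apply/ler_addgt0Pl => e e0; rewrite addr0.
have Lk : L2 (@basis_fun R k) := L2_basis_fun k.
have n0 : 0 < nrm (@basis_fun R k) + 1 by rewrite ltr_wpDl ?nrm_ge0.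
move/(cvg0_seqP (fun n => nrm_ge0 _))/(_ (e / (nrm (@basis_fun R k) + 1)) (divr_gt0 e0 n0)) : h => [N hN].
have Lc : L2 (comb c 0 (N + k.+1)) by exact: L2_comb.
have : dotp (fun x => f x - comb c 0 (N + k.+1) x) (basis_fun k) =
    dotp f (basis_fun k) - (2 * pi)%:C%C * c k.
  by rewrite dotpB// dotp_comb /= (leq_trans (ltnSn k) (leq_addl _ _)) mulr1n.
move=> <-; apply: le_trans (normc_dotp _ _) _ => //; first exact: L2B.
have := hN (N + k.+1)%N (leq_addr _ _); rewrite ltr_pdivlMr// => h.
apply: le_trans (ltW h); rewrite ler_wpM2l ?nrm_ge0//.
by rewrite lerDl.
Qed.

(** From right to left, norm convergence identifies the coefficients with [fcoef f], and Bessel's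
    inequality bounds the sum of their squares. *)
Lemma expansionP f c : L2 f -> expansion f c <-> represents f c.
Proof.
move=> Lf.
have e n : (fun x => f x - \sum_(k < n) c k * basis_fun k x) =
    (fun x => f x - comb c 0 n x).
  by apply/funext => x; rewrite /comb big_mkord.
have key : L2norm (fun x => f x - \sum_(k < n) c k * basis_fun k x) @[n --> \oo] --> 0%E
    <-> represents f c.
  under eq_fun do rewrite e.
  by apply: L2norm_cvg0; apply: nearW => n; apply: L2B => //; exact: L2_comb.
split=> [[_ /key]//|h]; split; last exact/key.
have ce := represents_fcoef Lf h.
apply: le_lt_trans (ltry ((2 * pi)^-1 * sqint f)).
apply: lime_le.
  by apply: ereal_nondecreasing_is_cvgn; apply: ereal_nondecreasing_series => n _ _;
    rewrite lee_fin sqr_ge0.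
apply: nearW => n; rewrite sumEFin lee_fin.
rewrite ler_pdivlMl ?twopi_gt0//; under eq_bigr do rewrite ce.
exact: bessel.
Qed.

(** Uniqueness of the coefficients determines the sequence that [xget] has chosen. *)
Lemma coeffsE f c : L2 f -> represents f c -> coeffs f = c.
Proof.
move=> Lf h; have hc : [set c | expansion f c] c by exact/expansionP.
rewrite /coeffs; have /(expansionP _ Lf) h2 := xgetPex (fun=> 0) (ex_intro _ c hc).
by apply/funext => k; rewrite (represents_fcoef Lf h2) (represents_fcoef Lf h).
Qed.

Lemma represents_ae f g c : L2 f -> L2 g -> represents f c -> represents g c ->
  ae_same f g.
Proof.
move=> Lf Lg hf hg; apply: nrm_eq0_ae => //.
apply/eqP; rewrite eq_le nrm_ge0 andbT; apply/ler_addgt0Pl => e e0; rewrite addr0.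
have e2 : 0 < e / 2 by rewrite divr_gt0.
move/(cvg0_seqP (fun n => nrm_ge0 _))/(_ _ e2) : hf => [N hN].
move/(cvg0_seqP (fun n => nrm_ge0 _))/(_ _ e2) : hg => [M hM].
have Lc := L2_comb c 0 (N + M).
apply: le_trans (nrm_triangle Lf Lc Lg) _.
rewrite (splitr e); apply: lerD; first exact/ltW/hN/leq_addr.
by rewrite nrm_distC; exact/ltW/hM/leq_addl.
Qed.

Lemma ae_represents f g c : cmeasurable f -> cmeasurable g ->
  ae_same f g -> represents g c -> represents f c.
Proof.
move=> mf mg fg; rewrite /represents (_ : (fun n => nrm (fun x => f x - _)) =
  (fun n => nrm (fun x => g x - comb c 0 n x)))//.
apply/funext => n; have mc := L2_cmeasurable (L2_comb c 0 n).
apply: ae_nrm; [exact: cmeasurableB|exact: cmeasurableB|].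
by apply: aeS fg => x ->.
Qed.

Lemma representsD f g c c' : L2 f -> L2 g -> represents f c -> represents g c' ->
  represents (fun x => f x + g x) (fun k => c k + c' k).
Proof.
move=> Lf Lg hf hg.
apply: (@squeeze_cvgr _ _ _ _ (fun=> 0) (fun n => nrm (fun x => f x - comb c 0 n x) +
   nrm (fun x => g x - comb c' 0 n x))).
- apply: nearW => n; rewrite nrm_ge0 /=.
  have := nrmD (L2B Lf (L2_comb c 0 n)) (L2B Lg (L2_comb c' 0 n)).
  apply: le_trans; rewrite le_eqVlt; apply/orP; left; apply/eqP; congr nrm.
  apply/funext => x; rewrite addrACA -opprD; congr (_ - _).
  by rewrite /comb -big_split; apply: eq_bigr => k _; rewrite mulrDl.
- exact: cvg_cst.
- by rewrite -[X in _ --> X](addr0 0); apply: cvgD.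
Qed.

Lemma representsZ (a : R[i]) f c : L2 f -> represents f c ->
  represents (fun x => a * f x) (fun k => a * c k).
Proof.
move=> Lf hf; rewrite /represents (_ : (fun n => nrm _) =
   fun n => normc a * nrm (fun x => f x - comb c 0 n x)).
  by rewrite -[X in _ --> X](mulr0 (normc a)); apply: cvgMr.
apply/funext => n; rewrite -nrmZ; last by apply: L2B => //; exact: L2_comb.
congr nrm; apply/funext => x; rewrite mulrBr /comb mulr_sumr; congr (_ - _).
by apply: eq_bigr => k _; rewrite -mulrA.
Qed.

Lemma represents_comb c m :
  represents (comb c 0 m) (fun k => if (k < m)%N then c k else 0).
Proof.
apply/cvg0_seqP => [n|e e0]; first exact: nrm_ge0.
exists m => n mn; suff -> : (fun x => comb c 0 m x -
    comb (fun k => if (k < m)%N then c k else 0) 0 n x) = fun=> 0 by rewrite nrm0.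
apply/funext => x; rewrite /comb (big_cat_nat (leq0n m) mn)/=.
rewrite [X in _ - (_ + X)](_ : _ = 0) ?addr0; last first.
  by rewrite big_nat big1// => k /andP[mk _]; rewrite ltnNge mk mul0r.
apply/eqP; rewrite subr_eq0; apply/eqP; apply: eq_big_nat => k /andP[_ km].
by rewrite km.
Qed.

(** Termwise integration with an explicit error, by Cauchy-Schwarz; the pairing is bilinear, as in
    [hcoef]. *)
Lemma represents_cintegral f c g n : L2 f -> L2 g ->
  normc (cintegral (fun x => f x * g x) -
    \sum_(0 <= k < n) c k * cintegral (fun x => basis_fun k x * g x)) <=
  nrm (fun x => f x - comb c 0 n x) * nrm g.
Proof.
move=> Lf Lg; have Lc := L2_comb c 0 n.
have -> : \sum_(0 <= k < n) c k * cintegral (fun x => basis_fun k x * g x) =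
    cintegral (fun x => comb c 0 n x * g x).
  under [RHS]eq_cintegral do rewrite /comb mulr_suml.
  have i k : cintegrable (fun x => basis_fun k x * g x).
    by apply: L2_mul_cintegrable => //; exact: L2_basis_fun.
  under [RHS]eq_cintegral do under eq_bigr do rewrite -mulrA.
  rewrite cintegral_sum => [|k]; last exact: cintegrableZ.
  by apply: eq_bigr => k _; rewrite cintegralZ.
rewrite -cintegralB; [|exact: L2_mul_cintegrable|exact: L2_mul_cintegrable].
under eq_cintegral do rewrite -mulrBl.
by apply: cauchy_schwarz => //; exact: L2B.
Qed.

Lemma riesz_fischer c (B : R) :
  (forall n, \sum_(0 <= k < n) normc (c k) ^+ 2 <= B) ->
  exists2 h, L2 h & represents h c.
Proof.
move=> hB; pose s n := \sum_(0 <= k < n) normc (c k) ^+ 2.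
have s_le n m : (n <= m)%N -> s n <= s m.
  move=> nm; rewrite /s (big_cat_nat (leq0n n) nm)//= lerDl.
  by apply: sumr_ge0 => k _; exact: sqr_ge0.
have sE n m : (n <= m)%N -> sqint (comb c n m) = 2 * pi * (s m - s n).
  move=> nm; rewrite sqint_comb /s (big_cat_nat (leq0n n) nm)//=.
  by rewrite addrAC subrr add0r.
have : cvgn s.
  by apply: nondecreasing_is_cvgn => //; exists B => _ [n _ <-]; exact: hB.
move=> /cvg_ex[l sl].
have s_lel n : s n <= l.
  rewrite -(cvg_lim _ sl)//; apply: nondecreasing_cvgn_le => //.
  by apply/cvg_ex; exists l.
have tail e : 0 < e -> exists N, forall n m, (N <= n)%N -> (n <= m)%N ->
    nrm (fun x => comb c 0 m x - comb c 0 n x) <= e.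
  move=> e0; move/cvgrPdist_lt/(_ (e ^+ 2 / (2 * pi)) (divr_gt0 (exprn_gt0 2 e0) twopi_gt0)) : sl.
  move=> [N _ hN]; exists N => n m Nn nm.
  under eq_fun do rewrite comb_cat//.
  rewrite -(ler_pXn2r (n := 2)) ?nnegrE ?nrm_ge0 ?(ltW e0)// sqr_nrm sE//.
  have := hN n Nn; rewrite /= ger0_norm ?subr_ge0// ltr_pdivlMr ?twopi_gt0// => h.
  rewrite mulrC; apply: le_trans (ltW h).
  by rewrite ler_pM2r ?twopi_gt0// lerD2r.
have /choice[N hN] : forall j, exists N, forall n m, (N <= n)%N -> (n <= m)%N ->
    nrm (fun x => comb c 0 m x - comb c 0 n x) <= 2^-1 ^+ j.
  by move=> j; apply: tail; rewrite exprn_gt0// invr_gt0.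
(* Running maxima make the indices monotone, so that consecutive partial sums along [M] differ by at
   most 2^-j, as [L2_complete_fast] demands. *)
pose M j := \max_(i < j.+1) N i.
have NM j : (N j <= M j)%N.
  exact: (leq_bigmax (@ord_max j)).
have MM j : (M j <= M j.+1)%N by rewrite /M [in leqRHS]big_ord_recr leq_maxl.
have [h Lh hh] := @L2_complete_fast R (fun j => comb c 0 (M j))
  (fun j => L2_comb c 0 (M j)) (fun j => hN j _ _ (NM j) (MM j)).
exists h => //; apply/cvg0_seqP => [n|e e0]; first exact: nrm_ge0.
have e2 : 0 < e / 2 by rewrite divr_gt0.
move/(cvg0_seqP (fun n => nrm_ge0 _))/(_ _ e2) : hh => [J hJ].
have [J2 hJ2] : exists J2, forall j, (J2 <= j)%N -> (2^-1 : R) ^+ j < e / 2.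
  have : (2^-1 : R) ^+ j @[j --> \oo] --> (0 : R).
    by apply: cvg_expr; rewrite ger0_norm ?invr_ge0// invf_lt1// ltr1n.
  by move/(cvg0_seqP (fun n => exprn_ge0 _ (ltac:(by rewrite invr_ge0) : 0 <= 2^-1 :> R)))/(_ _ e2).
exists (M (J + J2)%N) => n Mn.
apply: le_lt_trans (nrm_triangle Lh (L2_comb c 0 (M (J + J2)%N)) (L2_comb c 0 n)) _.
rewrite (splitr e); apply: ltrD; first exact/hJ/leq_addr.
rewrite nrm_distC; apply: le_lt_trans (hN _ _ _ (NM _) Mn) _.
exact/hJ2/leq_addl.
Qed.

End Expansions.

Arguments Normc.normc : simpl never.

(** * Expansion of the Cauchy kernel in the e_k *)

Section CauchyKernel.
Context {R : realType}.
Local Notation mu := (@lebesgue_measure R).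
Implicit Types (g : R -> R[i]).

Lemma normc_i : normc ('i%C : R[i]) = 1.
Proof. by rewrite /Normc.normc expr0n expr1n add0r sqrtr1. Qed.

Lemma cmeasurableV g : cmeasurable g -> cmeasurable (fun x => (g x)^-1).
Proof.
move=> mg; have mq : measurable_fun [set: R] (fun x => (normc (g x) ^+ 2)^-1).
  have -> : (fun x => (normc (g x) ^+ 2)^-1) =
      (@powR R ^~ (-1)) \o (fun x => normc (g x) ^+ 2).
    by apply/funext => x /=; rewrite powR_inv1 ?sqr_ge0.
  apply: measurableT_comp; first exact: measurable_powR.
  exact: measurable_sqr_normc.
have [m1 m2] := mg; split.
  have -> : (fun x => complex.Re (g x)^-1) =
      fun x => complex.Re (g x) * (normc (g x) ^+ 2)^-1.
    by apply/funext => x; rewrite normc_sqrE; case: (g x).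
  exact: measurable_funM.
have -> : (fun x => complex.Im (g x)^-1) =
    fun x => - complex.Im (g x) * (normc (g x) ^+ 2)^-1.
  by apply/funext => x; rewrite normc_sqrE; case: (g x) => a b /=; rewrite mulNr.
by apply: measurable_funM => //; exact: measurable_funN.
Qed.

Lemma cmeasurable_zmap : cmeasurable (@zmap R).
Proof. by have := @cmeasurable_zmapX R 1; under eq_fun do rewrite expr1. Qed.

Lemma cmeasurable_cauchy (x y : R) : cmeasurable (fun t => (Complex (t + x) y)^-1).
Proof.
apply: cmeasurableV; split => /=; last exact: measurable_cst.
by apply: measurable_funD; [exact: measurable_id|exact: measurable_cst].
Qed.

Lemma cauchy_neq0 (t y : R) : y != 0 -> Complex t y != 0.
Proof. by move=> y0; rewrite eq_complex /= negb_and y0 orbT. Qed.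

(** With a and b the two denominators, z = (1 - a) / a and likewise for b, so the left side is ab -
    (1 - a)(1 - b) = a + b - 1. *)
Lemma kernel_den (t x y : R) : 0 < y ->
  den (upt t 0) * den (upt x y) * (1 - zmap t * cayley (upt x y)) =
  - 'i%C * Complex (t + x) y.
Proof.
move=> y0; have d0 := den_neq0 t (lexx 0); have d1 := den_neq0 x (ltW y0).
rewrite zmapE !cayleyE//.
have key (a b c d : R[i]) : a != 0 -> b != 0 ->
    a * b * (1 - c / a * (d / b)) = a * b - c * d.
  by move=> a0 b0; field; rewrite a0 b0.
rewrite key// /den.
by apply/eqP; rewrite eq_complex /=; apply/andP; split; apply/eqP; field.
Qed.

(** A finite geometric sum with its exact remainder. On the line |z(t)| = 1, while |[cayley]| < 1 at
    height [y], so the remainder decays geometrically at a rate independent of [t]. *)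
Lemma kernel_geometric (t x y : R) n : 0 < y ->
  (Complex (t + x) y)^-1 =
  - 'i%C * (\sum_(0 <= k < n) basis_fun k t * ebasis k (upt x y)) +
  (zmap t * cayley (upt x y)) ^+ n / Complex (t + x) y.
Proof.
move=> y0; have d0 := den_neq0 t (lexx 0); have d1 := den_neq0 x (ltW y0).
have s0 : Complex (t + x) y != 0 by rewrite cauchy_neq0// gt_eqF.
have i0 : 'i%C != 0 :> R[i] by rewrite eq_complex /= oner_eq0 andbF.
have := kernel_den t x y0; set w := zmap t * cayley (upt x y); set s := Complex (t + x) y.
set d := den (upt t 0) * den (upt x y) => ds.
have dn0 : d != 0 by rewrite mulf_neq0.
have -> : \sum_(0 <= k < n) basis_fun k t * ebasis k (upt x y) =
    d^-1 * \sum_(k < n) w ^+ k.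
  rewrite big_mkord mulr_sumr; apply: eq_bigr => k _.
  have -> : w ^+ k = zmap t ^+ k * cayley (upt x y) ^+ k by exact: exprMn.
  rewrite basis_funE /ebasis -zmapE /d.
  move: (zmap t ^+ k) (cayley (upt x y) ^+ k) => a b.
  by field; rewrite d0 d1.
apply: (mulfI s0); rewrite mulrDr divff//.
have -> : s * (- 'i%C * (d^-1 * \sum_(k < n) w ^+ k)) =
   (- 'i%C * s) * (d^-1 * \sum_(k < n) w ^+ k) by ring.
rewrite -/s -ds; have := subrX1 w n; set S := \sum_(k < n) w ^+ k => h.
have -> : d * (1 - w) * (d^-1 * S) = - ((w - 1) * S) by field.
have -> : s * (w ^+ n / s) = w ^+ n by rewrite mulrCA divff ?mulr1.
by rewrite -h opprB subrK.
Qed.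

(** With s = t + w, den(t) is a constant minus i s, and |s| >= y. The kernel thus decays like e_0,
    and integrability of g e_0 is enough for the Cauchy transform of g. This is the form needed for
    g = phi, which need not lie in L_2. *)
Lemma normc_cauchy_le (x y : R) : 0 < y -> exists2 C, 0 < C &
  forall t, normc (Complex (t + x) y)^-1 <= C * normc (basis_fun 0 t).
Proof.
move=> y0; set K := normc (2^-1%:C%C + 'i%C * upt x y).
have C0 : 0 < K / y + 1 by rewrite ltr_wpDl// divr_ge0 ?normc_ge0 ?ltW.
exists (K / y + 1) => // t; set s := Complex (t + x) y.
have s0 : s != 0 by rewrite cauchy_neq0// gt_eqF.
have sy : y <= normc s by rewrite (le_trans _ (normc_Im _))//= ler_norm.
have d0 := den_neq0 t (lexx 0).
rewrite basis_funE /ebasis expr0 mul1r !Normc.normcV.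
rewrite ler_pdivlMr ?normc_gt0// mulrC ler_pdivrMr ?normc_gt0//.
have -> : den (upt t 0) = 2^-1%:C%C + 'i%C * upt x y - 'i%C * s.
  by apply/eqP; rewrite eq_complex /=; apply/andP; split; apply/eqP; ring.
apply: le_trans (le_normcB _ _) _; rewrite -/K mulrDl mul1r; apply: lerD.
  rewrite -mulrAC ler_pdivlMr// ler_wpM2l ?normc_ge0//.
by rewrite Normc.normcM normc_i mul1r.
Qed.

Lemma cintegrable_cauchy g (x y : R) : 0 < y -> cmeasurable g ->
  cintegrable (fun t => g t * basis_fun 0 t) ->
  cintegrable (fun t => g t / Complex (t + x) y).
Proof.
move=> y0 mg ig; have [C C0 hC] := normc_cauchy_le x y0.
apply: (cintegrable_le _ _ (rintegrableZ C (cintegrable_normc ig))).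
  by apply: cmeasurableM => //; exact: cmeasurable_cauchy.
move=> t; rewrite [leLHS]Normc.normcM (Normc.normcM (g t)) mulrCA.
by rewrite ler_wpM2l ?normc_ge0.
Qed.

Lemma cintegrable_basis g k : cmeasurable g ->
  cintegrable (fun t => g t * basis_fun 0 t) ->
  cintegrable (fun t => g t * basis_fun k t).
Proof.
move=> mg ig; apply: (cintegrable_le _ _ (cintegrable_normc ig)).
  by apply: cmeasurableM => //; exact/L2_cmeasurable/L2_basis_fun.
by move=> t; rewrite !(Normc.normcM (g t)) (normc_basis_fun k).
Qed.

(** The expression under the limit in [hankel]. Its kernel contains t + w instead of t - w, hence
    the reflected point -x in [poissonE]. *)
Definition cauchyT g (x y : R) : R[i] :=
  ((2 * pi)%:C%C * 'i%C)^-1 * cintegral (fun t => g t / Complex (t + x) y).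

(** The factor is 1 / (2 pi i) times the -i of [kernel_geometric]; e_k is not conjugated. *)
Definition hcoef g k : R[i] :=
  - ((2 * pi)^-1)%:C%C * cintegral (fun t => g t * basis_fun k t).

Lemma cauchyT_series g (x y : R) : 0 < y -> cmeasurable g ->
  cintegrable (fun t => g t * basis_fun 0 t) ->
  normc (cauchyT g x y - \sum_(0 <= k < n) hcoef g k * ebasis k (upt x y))
    @[n --> \oo] --> (0 : R).
Proof.
move=> y0 mg ig.
have ik k := cintegrable_basis k mg ig.
have ic := cintegrable_cauchy x y0 mg ig.
set Z := cayley (upt x y).
set C := \int[mu]_(t in [set: R]) normc (g t / Complex (t + x) y).
have twopi := @twopi_gt0 R.
apply: (@squeeze_cvgr _ _ _ _ (fun=> 0) (fun n => normc Z ^+ n * ((2 * pi)^-1 * C))).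
- apply: nearW => n; apply/andP; split; first exact: normc_ge0.
  have ir : cintegrable (fun t => (zmap t) ^+ n * (g t / Complex (t + x) y)).
    apply: (cintegrable_le _ _ (cintegrable_normc ic)).
      apply: cmeasurableM; first exact: cmeasurable_zmapX.
      exact: cintegrable_measurable.
    by move=> t; rewrite Normc.normcM normc_zmapX mul1r.
  have e : cintegral (fun t => g t / Complex (t + x) y) =
      - 'i%C * (\sum_(0 <= k < n) cintegral (fun t => g t * basis_fun k t) * ebasis k (upt x y)) +
      Z ^+ n * cintegral (fun t => (zmap t) ^+ n * (g t / Complex (t + x) y)).
    rewrite -cintegralZ//.
    under [in RHS]eq_bigr do rewrite mulrC -cintegralZ//.
    rewrite -cintegral_sum => [|k]; last exact: cintegrableZ.
    rewrite -cintegralZ; last by apply: cintegrable_sum => k; exact: cintegrableZ.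
    rewrite -cintegralD; [|by apply: cintegrableZ; apply: cintegrable_sum => k; exact: cintegrableZ|exact: cintegrableZ].
    apply: eq_cintegral => t; rewrite {1}(kernel_geometric t x n y0) mulrDr; congr (_ + _).
      rewrite mulrCA mulr_sumr; congr (_ * _); apply: eq_bigr => k _; ring.
    by rewrite -/Z (exprMn _ (zmap t)); ring.
  have -> : cauchyT g x y - \sum_(0 <= k < n) hcoef g k * ebasis k (upt x y) =
      ((2 * pi)%:C%C * 'i%C)^-1 * (Z ^+ n * cintegral (fun t => (zmap t) ^+ n * (g t / Complex (t + x) y))).
    rewrite /cauchyT e mulrDr addrAC -[RHS]add0r; congr (_ + _).
    rewrite mulrA invfM; have -> : (2 * pi)%:C%C^-1 / 'i%C * - 'i%C = - ((2 * pi)^-1)%:C%C :> R[i].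
      rewrite mulrN mulfVK; last by rewrite eq_complex /= oner_eq0 andbF.
      by rewrite fmorphV.
    by rewrite mulr_sumr -sumrB big1// => k _; rewrite /hcoef -mulrA subrr.
  rewrite Normc.normcM Normc.normcV Normc.normcM normc_real normc_i mulr1.
  rewrite (ger0_norm (ltW twopi)) Normc.normcM normcX mulrCA.
  apply: ler_wpM2l; first by rewrite exprn_ge0 ?normc_ge0.
  apply: ler_wpM2l; first by rewrite invr_ge0 ltW.
  apply: le_trans (normc_cintegral ir) _.
  by under eq_Rintegral do rewrite Normc.normcM normc_zmapX mul1r.
- exact: cvg_cst.
- rewrite -[X in _ --> X](mul0r ((2 * pi)^-1 * C)); apply: cvgMl.
  by apply: cvg_expr; rewrite ger0_norm ?normc_ge0// normc_cayley_lt1.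
Qed.

Lemma L2_cintegrable0 g : L2 g -> cintegrable (fun t => g t * basis_fun 0 t).
Proof. by move=> Lg; apply: L2_mul_cintegrable => //; exact: L2_basis_fun. Qed.

Definition poisson_ker (x y t : R) : R := pi^-1 * (y / ((t - x) ^+ 2 + y ^+ 2)).

Definition poisson g (x y : R) : R[i] :=
  cintegral (fun t => g t * (poisson_ker x y t)%:C%C).

End CauchyKernel.

(** * Boundary values of Cauchy and Poisson integrals *)

Section PoissonReal.
Context {R : realType}.
Local Notation mu := (@lebesgue_measure R).
Variable x : R.

Lemma poisson_ker_ge0 y t : 0 <= y -> 0 <= poisson_ker x y t.
Proof.
move=> y0; rewrite mulr_ge0 ?invr_ge0 ?pi_ge0// divr_ge0// addr_ge0 ?sqr_ge0//.
Qed.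

Lemma poisson_den_gt0 (y t : R) : 0 < y -> 0 < (t - x) ^+ 2 + y ^+ 2.
Proof. by move=> y0; rewrite ltr_wpDl ?sqr_ge0// exprn_gt0. Qed.

Lemma poisson_ker_le1 y t : 0 < y -> poisson_ker x y t <= (pi * y)^-1.
Proof.
move=> y0; rewrite /poisson_ker invfM ler_wpM2l ?invr_ge0 ?pi_ge0//.
rewrite ler_pdivrMr ?poisson_den_gt0// mulrDr expr2 [X in _ + X]mulrA mulVf ?gt_eqF//.
by rewrite mul1r ler_wpDl// mulr_ge0 ?invr_ge0 ?sqr_ge0// ltW.
Qed.

Lemma poisson_ker_le2 y t : 0 < y -> t != x ->
  poisson_ker x y t <= pi^-1 * (y / (t - x) ^+ 2).
Proof.
move=> y0 tx; rewrite /poisson_ker ler_wpM2l ?invr_ge0 ?pi_ge0//.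
rewrite ler_wpM2l ?(ltW y0)// lef_pV2 ?posrE ?poisson_den_gt0//.
  by rewrite lerDl sqr_ge0.
by rewrite exprn_even_gt0//= subr_eq0.
Qed.

Lemma is_derive_poisson (y t : R) : 0 < y ->
  is_derive t 1 (fun t => pi^-1 * atan (y^-1 * (t - x))) (poisson_ker x y t).
Proof.
move=> y0; have h : is_derive t 1 (fun t : R => y^-1 * (t - x)) y^-1.
  apply: (@is_deriveZ_pt _ y^-1 (fun t => t - x) t 1); last by rewrite mulr1.
  apply: (@is_deriveB_pt _ id (fun=> x)); by rewrite subr0.
have h2 := @is_derive1_comp R atan _ t _ _ (is_derive1_atan (y^-1 * (t - x))) h.
apply: (is_deriveZ_pt h2); rewrite /poisson_ker.
have p := poisson_den_gt0 t y0.
congr (_ * _).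
have -> : 1 + (y^-1 * (t - x)) ^+ 2 = ((t - x) ^+ 2 + y ^+ 2) / y ^+ 2.
  by field; rewrite gt_eqF.
by field; rewrite !gt_eqF.
Qed.

Lemma poisson_ker_integral (y : R) : 0 < y -> rintegrable (poisson_ker x y) /\
  \int[mu]_(t in [set: R]) poisson_ker x y t = 1.
Proof.
move=> y0; have y1 : 0 < y^-1 by rewrite invr_gt0.
have cP : continuous (poisson_ker x y).
  move=> t; apply: cvgMr; apply: cvgMr; apply: cvgV.
    by rewrite gt_eqF// poisson_den_gt0.
  apply: cvgD; last exact: cvg_cst.
  have c : t - x @[t --> t] --> t - x by apply: cvgB; [exact: cvg_id|exact: cvg_cst].
  by have := cvgM c c; apply.
have lin_y : y^-1 * (t - x) @[t --> +oo] --> +oo.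
  apply/cvgryPge => A; near=> t; rewrite ler_pdivlMl// lerBrDr.
  by near: t; apply: nbhs_pinfty_ge; rewrite num_real.
have lin_Ny : y^-1 * (t - x) @[t --> -oo] --> -oo.
  apply/cvgrNyPle => A; near=> t; rewrite ler_pdivrMl// lerBlDr.
  by near: t; apply: nbhs_ninfty_le; rewrite num_real.
have atNy : atan t @[t --> -oo] --> - (pi / 2 : R).
  apply/cvgNy_compNP; rewrite (_ : _ \o _ = fun x : R => - atan x).
    by apply: cvgN; exact: cvgy_atan.
  by apply/funext => t /=; rewrite atanN.
have H : (\int[mu]_(t in [set: R]) (poisson_ker x y t)%:E =
    (pi^-1 * (pi / 2) - pi^-1 * - (pi / 2))%:E)%E.
  apply: (@ge0_continuous_FTC_line _ _ (fun t => pi^-1 * atan (y^-1 * (t - x)))).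
  - by move=> t; apply: poisson_ker_ge0; exact: ltW.
  - exact: cP.
  - by move=> t; exact: is_derive_poisson.
  - apply: cvgM; first exact: cvg_cst.
    apply: (@cvg_comp _ _ _ (fun t : R => y^-1 * (t - x)) atan _ +oo).
      exact: lin_y.
    exact: cvgy_atan.
  - apply: cvgM; first exact: cvg_cst.
    apply: (@cvg_comp _ _ _ (fun t : R => y^-1 * (t - x)) atan _ -oo).
      exact: lin_Ny.
    exact: atNy.
have p0 : (pi : R) != 0 by rewrite gt_eqF// pi_gt0.
have e1 : pi^-1 * (pi / 2) - pi^-1 * - (pi / 2) = 1 :> R.
  by rewrite mulrN opprK -mulrDr -splitr mulVf.
rewrite e1 in H; split; last by rewrite /Rintegral H.
apply/integrableP; split.
  by apply/measurable_EFinP; exact: continuous_measurable_fun.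
rewrite (_ : (\int[mu]_x _)%E = 1%:E) ?ltry// -H.
by apply: eq_integral => t _ /=; rewrite ger0_norm// poisson_ker_ge0// ltW.
Unshelve. all: by end_near. Qed.

Variable f : R -> R.
Hypothesis mf : measurable_fun [set: R] f.
Hypothesis if2 : rintegrable (fun t => f t ^+ 2).
Hypothesis fx : lebesgue_pt f x.

Let D t := `|f t - f x|.

Let mD : measurable_fun [set: R] D.
Proof.
apply: measurableT_comp => //; apply: measurable_funB => //.
Qed.

Lemma lebesgue_ball (eta : R) : 0 < eta -> exists2 r0, 0 < r0 & forall r, 0 < r < r0 ->
  rintegrable (D \_ (ball x r)) /\
  \int[mu]_(t in [set: R]) (D \_ (ball x r)) t <= 2 * r * eta.
Proof.
move=> eta0; have fx' := fx; move/fine_cvgP : fx' => [fin /cvgrPdist_lt/(_ _ eta0) lim].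
have [r0 /= r00 h] : \forall r \near 0^'+, davg f x r \is a fin_num /\
    `|0 - fine (davg f x r)| < eta.
  by apply: filterS2 fin lim.
exists r0 => // r /andP[rp rr0].
have [] := h r; rewrite /= ?sub0r ?normrN ?ger0_norm ?(ltW rp)//.
rewrite /davg /iavg lebesgue_measure_ball ?(ltW rp)// inver.
have r2 : r *+ 2 != 0 by rewrite mulrn_eq0 /= gt_eqF.
rewrite (negPf r2) => fin1 lt1.
have mB : measurable (ball x r) by exact: measurable_ball.
set I := (\int[mu]_(y in ball x r) _)%E in fin1 lt1.
have IE : I = (\int[mu]_(y in ball x r) `|(D y)%:E|)%E.
  by apply: eq_integral => t _; rewrite /= /D normr_id.
have Ifin : I \is a fin_num.
  move: fin1; have : (0 <= I)%E by apply: integral_ge0.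
  case: I {IE lt1} => //= _; rewrite mulry gtr0_sg ?mul1e// invr_gt0 mulrn_wgt0//.
have iD : mu.-integrable (ball x r) (EFin \o D).
  apply/integrableP; split.
    by apply/measurable_EFinP; exact: measurable_funTS.
  by rewrite -IE ltey_eq Ifin.
split.
  rewrite /rintegrable -restrict_EFin.
  by apply/integrable_restrict => //=; rewrite setTI.
rewrite -Rintegral_mkcond.
have e2 : \int[mu]_(t in ball x r) D t = fine I.
  by rewrite IE /Rintegral; congr fine; apply: eq_integral => t _ /=; rewrite /D normr_id.
move: lt1; rewrite e2 -[I in X in X -> _]fineK// -EFinM /=.
rewrite ltr_pdivrMl ?mulrn_wgt0// => lt1.
by rewrite mulr_natl ltW.
by apply: fine_ge0; exact: iavg_ge0.
Qed.

(** If |t - x| < d, let j be the index of the first box that contains t. For j > 0 the previous box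
    misses t, so |t - x| >= 2^(j-1) y, which gives 4 * 4^-j / (pi y). If |t - x| >= d, then 1 / (t -
    x)^2 is at most twice 1 / ((t - x)^2 + d^2), the integrable tail. *)
Lemma poisson_dyadic (d y t : R) (J : nat) : 0 < y -> 0 < d -> d <= 2 ^+ J * y ->
  poisson_ker x y t <=
  \sum_(0 <= j < J.+1) 4 * 4^-1 ^+ j / (pi * y) * (t \in (ball x (2 ^+ j * y) : set R))%:R +
  y * (2 / ((t - x) ^+ 2 + d ^+ 2)).
Proof.
move=> y0 d0 dJ; have py : 0 < pi * y by rewrite mulr_gt0 ?pi_gt0.
have sum0 : 0 <= \sum_(0 <= j < J.+1) 4 * 4^-1 ^+ j / (pi * y) *
    (t \in (ball x (2 ^+ j * y) : set R))%:R.
  by apply: sumr_ge0 => j _; rewrite mulr_ge0 ?ler0n// divr_ge0 ?(ltW py).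
have pi1 : (1 : R) <= pi by have := @pi_ge2 R; lra.
have [td|td] := leP d `|t - x|.
  apply: ler_wpDl => //; have tx : t != x.
    by apply: contraTneq td => ->; rewrite subrr normr0 -ltNge.
  apply: le_trans (poisson_ker_le2 y0 tx) _.
  have td2 : d ^+ 2 <= (t - x) ^+ 2.
    by rewrite -[leRHS]real_normK ?num_real// lerXn2r// ?nnegrE ?(ltW d0).
  have tp : 0 < (t - x) ^+ 2 by rewrite exprn_even_gt0//= subr_eq0.
  have p : 0 < (t - x) ^+ 2 + d ^+ 2 by rewrite ltr_wpDr ?sqr_ge0.
  apply: (@le_trans _ _ (y / (t - x) ^+ 2)).
    by rewrite ler_piMl ?invf_le1 ?pi_gt0// divr_ge0 ?sqr_ge0// ltW.
  rewrite ler_wpM2l ?(ltW y0)// ler_pdivlMr// mulrC ler_pdivrMr//; lra.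
have exJ : exists j, `|t - x| < 2 ^+ j * y by exists J; exact: lt_le_trans dJ.
have inB j : (t \in (ball x (2 ^+ j * y) : set R)) = (`|t - x| < 2 ^+ j * y).
  by apply/idP/idP; rewrite inE /ball /= distrC.
case: (ex_minnP exJ) => j hj jmin.
have jJ : (j < J.+1)%N by rewrite ltnS jmin// (lt_le_trans td dJ).
apply: ler_wpDr.
  by rewrite mulr_ge0 ?(ltW y0)// divr_ge0// addr_ge0 ?sqr_ge0.
rewrite (bigD1_seq j) ?mem_index_iota ?iota_uniq//= inB hj mulr1.
apply: ler_wpDr.
  by apply: sumr_ge0 => i _; rewrite mulr_ge0 ?ler0n// divr_ge0 ?(ltW py).
case: j hj jmin jJ => [|j] hj jmin jJ.
  rewrite expr0 mulr1; apply: le_trans (poisson_ker_le1 t y0) _.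
  by rewrite -[leLHS]mul1r ler_wpM2r ?invr_ge0 ?(ltW py)// ler1n.
have tj : 2 ^+ j * y <= `|t - x|.
  by rewrite leNgt; apply/negP => /jmin; rewrite ltnn.
have p2 : 0 < 2 ^+ j * y by rewrite mulr_gt0// exprn_gt0.
have tx : t != x.
  by apply: contraTneq tj => ->; rewrite subrr normr0 -ltNge.
apply: le_trans (poisson_ker_le2 y0 tx) _.
have td2 : (2 ^+ j * y) ^+ 2 <= (t - x) ^+ 2.
  by rewrite -[leRHS]real_normK ?num_real// lerXn2r// ?nnegrE ?(ltW p2).
apply: (@le_trans _ _ (pi^-1 * (y / (2 ^+ j * y) ^+ 2))).
  rewrite ler_wpM2l ?invr_ge0 ?pi_ge0// ler_wpM2l ?(ltW y0)// lef_pV2 ?posrE//.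
    by rewrite exprn_even_gt0//= subr_eq0.
  by rewrite exprn_gt0.
rewrite le_eqVlt; apply/orP; left; apply/eqP.
have -> : 4^-1 ^+ j.+1 = (2 ^+ j)^-2 / 4 :> R.
  rewrite exprSr exprVn (_ : 4 ^+ j = (2 ^+ j) ^+ 2)//.
  by rewrite -exprM mulnC exprM -[in RHS]natrX.
have e2 : (2 ^+ j : R) != 0 by rewrite expf_neq0.
have y1 : y != 0 by rewrite gt_eqF.
have p1 : (pi : R) != 0 by rewrite gt_eqF ?pi_gt0.
by move: (2 ^+ j) (pi : R) e2 p1 => a p e2 p1; field; rewrite y1 p1.
Qed.


Lemma rintegrable_poisson_bound (y : R) : 0 < y ->
  rintegrable (fun t => f t * poisson_ker x y t).
Proof.
move=> y0; have [iP _] := poisson_ker_integral y0.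
have py : 0 <= (pi * y)^-1 by rewrite invr_ge0 mulr_ge0 ?pi_ge0// ltW.
apply: (@rintegrable_le _ _ (fun t => (pi * y)^-1 * f t ^+ 2 + poisson_ker x y t)).
- by apply: measurable_funM => //; exact: rintegrable_measurable iP.
- move=> t; have P0 := poisson_ker_ge0 t (ltW y0).
  have P1 := poisson_ker_le1 t y0.
  rewrite normrM (ger0_norm P0).
  apply: (@le_trans _ _ ((f t ^+ 2 + 1) * poisson_ker x y t)).
    rewrite ler_wpM2r// -[f t ^+ 2]real_normK ?num_real//.
    have := sqr_ge0 (`|f t| - 1); have := normr_ge0 (f t); nra.
  by rewrite mulrDl mul1r lerD2r mulrC ler_wpM2r ?sqr_ge0.
- by apply: rintegrableD => //; exact: rintegrableZ.
Qed.

(* Split the Poisson kernel into dyadic boxes around [x], on which the averages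
   of [D] are small, and a tail of size [O(y)]. *)
Lemma poisson_real_cvg :
  \int[mu]_(t in [set: R]) (f t * poisson_ker x y t) @[y --> 0^'+] --> f x.
Proof.
apply/cvgrPdist_le => e e0.
(* The box of index j will contribute at most (e / (4 pi)) 2^-j; these bounds sum to at most e / (2
   pi), below e / 2. *)
have eta0 : 0 < e / 32 by rewrite divr_gt0.
have [r0 r00 hr0] := lebesgue_ball eta0.
pose d := r0 / 2; have d0 : 0 < d by rewrite divr_gt0.
(* A majorant of the tail that is integrable for square integrable f: |f - f(x)| <= 1 + |f(x)| +
   f^2, where the constant part meets the Poisson kernel at height [d] and f^2 meets a bounded
   factor. *)
pose W t := (2 * (1 + `|f x|)) * ((pi * d^-1) * poisson_ker x d t) + 2 * d^-2 * f t ^+ 2.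
have iW : rintegrable W.
  have [iP _] := poisson_ker_integral d0.
  by apply: rintegrableD; [apply: rintegrableZ; exact: rintegrableZ|exact: rintegrableZ].
have W_ge t : D t * (2 / ((t - x) ^+ 2 + d ^+ 2)) <= W t.
  have p := poisson_den_gt0 t d0.
  have -> : W t = (2 / ((t - x) ^+ 2 + d ^+ 2)) * (1 + `|f x|) + 2 * d^-2 * f t ^+ 2.
    rewrite /W /poisson_ker; congr (_ + _).
    have p1 : (pi : R) != 0 by rewrite gt_eqF ?pi_gt0.
    have dn : d != 0 by rewrite gt_eqF.
    have pn : (t - x) ^+ 2 + d ^+ 2 != 0 by rewrite gt_eqF.
    by move: (pi : R) p1 => q p1; field; rewrite pn dn p1.
  have q0 : 0 <= 2 / ((t - x) ^+ 2 + d ^+ 2) by rewrite divr_ge0// ltW.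
  apply: (@le_trans _ _ ((1 + `|f x| + f t ^+ 2) * (2 / ((t - x) ^+ 2 + d ^+ 2)))).
    rewrite ler_wpM2r// (le_trans (ler_normB _ _))// -[f t ^+ 2]real_normK ?num_real//.
    have := sqr_ge0 (`|f t| - 1); have := normr_ge0 (f t); nra.
  rewrite mulrDl mulrC lerD2l mulrC ler_wpM2r ?sqr_ge0//.
  rewrite ler_wpM2l// lef_pV2 ?posrE ?exprn_gt0//.
  by rewrite lerDr sqr_ge0.
pose C := \int[mu]_(t in [set: R]) W t.
have W0 t : 0 <= W t.
  apply: le_trans (W_ge t); apply: mulr_ge0; first exact: normr_ge0.
  by rewrite divr_ge0 ?addr_ge0 ?sqr_ge0.
have C0 : 0 <= C by exact: Rintegral_ge0.
have step y : 0 < y -> y < d -> y * (C + 1) < e / 2 ->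
    `|f x - \int[mu]_(t in [set: R]) (f t * poisson_ker x y t)| <= e.
  move=> y0 yd yC; have [iP P1] := poisson_ker_integral y0.
  (* The least [J] that reaches [d] does not exceed 2d = r0, so every box is small enough for
     [lebesgue_ball]. *)
  have [J dJ1 dJ2] : exists2 J, d <= 2 ^+ J * y & 2 ^+ J * y < 2 * d.
    have ex : exists J, d <= 2 ^+ J * y.
      exists (Num.truncn (d / y)).+1; rewrite -ler_pdivrMr//.
      apply: le_trans (ltW (truncnS_gt _)) _.
      by rewrite -natrX ler_nat ltnW// ltn_expl.
    case: (ex_minnP ex) => -[|J] hJ Jmin.
      by exfalso; move: hJ; rewrite expr0 mul1r leNgt yd.
    exists J.+1 => //; rewrite exprS -mulrA ltr_pM2l// ltNge.
    by apply/negP => /Jmin; rewrite ltnn.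
  pose c j := 4 * 4^-1 ^+ j / (pi * y).
  have c0 j : 0 <= c j.
    by rewrite divr_ge0 ?mulr_ge0 ?exprn_ge0 ?invr_ge0 ?pi_ge0 ?(ltW y0).
  pose B j := ball x (2 ^+ j * y).
  have Br j : (j < J.+1)%N -> 0 < 2 ^+ j * y < r0.
    rewrite ltnS => jJ; rewrite mulr_gt0 ?exprn_gt0//=.
    have -> : r0 = 2 * d by rewrite /d mulrC divfK.
    by apply: le_lt_trans dJ2; rewrite ler_wpM2r ?(ltW y0)// ler_weXn2l// ler1n.
  pose G t := \sum_(0 <= j < J.+1) c j * (D \_ (B j)) t + y * W t.
  have iG0 (s : seq nat) : (forall j, j \in s -> (j < J.+1)%N) ->
      rintegrable (fun t => \sum_(j <- s) c j * (D \_ (B j)) t) /\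
      \int[mu]_(t in [set: R]) (\sum_(j <- s) c j * (D \_ (B j)) t) <=
      \sum_(j <- s) c j * (2 * (2 ^+ j * y) * (e / 32)).
    elim: s => [|j s IH] js.
      under eq_fun do rewrite big_nil; split; first exact: integrable0.
      by rewrite big_nil /Rintegral integral0.
    have [i1 i2] := IH (fun k ks => js k (mem_behead (s := j :: s) ks)).
    have [k1 k2] := hr0 _ (Br j (js j (mem_head _ _))).
    under eq_fun do rewrite big_cons; split.
      by apply: rintegrableD => //; exact: rintegrableZ.
    rewrite big_cons RintegralD//; last exact: rintegrableZ.
    by rewrite RintegralZl// lerD// ler_wpM2l.
  have [i1 i2] := iG0 (index_iota 0 J.+1) (fun j => ltac:(by rewrite mem_index_iota)).
  have iG : rintegrable G by apply: rintegrableD => //; exact: rintegrableZ.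
  have DPG t : D t * poisson_ker x y t <= G t.
    have Dt : 0 <= D t := normr_ge0 _.
    apply: le_trans (ler_wpM2l Dt (poisson_dyadic t y0 d0 dJ1)) _.
    rewrite mulrDr; apply: lerD; last first.
      by rewrite mulrCA ler_wpM2l ?(ltW y0).
    rewrite mulr_sumr le_eqVlt; apply/orP; left; apply/eqP; apply: eq_bigr => j _.
    rewrite /patch /B mulrCA; case: ifP => _; first by rewrite mulr1.
    by rewrite !mulr0.
  have iDP : rintegrable (fun t => D t * poisson_ker x y t).
    apply: rintegrable_le iG => [|t].
      by apply: measurable_funM => //; exact: rintegrable_measurable iP.
    by rewrite ger0_norm ?DPG// mulr_ge0 ?normr_ge0// poisson_ker_ge0// ltW.
  have -> : f x = \int[mu]_(t in [set: R]) (f x * poisson_ker x y t).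
    by rewrite RintegralZl// P1 mulr1.
  have ifP := rintegrable_poisson_bound y0.
  rewrite -RintegralB//; last exact: rintegrableZ.
  have ifB : rintegrable (fun t => f x * poisson_ker x y t - f t * poisson_ker x y t).
    by apply: rintegrableB => //; exact: rintegrableZ.
  apply: le_trans (le_normr_Rintegral measurableT ifB) _.
  apply: (@le_trans _ _ (\int[mu]_(t in [set: R]) G t)).
    apply: le_Rintegral => //; first exact: rintegrable_norm.
    move=> t _; apply: le_trans (DPG t).
    by rewrite -mulrBl normrM distrC (ger0_norm (poisson_ker_ge0 t (ltW y0))).
  rewrite RintegralD//; last exact: rintegrableZ.
  rewrite RintegralZl// (splitr e); apply: lerD; last first.
    by apply: le_trans (ltW yC); rewrite ler_wpM2l ?(ltW y0)// lerDl.
  apply: le_trans i2 _.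
  have py : (pi : R) != 0 by rewrite gt_eqF ?pi_gt0.
  have -> : \sum_(0 <= j < J.+1) c j * (2 * (2 ^+ j * y) * (e / 32)) =
      \sum_(0 <= j < J.+1) (e / 4 / pi) * 2^-1 ^+ j.
    apply: eq_bigr => j _; rewrite /c.
    have -> : 4^-1 ^+ j = 2^-1 ^+ j * (2 ^+ j)^-1 :> R.
      by rewrite -exprVn -exprMn -invfM -natrM.
    have e2 : (2 ^+ j : R) != 0 by rewrite expf_neq0.
    have y1 : y != 0 by rewrite gt_eqF.
    by move: (2 ^+ j) (2^-1 ^+ j) (pi : R) e2 py => a b p e2 py; field; rewrite y1 py.
  rewrite -mulr_sumr sum_half.
  apply: (@le_trans _ _ (e / 4 / pi * 2)).
    by rewrite ler_wpM2l ?divr_ge0 ?pi_ge0 ?(ltW e0)// gerBl mulr_ge0// exprn_ge0.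
  have pi1 : (1 : R) <= pi by have := @pi_ge2 R; lra.
  rewrite mulrAC ler_pdivrMr ?pi_gt0//; nra.
near=> y; have y0 : 0 < y by near: y; exact: nbhs_right_gt.
have yd : y < d by near: y; apply: nbhs_right_lt.
have yC : y < e / 2 / (C + 1).
  by near: y; apply: nbhs_right_lt; rewrite !divr_gt0// ltr_wpDl.
by apply: step => //; rewrite -ltr_pdivlMr ?ltr_wpDl.
Unshelve. all: by end_near. Qed.

End PoissonReal.

Section PoissonComplex.
Context {R : realType}.
Local Notation mu := (@lebesgue_measure R).
Implicit Types (f g h : R -> R[i]).

(** The radii of neighbourhoods in [R[i]] are themselves elements of [R[i]]; this moves all limits
    to real-valued norms. *)
Lemma cvg_normcP (T : Type) (F : set_system T) {FF : Filter F} (f : T -> R[i]) l :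
  f t @[t --> F] --> l <-> normc (f t - l) @[t --> F] --> (0 : R).
Proof.
split=> [/cvgrPdist_lt h|/cvgrPdist_lt h]; apply/cvgrPdist_lt => e e0.
  have := h e%:C%C; rewrite ltcR => /(_ e0); apply: filterS => t.
  by rewrite normrE ltcR sub0r normrN ger0_norm ?normc_ge0// -normcN opprB.
have : e = (complex.Re e)%:C%C by rewrite RRe_real// ger0_real// ltW.
move=> eE; rewrite eE ltcR in e0; apply: filterS (h _ e0) => t.
rewrite {2}eE normrE ltcR sub0r normrN ger0_norm ?normc_ge0//.
by rewrite -normcN opprB.
Qed.

Lemma normc_cvg_unique (a b : R[i]) (u : nat -> R[i]) :
  normc (a - u n) @[n --> \oo] --> (0 : R) -> normc (b - u n) @[n --> \oo] --> (0 : R) ->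
  a = b.
Proof.
move=> ha hb; apply/eqP; rewrite -subr_eq0 -normc_eq0 eq_le normc_ge0 andbT.
apply/ler_addgt0Pl => e e0; rewrite addr0.
have e2 : 0 < e / 2 by rewrite divr_gt0.
move/(cvg0_seqP (fun n => normc_ge0 _))/(_ _ e2) : ha => [N hN].
move/(cvg0_seqP (fun n => normc_ge0 _))/(_ _ e2) : hb => [M hM].
have -> : a - b = (a - u (N + M)%N) - (b - u (N + M)%N) by ring.
apply: le_trans (le_normcB _ _) _; rewrite (splitr e).
by apply: lerD; [exact/ltW/hN/leq_addr|exact/ltW/hM/leq_addl].
Qed.

Lemma den_uptN x y : den (upt (- x) y) = conjc (den (upt x y : R[i])).
Proof. by rewrite !den_upt. Qed.

Lemma ebasisN k x y : ebasis k (upt (- x) y) = conjc (ebasis k (upt x y : R[i])).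
Proof.
rewrite /ebasis /cayley den_uptN; move: (den (upt x y)) => d.
rewrite conjcM conjcX conjcB !conjc_inv.
by rewrite (_ : conjc 1 = 1)//; apply/eqP; rewrite eq_complex /= oppr0 !eqxx.
Qed.

(** For s = t - x + i y, conj(1/s) - 1/s = 2 i y / |s|^2 is 2 pi i times the Poisson kernel. The
    term with conj(1/s) is the conjugate of a Cauchy transform, that of the conjugate of [h]. *)
Lemma poissonE h x y : 0 < y -> L2 h -> poisson h x y =
  - conjc (cauchyT (fun t => conjc (h t)) (- x) y) - cauchyT h (- x) y.
Proof.
move=> y0 Lh; have Lh' := L2_conj Lh.
have i1 := cintegrable_cauchy (- x) y0 (L2_cmeasurable Lh) (L2_cintegrable0 Lh).
have i2 := cintegrable_cauchy (- x) y0 (L2_cmeasurable Lh') (L2_cintegrable0 Lh').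
set c : R[i] := ((2 * pi)%:C%C * 'i%C)^-1.
have cc : conjc c = - c.
  rewrite /c conjc_inv conjcM conjc_real (_ : conjc 'i%C = - 'i%C).
    by rewrite mulrN invrN.
  by apply/eqP; rewrite eq_complex /= oppr0 !eqxx.
rewrite /cauchyT -/c conjcM cc mulNr opprK -mulrBr -cintegral_conj//.
rewrite -cintegralB//; last exact: cintegrable_conj.
rewrite -cintegralZ; last by apply: cintegrableB => //; exact: cintegrable_conj.
apply: eq_cintegral => t; rewrite conjcM conjcK -mulrBr mulrCA; congr (_ * _).
have pi0 : (pi : R) != 0 by rewrite gt_eqF ?pi_gt0.
have p : (t - x) ^+ 2 + y ^+ 2 != 0 by rewrite gt_eqF// poisson_den_gt0.
have s0 : Complex (t - x) y != 0 by rewrite cauchy_neq0 ?gt_eqF.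
have -> : conjc (Complex (t - x) y)^-1 - (Complex (t - x) y)^-1 =
    Complex 0 (2 * (y / ((t - x) ^+ 2 + y ^+ 2))).
  by apply/eqP; rewrite eq_complex /=; apply/andP; split; apply/eqP; field.
have A0 : (2 * pi)%:C%C * 'i%C != 0 :> R[i].
  by rewrite mulf_neq0 ?twopiC_neq0// eq_complex /= oner_eq0 andbF.
apply: (mulfI A0); rewrite /c mulVKf// /poisson_ker.
apply/eqP; rewrite eq_complex /=; apply/andP.
by move: (pi : R) pi0 => q q0; split; apply/eqP; field; rewrite ?p ?q0.
Qed.

Lemma hcoef_conj h k : L2 h -> hcoef (fun t => conjc (h t)) k = - conjc (fcoef h k).
Proof.
move=> Lh; rewrite /hcoef /fcoef mulNr conjcM conjc_real; congr (- (_ * _)).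
rewrite /dotp -cintegral_conj; last by apply: L2_dotp => //; exact: L2_basis_fun.
by apply: eq_cintegral => t; rewrite conjcM conjcK.
Qed.

(** The hypothesis makes all coefficients of the second Cauchy term in [poissonE] vanish, so that
    term is 0. The conjugated first term has the coefficients [fcoef h], and the Poisson integral is
    therefore a series in the holomorphic functions [ebasis]. *)
Lemma poisson_series h x y : 0 < y -> L2 h ->
  (forall k, cintegral (fun t => h t * basis_fun k t) = 0) ->
  normc (poisson h x y - \sum_(0 <= k < n) fcoef h k * ebasis k (upt x y))
    @[n --> \oo] --> (0 : R).
Proof.
move=> y0 Lh h0; have Lh' := L2_conj Lh.
have s1 := cauchyT_series (- x) y0 (L2_cmeasurable Lh) (L2_cintegrable0 Lh).
have s2 := cauchyT_series (- x) y0 (L2_cmeasurable Lh') (L2_cintegrable0 Lh').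
have z : cauchyT h (- x) y = 0.
  have e n : 0 = normc (0 - \sum_(0 <= k < n) hcoef h k * ebasis k (upt (- x) y)).
    rewrite big1 ?subrr ?Normc.normc0// => k _.
    by rewrite /hcoef h0 mulr0 mul0r.
  apply: (normc_cvg_unique s1); apply: cvg_trans (@cvg_cst R (0 : R) nat \oo _).
  by apply: near_eq_cvg; apply: nearW.
apply: cvg_trans s2; apply: near_eq_cvg; apply: nearW => n.
rewrite poissonE// z subr0 -normc_conj -[in RHS]normcN; congr normc.
rewrite conjcB opprD !opprK conjc_sum -sumrN; congr (_ + _).
apply: eq_bigr => k _; rewrite hcoef_conj// ebasisN mulNr -conjcM.
have -> (z' : R[i]) : conjc (- conjc z') = - z'; last by rewrite opprK.
by case: z' => a b /=; rewrite opprK.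
Qed.

Lemma represents_orthogonal h c : L2 h -> represents h c ->
  forall j, cintegral (fun t => h t * basis_fun j t) = 0.
Proof.
move=> Lh hc j; have Lj := @L2_basis_fun R j.
apply/eqP; rewrite -normc_eq0 eq_le normc_ge0 andbT.
apply/ler_addgt0Pl => e e0; rewrite addr0.
have n0 : 0 < nrm (@basis_fun R j) + 1 by rewrite ltr_wpDl ?nrm_ge0.
move/(cvg0_seqP (fun n => nrm_ge0 _))/(_ _ (divr_gt0 e0 n0)) : hc => [N hN].
have := represents_cintegral c N Lh Lj.
rewrite big1 => [|k _]; last by rewrite cintegral_basis_mul mulr0.
rewrite subr0 => h1; apply: le_trans h1 _.
have := hN N (leqnn N); rewrite ltr_pdivlMr// => /ltW; apply: le_trans.
by rewrite ler_wpM2l ?nrm_ge0// lerDl.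
Qed.

(** Real and imaginary parts are square integrable, hence locally integrable, and almost every point
    is a Lebesgue point of both. *)
Lemma poisson_ae h : L2 h -> {ae mu, forall x,
  normc (poisson h x y - h x) @[y --> 0^'+] --> (0 : R)}.
Proof.
move=> Lh; have [mr mi] := L2_cmeasurable Lh.
have sq (p : R[i] -> R) : (forall z, `|p z| <= normc z) ->
    measurable_fun [set: R] (fun t => p (h t)) -> rintegrable (fun t => p (h t) ^+ 2).
  move=> pn mp; apply: rintegrable_le (L2_rintegrable Lh).
    exact: measurable_funX.
  by move=> t; rewrite normrX lerXn2r ?nnegrE ?normc_ge0.
have loc (p : R -> R) : measurable_fun [set: R] p ->
    rintegrable (fun t => p t ^+ 2) -> locally_integrable [set: R] p.
  move=> mp ip; split=> //; first exact: openT.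
  move=> K _ cK; have mK : measurable K by exact: compact_measurable.
  have fK := compact_finite_measure cK.
  have i1 : mu.-integrable K (EFin \o (fun t => p t ^+ 2)).
    by apply: integrableS ip.
  have i2 : mu.-integrable K (EFin \o (fun _ : R => 1 : R)).
    apply/integrableP; split; first by apply/measurable_EFinP; exact: measurable_cst.
    by under eq_integral do rewrite /= normr1; rewrite integral_cst// mul1e.
  have i3 : mu.-integrable K (fun t => (p t ^+ 2)%:E + 1%:E)%E.
    exact: integrableD i1 i2.
  have /integrableP[_] : mu.-integrable K (EFin \o p).
    apply: le_integrable i3 => //; first by apply/measurable_EFinP; exact: measurable_funTS.
    move=> t _; rewrite -EFinD /= lee_fin [leRHS]ger0_norm ?addr_ge0 ?sqr_ge0//.
    rewrite -[p t ^+ 2]real_normK ?num_real//.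
    have := sqr_ge0 (`|p t| - 1); have := normr_ge0 (p t); nra.
  by [].
have ir := sq _ (@normc_Re R) mr; have ii := sq _ (@normc_Im R) mi.
apply: aeS (aeI (lebesgue_differentiation (loc _ mr ir)) (lebesgue_differentiation (loc _ mi ii))).
move=> x [lr li].
have cr := poisson_real_cvg mr ir lr; have ci := poisson_real_cvg mi ii li.
have {}cr : complex.Re (poisson h x y - h x) @[y --> 0^'+] --> (0 : R).
  rewrite -[X in _ --> X](subrr (complex.Re (h x))).
  under eq_fun do rewrite ReD ReN.
  apply: cvgB; last exact: cvg_cst.
  apply: cvg_trans cr; apply: near_eq_cvg; apply: nearW => y.
  by apply: eq_Rintegral => t _; rewrite ReM /= mulr0 subr0.
have {}ci : complex.Im (poisson h x y - h x) @[y --> 0^'+] --> (0 : R).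
  rewrite -[X in _ --> X](subrr (complex.Im (h x))).
  under eq_fun do rewrite ImD ImN.
  apply: cvgB; last exact: cvg_cst.
  apply: cvg_trans ci; apply: near_eq_cvg; apply: nearW => y.
  by apply: eq_Rintegral => t _; rewrite ImM /= mulr0 add0r.
apply: (@squeeze_cvgr _ _ _ _ (fun=> 0) (fun y =>
  `|complex.Re (poisson h x y - h x)| + `|complex.Im (poisson h x y - h x)|)).
- by apply: nearW => y; rewrite normc_ge0 normc_le_ReIm.
- exact: cvg_cst.
- rewrite -[X in _ --> X](addr0 0); apply: cvgD.
    by rewrite -[X in _ --> X](@normr0 _ R); exact: cvg_norm.
  by rewrite -[X in _ --> X](@normr0 _ R); exact: cvg_norm.
Qed.

(** Let h be the Riesz-Fischer sum of the Fourier series of [f]. Both functions have vanishing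
    bilinear pairings and the same coefficients, so their Poisson integrals coincide at every point
    of the half-plane; their boundary values then give f = h almost everywhere. *)
Lemma represents_of_orthogonal f : L2 f ->
  (forall k, cintegral (fun t => f t * basis_fun k t) = 0) -> represents f (fcoef f).
Proof.
move=> Lf f0; have pi0 := @twopi_gt0 R.
have [|h Lh hr] := @riesz_fischer R (fcoef f) ((2 * pi)^-1 * sqint f).
  by move=> n; rewrite ler_pdivlMl//; exact: bessel.
have e k : fcoef f k = fcoef h k := represents_fcoef Lh hr k.
have ps x y : 0 < y -> poisson f x y = poisson h x y.
  move=> y0; have s1 := poisson_series x y0 Lf f0.
  have s2 := poisson_series x y0 Lh (represents_orthogonal Lh hr).
  apply: (normc_cvg_unique s1); apply: cvg_trans s2; apply: near_eq_cvg.
  by apply: nearW => n; under eq_bigr do rewrite -e.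
apply: ae_represents hr; [exact: L2_cmeasurable|exact: L2_cmeasurable|].
apply: aeS (aeI (poisson_ae Lf) (poisson_ae Lh)) => x [c1 c2].
have {}c1 : poisson f x y @[y --> 0^'+] --> f x by apply/cvg_normcP.
have {}c2 : poisson h x y @[y --> 0^'+] --> h x by apply/cvg_normcP.
have c3 : poisson f x y @[y --> 0^'+] --> h x.
  apply: cvg_trans c2; apply: near_eq_cvg; near=> y.
  by rewrite ps//; near: y; exact: nbhs_right_gt.
exact: (cvg_unique (@norm_hausdorff _ _) c1 c3).
Unshelve. all: by end_near. Qed.

(** Up to sign and conjugation, [hcoef g] is [fcoef] of the conjugate of [g]. *)
Lemma hcoef_bessel g n : L2 g ->
  \sum_(0 <= k < n) normc (hcoef g k) ^+ 2 <= (2 * pi)^-1 * sqint g.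
Proof.
move=> Lg; have Lg' := L2_conj Lg; rewrite ler_pdivlMl ?twopi_gt0//.
rewrite (_ : sqint g = sqint (fun t => conjc (g t))); last first.
  by rewrite /sqint; under [RHS]eq_Rintegral do rewrite normc_conj.
apply: le_trans (bessel n Lg'); rewrite ler_pM2l ?twopi_gt0//.
apply: ler_sum => k _; set g' := fun t => conjc (g t).
have -> : hcoef g k = hcoef (fun t => conjc (g' t)) k.
  rewrite (_ : (fun t => conjc (g' t)) = g)//.
  by apply/funext => t; rewrite /g' conjcK.
by rewrite hcoef_conj// normcN normc_conj.
Qed.

(** Both sides are limits of the same series. This replaces the boundary behaviour of a Cauchy
    integral, whose kernel is no approximate identity, by that of a Poisson integral. *)
Lemma cauchyT_poisson g h x y : L2 h -> cmeasurable g ->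
  cintegrable (fun t => g t * basis_fun 0 t) -> represents h (hcoef g) -> 0 < y ->
  cauchyT g x y = poisson h x y.
Proof.
move=> Lh mg ig hr y0.
apply: (normc_cvg_unique (cauchyT_series x y0 mg ig)).
apply: cvg_trans (poisson_series x y0 Lh (represents_orthogonal Lh hr)).
apply: near_eq_cvg; apply: nearW => n.
by under eq_bigr do rewrite -(represents_fcoef Lh hr).
Qed.

Lemma cauchyT_ae g h : L2 h -> cmeasurable g ->
  cintegrable (fun t => g t * basis_fun 0 t) -> represents h (hcoef g) ->
  {ae mu, forall x, cauchyT g x y @[y --> 0^'+] --> h x}.
Proof.
move=> Lh mg ig hr; apply: aeS (poisson_ae Lh) => x /cvg_normcP c.
apply: cvg_trans c; apply: near_eq_cvg; near=> y.
rewrite (@cauchyT_poisson g h)//; near: y; exact: nbhs_right_gt.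
Unshelve. all: by end_near. Qed.

End PoissonComplex.

(** * The Hankel operator on L_2 *)

Section HankelOperator.
Context {R : realType}.
Variable phi : one_point_compactification R -> R[i].
Hypothesis phi_cont : continuous phi.

Definition symb (t : R) : R[i] := phi (Some t).

Lemma cmeasurable_symb : cmeasurable symb.
Proof.
have c (t : R) : symb t' @[t' --> t] --> symb t.
  apply: (@continuous_comp R (one_point_compactification R) R[i] Some phi).
    exact: one_point_compactification_some_continuous.
  exact: phi_cont.
have key (p : R[i] -> R) : (forall a b, p (a - b) = p a - p b) ->
    (forall a, `|p a| <= normc a) -> continuous (fun t => p (symb t)).
  move=> pB pn t; apply/cvgrPdist_lt => e e0.
  move/cvg_normcP/cvgrPdist_lt/(_ e e0) : (c t); apply: filterS => s.
  rewrite sub0r normrN ger0_norm ?normc_ge0//; apply: le_lt_trans.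
  by rewrite distrC -pB.
split; apply: continuous_measurable_fun; apply: key.
- by move=> a b; rewrite ReD ReN.
- exact: normc_Re.
- by move=> a b; rewrite ImD ImN.
- exact: normc_Im.
Qed.

Lemma symb_bounded : exists2 B, 0 <= B & forall t, normc (symb t) <= B.
Proof.
have cn : continuous (fun p => normc (phi p)).
  move=> p; apply/(@cvgrPdist_lt _ _ _ (nbhs p) _) => e e0.
  have := @phi_cont p; move=> /(@cvg_normcP _ _ (nbhs p) _).
  move=> /(@cvgrPdist_lt _ _ _ (nbhs p) _)/(_ e e0); apply: filterS => q.
  rewrite sub0r normrN ger0_norm ?normc_ge0//; apply: le_lt_trans.
  by rewrite distrC normc_dist.
have [|c _ hc] := @compact_EVT_max (one_point_compactification R) R _ [set: _] _
  one_point_compactification_compact (continuous_subspaceT cn).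
  by exists None.
by exists (normc (phi c)) => [|t]; [exact: normc_ge0|rewrite hc// inE].
Qed.

Lemma L2_symb y : L2 y -> L2 (fun t => symb t * y t).
Proof.
have [B _ hB] := symb_bounded.
exact: (L2_bounded cmeasurable_symb hB).
Qed.

Lemma hankelE y x : hankel phi y x =
  lim (cauchyT (fun t => symb t * y t) x e @[e --> 0^'+]).
Proof. by []. Qed.

Lemma hankel_ae y : L2 y -> exists2 h, L2 h &
  represents h (hcoef (fun t => symb t * y t)) /\ ae_same (hankel phi y) h.
Proof.
move=> Ly; have Lg := L2_symb Ly.
have [h Lh hr] := riesz_fischer (fun n => hcoef_bessel n Lg).
exists h => //; split=> //.
apply: aeS (cauchyT_ae Lh (L2_cmeasurable Lg) (L2_cintegrable0 Lg) hr) => x c.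
by rewrite hankelE; apply: cvg_lim => //; exact: norm_hausdorff.
Qed.

End HankelOperator.

(** * Cauchy's theorem and the Hardy space *)

Section ComplexDerivative.
Context {R : realType}.
Implicit Types (w h : R[i]).
Lemma derivable_den w : derivable (@den R) w 1.
Proof.
have a : derivable (fun w : R[i] => w) w 1 by exact: derivable_id.
have b : derivable (fun w : R[i] => 2^-1%:C%C : R[i]) w 1 by exact: derivable_cst.
have c : derivable (fun w : R[i] => 'i%C : R[i]) w 1 by exact: derivable_cst.
exact: (derivableB b (derivableM c a)).
Qed.

Lemma derivable_ebasis k w : 0 < complex.Im w -> derivable (@ebasis R k) w 1.
Proof.
move=> w0.
have dw : den w != 0 by move: w0; case: w => x y /= y0; rewrite -/(upt x y) den_neq0 // ltW.
have dd : derivable (@den R) w 1 by exact: derivable_den.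
have a := derivableV dw dd.
have c1 : derivable (fun w : R[i] => 1 : R[i]) w 1 by exact: derivable_cst.
have c : derivable (@cayley R) w 1 by exact: (derivableB a c1).
have p : derivable (fun w => cayley w ^+ k : R[i]) w 1 .
  elim: k => [|k IH]; first exact: c1.
  have -> : (fun w => cayley w ^+ k.+1 : R[i]) = (fun w => cayley w * cayley w ^+ k).
    by apply/funext => v; rewrite exprS.
  exact: (derivableM c IH).
exact: (derivableM p a).
Qed.

(** Derivability in direction 1 over the field [R[i]] is complex differentiability, so one [L]
    serves for increments in every real direction. *)
Lemma derivable_linear_approx (F : R[i] -> R[i]) w : derivable F w 1 -> exists L : R[i],
  forall e : R, 0 < e -> exists2 d : R, 0 < d & forall h, normc h < d ->
  normc (F (w + h) - F w - L * h) <= e * normc h.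
Proof.
move=> /cvg_ex [L hl]; exists L => e e0.
have e0' : (0 : R[i]) < e%:C%C by rewrite ltcR.
have /cvgrPdist_lt /(_ _ e0') [d0 /= d00 H] := hl.
have [d dE] : exists d : R, d0 = d%:C%C by exists (complex.Re d0); apply/esym/RRe_real/gtr0_real.
move: d00 H; rewrite dE ltcR => d0' H; exists d => // h hd.
have [->|h0] := eqVneq h 0.
  by rewrite addr0 subrr mulr0 subrr Normc.normc0 mulr0.
have hb : ball_ [eta Num.Def.normr] 0 d%:C%C h.
  by change (`|0 - h| < d%:C%C); rewrite sub0r normrN normrE ltcR.
have := H h hb h0.
rewrite normrE ltcR => /ltW K.
have -> : F (w + h) - F w - L * h = - (h * (L - h^-1 * (F (w + h) - F w))).
  by field.
rewrite normcN Normc.normcM mulrC ler_wpM2r ?normc_ge0//.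
apply: le_trans K; rewrite le_eqVlt; apply/orP; left; apply/eqP.
by congr (normc (_ - _ * (F _ - _))); rewrite /= [h *: _]mulr1 addrC.
Qed.
End ComplexDerivative.

(** * Cauchy's theorem on rectangles *)

Section Goursat.
Context {R : realType}.
Local Notation mu := (@lebesgue_measure R).
Implicit Types (f : R -> R[i]) (g : R -> R -> R[i]).

(** Stated with [normc], so that all radii stay in [R] rather than in [R[i]]. *)
Definition ccont f := forall x e, 0 < e ->
  exists2 d, 0 < d & forall y, `|y - x| < d -> normc (f y - f x) < e.

Lemma ccont_continuous f (p : R[i] -> R) :
  (forall z w, `|p z - p w| <= normc (z - w)) -> ccont f -> continuous (p \o f).
Proof.
move=> hp fc x; apply/(@cvgrPdist_lt _ _ _ (nbhs x)) => e e0.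
have [d d0 H] := fc x e e0.
exists d => //= y; rewrite /ball_ /= distrC => yx.
rewrite distrC; exact: le_lt_trans (hp _ _) (H y yx).
Qed.

Lemma ccont_cmeasurable f : ccont f -> cmeasurable f.
Proof.
move=> fc; split; apply: continuous_measurable_fun.
  apply: (ccont_continuous _ fc) => z w; rewrite -ReN -ReD; exact: normc_Re.
apply: (ccont_continuous _ fc) => z w; rewrite -ImN -ImD; exact: normc_Im.
Qed.

Lemma ccont_bounded f a b : ccont f -> exists B : R, forall x, a <= x <= b -> normc (f x) <= B.
Proof.
move=> fc; have [ab|ab] := leP a b; last first.
  by exists 0 => x /andP[ax xb]; move: (lt_le_trans ab (le_trans ax xb)); rewrite ltxx.
have nc : continuous (fun x => normc (f x)).
  have H := @ccont_continuous f (@Normc.normc R) _ fc.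
  by apply: H => z w; exact: normc_dist.
have [c _ H] := EVT_max ab (continuous_subspaceT nc).
by exists (normc (f c)) => x xab; apply: H; rewrite in_itv.
Qed.

(* Half-open intervals make [CI] additive without discarding endpoints. *)
Definition cind (a b : R) f x : R[i] := (\1_`[a, b[ x : R)%:C%C * f x.

Definition CI (a b : R) f : R[i] := cintegral (cind a b f).

Lemma cmeasurable_cind a b f : cmeasurable f -> cmeasurable (cind a b f).
Proof.
move=> mf; apply: cmeasurableM => //; apply: cmeasurable_real.
exact: measurable_indic.
Qed.

Lemma normc_cind a b f B : (forall x, a <= x <= b -> normc (f x) <= B) ->
  forall x, normc (cind a b f x) <= B * \1_`[a, b[ x.
Proof.
move=> fB x; rewrite /cind Normc.normcM normc_real indicE mem_setE in_itv /=.
case: (boolP (_ && _)) => [/andP[ax xb]|_] /=; last by rewrite normr0 mul0r mulr0.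
by rewrite normr1 mul1r mulr1 fB// ax ltW.
Qed.

Lemma cind_integrable a b f : ccont f -> cintegrable (cind a b f).
Proof.
move=> fc; have [B fB] := ccont_bounded a b fc.
apply: (cintegrable_le _ (normc_cind fB)).
  exact/cmeasurable_cind/ccont_cmeasurable.
by apply: rintegrableZ; exact: integrable_indic_itv.
Qed.

Lemma rintegral_indic_itv (a b : R) : a <= b -> \int[mu]_(x in [set: R]) (\1_`[a, b[ x : R) = b - a.
Proof.
move=> ab; rewrite /Rintegral integral_indic// setIT /= lebesgue_measure_itv /= lte_fin.
by move: ab; rewrite le_eqVlt => /orP[/eqP ->|->//]; rewrite ltxx subrr.
Qed.

Lemma CI_le a b f B : a <= b -> ccont f ->
  (forall x, a <= x <= b -> normc (f x) <= B) -> normc (CI a b f) <= B * (b - a).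
Proof.
move=> ab fc fB; have ci := cind_integrable a b fc.
apply: (le_trans (normc_cintegral ci)); rewrite -(rintegral_indic_itv ab).
have ri : rintegrable (\1_`[a, b[ : R -> R) by exact: integrable_indic_itv.
rewrite -RintegralZl//; apply: le_Rintegral => //.
- exact: cintegrable_normc.
- exact: rintegrableZ.
- by move=> x _; exact: normc_cind.
Qed.

Lemma CI_cst a b (z : R[i]) : a <= b -> CI a b (fun=> z) = z * (b - a)%:C%C.
Proof.
move=> ab; have ri : rintegrable (\1_`[a, b[ : R -> R) by exact: integrable_indic_itv.
rewrite /CI /cind; under eq_cintegral do rewrite mulrC.
have ci : cintegrable (fun x => (\1_`[a, b[ x : R)%:C%C).
  by split => //=; exact: integrable0.
rewrite cintegralZ// /cintegral /= rintegral_indic_itv//; congr (_ * Complex _ _).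
by rewrite /Rintegral integral0.
Qed.

Lemma CI_cat a m b f : a <= m -> m <= b -> ccont f -> CI a b f = CI a m f + CI m b f.
Proof.
move=> am mb fc; rewrite /CI -cintegralD; [|exact: cind_integrable..].
apply: eq_cintegral => x; rewrite /cind -mulrDl -rmorphD /=; congr (_%:C%C * _).
rewrite !indicE !mem_setE !in_itv /=.
have [xm|xm] := ltP x m.
  by rewrite (lt_le_trans xm mb) !andbT addr0.
by rewrite (le_trans am xm) /= add0r.
Qed.

Lemma CI_B a b f f' : ccont f -> ccont f' -> CI a b (fun x => f x - f' x) = CI a b f - CI a b f'.
Proof.
move=> fc fc'; rewrite /CI -cintegralB; [|exact: cind_integrable..].
by apply: eq_cintegral => x; rewrite /cind mulrBr.
Qed.

Lemma ccontB f f' : ccont f -> ccont f' -> ccont (fun x => f x - f' x).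
Proof.
move=> fc fc' x e e0; have [d d0 H] := fc x (e / 2) ltac:(by rewrite divr_gt0).
have [d' d0' H'] := fc' x (e / 2) ltac:(by rewrite divr_gt0).
exists (Num.min d d'); first by rewrite lt_min d0.
move=> y; rewrite lt_min => /andP[y1 y2].
have -> : f y - f' y - (f x - f' x) = (f y - f x) - (f' y - f' x) by ring.
rewrite (le_lt_trans (le_normcD _ _))// normcN [e]splitr ltrD//; [exact: H|exact: H'].
Qed.

Lemma ccont_cst (z : R[i]) : ccont (fun=> z).
Proof. by move=> x e e0; exists 1 => // y _; rewrite subrr Normc.normc0. Qed.

Variable g : R -> R -> R[i].
Hypothesis gx : forall y, ccont (g ^~ y).
Hypothesis gy : forall x, ccont (g x).

Definition contour (a b c d : R) : R[i] :=
  CI a b (fun x => g x c - g x d) + 'i%C * CI c d (fun y => g b y - g a y).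

(** A single complex [L] for the two real variables: this encodes the Cauchy-Riemann equations. *)
Definition analytic_at (x y : R) := exists L : R[i], forall e, 0 < e ->
  exists2 dl, 0 < dl & forall u v, `|u - x| < dl -> `|v - y| < dl ->
  normc (g u v - g x y - L * Complex (u - x) (v - y)) <= e * (`|u - x| + `|v - y|).

Lemma contour_catx a m b c d : a <= m -> m <= b ->
  contour a b c d = contour a m c d + contour m b c d.
Proof.
move=> am mb; rewrite /contour (CI_cat am mb); last by apply: ccontB; exact: gx.
rewrite !(CI_B c d (gy _) (gy _)); ring.
Qed.

Lemma contour_caty a b c m d : c <= m -> m <= d ->
  contour a b c d = contour a b c m + contour a b m d.
Proof.
move=> cm md; rewrite /contour (CI_cat cm md); last by apply: ccontB; exact: gy.
rewrite !(CI_B a b (gx _) (gx _)); ring.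
Qed.

(* The affine part of [g] contributes [L i (c - d) (b - a)] on the horizontal sides and its
   opposite on the vertical ones. *)
Lemma contour_le a b c d x y (L : R[i]) e : a <= b -> c <= d -> a <= x <= b -> c <= y <= d -> 0 <= e ->
  (forall u v, a <= u <= b -> c <= v <= d ->
    normc (g u v - g x y - L * Complex (u - x) (v - y)) <= e * (`|u - x| + `|v - y|)) ->
  normc (contour a b c d) <= 2 * e * (b - a + (d - c)) ^+ 2.
Proof.
move=> ab cd /andP[ax xb] /andP[cy yd] e0 H; set s := b - a + (d - c).
pose r u v := g u v - g x y - L * Complex (u - x) (v - y).
have rs u v : a <= u <= b -> c <= v <= d -> normc (r u v) <= e * s.
  move=> hu hv; apply: (le_trans (H u v hu hv)); rewrite ler_wpM2l//.
  case/andP: hu => ? ?; case/andP: hv => ? ?.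
  by rewrite lerD// ler_norml; apply/andP; split; lra.
have aa : a <= a <= b by rewrite lexx.
have bb : a <= b <= b by rewrite lexx andbT.
have cc : c <= c <= d by rewrite lexx.
have dd : c <= d <= d by rewrite lexx andbT.
have rd u v u' v' : a <= u <= b -> c <= v <= d -> a <= u' <= b -> c <= v' <= d ->
    normc (r u v - r u' v') <= 2 * e * s.
  move=> h1 h2 h3 h4; rewrite (le_trans (le_normcD _ _))// normcN.
  have -> : 2 * e * s = e * s + e * s by ring.
  by rewrite lerD// rs.
pose zh := L * Complex 0 (c - d); pose zv := L * Complex (b - a) 0.
have cx : ccont (fun u => g u c - g u d) by apply: ccontB; exact: gx.
have cyy : ccont (fun v => g b v - g a v) by apply: ccontB; exact: gy.
have -> : contour a b c d = CI a b (fun u => g u c - g u d - zh) +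
    'i%C * CI c d (fun v => g b v - g a v - zv).
  rewrite (CI_B a b cx (ccont_cst _)) (CI_B c d cyy (ccont_cst _)) !CI_cst//.
  rewrite /contour mulrBr addrACA -opprD.
  have -> : zh * (b - a)%:C%C + 'i%C * (zv * (d - c)%:C%C) = 0.
    rewrite /zh /zv; case: (L) => l1 l2; apply/eqP; rewrite eq_complex /=.
    by apply/andP; split; apply/eqP; ring.
  by rewrite subr0.
have i1 : normc (CI a b (fun u => g u c - g u d - zh)) <= 2 * e * s * (b - a).
  apply: CI_le => //; first by apply: ccontB => //; exact: ccont_cst.
  move=> u hu; have := rd u c u d hu cc hu dd; rewrite /r /zh.
  by congr (normc _ <= _); case: (L) => l1 l2; apply/eqP; rewrite eq_complex;
    case: (g u c) => ? ?; case: (g u d) => ? ?; case: (g x y) => ? ? /=;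
    apply/andP; split; apply/eqP; ring.
have i2 : normc (CI c d (fun v => g b v - g a v - zv)) <= 2 * e * s * (d - c).
  apply: CI_le => //; first by apply: ccontB => //; exact: ccont_cst.
  move=> v hv; have := rd b v a v bb hv aa hv; rewrite /r /zv.
  by congr (normc _ <= _); case: (L) => l1 l2; apply/eqP; rewrite eq_complex;
    case: (g a v) => ? ?; case: (g b v) => ? ?; case: (g x y) => ? ? /=;
    apply/andP; split; apply/eqP; ring.
rewrite (le_trans (le_normcD _ _))// Normc.normcM normc_i mul1r.
rewrite (le_trans (lerD i1 i2))// -mulrDr -/s expr2; lra.
Qed.

Section Bisection.
Variables a c w h : R.
Hypothesis w0 : 0 <= w.
Hypothesis h0 : 0 <= h.
Let r := normc (contour a (a + w) c (c + h)).

Let cell n (p : R * R) := normc (contour p.1 (p.1 + w / 2 ^+ n) p.2 (p.2 + h / 2 ^+ n)).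
Let child n (p : R * R) (q : bool * bool) : R * R :=
  (p.1 + q.1%:R * (w / 2 ^+ n.+1), p.2 + q.2%:R * (h / 2 ^+ n.+1)).

(** Pigeonhole: the contour integral is the sum of those over the four quarters, since the inner
    sides cancel. *)
Let cell_le n p : r / 4 ^+ n <= cell n p -> exists q, r / 4 ^+ n.+1 <= cell n.+1 (child n p q).
Proof.
move=> H; apply: contrapT => /forallNP N.
have {}N q : cell n.+1 (child n p q) < r / 4 ^+ n.+1 by rewrite ltNge; exact/negP.
case: p H N => x y; rewrite /cell /child /= => H N.
have t0 : 0 < 2 ^- n.+1 :> R by rewrite invr_gt0 exprn_gt0.
set w' := w / 2 ^+ n.+1 in N; set h' := h / 2 ^+ n.+1 in N.
have ew : w / 2 ^+ n = w' + w' by rewrite /w' exprS; field; rewrite expf_neq0.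
have eh : h / 2 ^+ n = h' + h' by rewrite /h' exprS; field; rewrite expf_neq0.
have w'0 : 0 <= w' by rewrite mulr_ge0// ltW.
have h'0 : 0 <= h' by rewrite mulr_ge0// ltW.
have x1 : x <= x + w' by rewrite lerDl.
have x2 : x + w' <= x + w' + w' by rewrite lerDl.
have y1 : y <= y + h' by rewrite lerDl.
have y2 : y + h' <= y + h' + h' by rewrite lerDl.
move: H; rewrite ew eh !addrA (contour_catx _ _ x1 x2).
rewrite (contour_caty x (x + w') y1 y2) (contour_caty (x + w') (x + w' + w') y1 y2).
have := N (false, false); have := N (true, false); have := N (false, true); have := N (true, true).
rewrite /= !mul0r !mul1r !addr0 => n1 n2 n3 n4.
set A1 := contour _ _ _ _; set A2 := contour _ _ _ _; set A3 := contour _ _ _ _; set A4 := contour _ _ _ _.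
have e4 : r / 4 ^+ n = 4 * (r / 4 ^+ n.+1) by rewrite exprS; field; rewrite expf_neq0.
rewrite e4; apply/negP; rewrite -ltNge.
have a0 := le_normcD (A1 + A2) (A3 + A4).
have a1 := le_normcD A1 A2; have a2 := le_normcD A3 A4.
apply: (le_lt_trans a0); apply: (le_lt_trans (lerD a1 a2)).
have -> (t : R) : 4 * t = (t + t) + (t + t) by ring.
exact: ltrD (ltrD n4 n2) (ltrD n3 n1).
Qed.

Let next n p : R * R :=
  child n p (odflt (false, false) [pick q | r / 4 ^+ n.+1 <= cell n.+1 (child n p q)]).

Let corner := fix corner n := if n is n'.+1 then next n' (corner n') else (a, c).

Let cornerP n : r / 4 ^+ n <= cell n (corner n).
Proof.
elim: n => [|n IH] /=; first by rewrite /cell /= !expr0 !divr1.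
rewrite /next; case: pickP => [q //|N].
have [q Hq] := @cell_le n (corner n) IH.
have Nq := N q.
cbv beta in Nq.
exfalso; rewrite Hq in Nq; discriminate Nq.
Qed.

Let corner1 n : (corner n).1 <= (corner n.+1).1 /\
  (corner n.+1).1 + w / 2 ^+ n.+1 <= (corner n).1 + w / 2 ^+ n.
Proof.
rewrite /= /next /child /=; set q := odflt _ _.
have ew : w / 2 ^+ n = w / 2 ^+ n.+1 + w / 2 ^+ n.+1 by rewrite exprS; field; rewrite expf_neq0.
have : 0 <= w / 2 ^+ n.+1 by rewrite divr_ge0// exprn_ge0.
by rewrite ew; case: q.1; rewrite ?mul0r ?mul1r; split; lra.
Qed.

Let corner2 n : (corner n).2 <= (corner n.+1).2 /\
  (corner n.+1).2 + h / 2 ^+ n.+1 <= (corner n).2 + h / 2 ^+ n.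
Proof.
rewrite /= /next /child /=; set q := odflt _ _.
have ew : h / 2 ^+ n = h / 2 ^+ n.+1 + h / 2 ^+ n.+1 by rewrite exprS; field; rewrite expf_neq0.
have : 0 <= h / 2 ^+ n.+1 by rewrite divr_ge0// exprn_ge0.
by rewrite ew; case: q.2; rewrite ?mul0r ?mul1r; split; lra.
Qed.

Let nested (u l : nat -> R) : (forall n, 0 <= l n) ->
  (forall n, u n <= u n.+1 /\ u n.+1 + l n.+1 <= u n + l n) ->
  exists x, forall n, u n <= x <= u n + l n.
Proof.
move=> l0 H.
have mu1 n k : u n <= u (n + k)%N.
  by elim: k => [|k IH]; rewrite ?addn0// addnS (le_trans IH)//; case: (H (n + k)%N).
have mu2 n k : u (n + k)%N + l (n + k)%N <= u n + l n.
  by elim: k => [|k IH]; rewrite ?addn0// addnS (le_trans _ IH)//; case: (H (n + k)%N).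
have ul m n : u m <= u n + l n.
  have [mn|/ltnW nm] := leqP m n.
    rewrite -(subnKC mn) (le_trans (mu1 m (n - m)%N))// lerDl//.
  by apply: le_trans (mu2 n (m - n)%N); rewrite subnKC// lerDl.
exists (sup (range u)) => n; apply/andP; split.
  by apply: ub_le_sup; [exists (u 0%N + l 0%N) => _ [m _ <-]|exists n].
by apply: ge_sup; [exists (u 0%N); exists 0%N|move=> _ [m _ <-]].
Qed.

(* Goursat: by quadrisection, cells of side [O(2^-n)] keep at least [r / 4^n] of the contour
   integral, while [contour_le] bounds it by [o(4^-n)] near their common point. *)
Lemma contour_eq0_rect :
  (forall x y, a <= x <= a + w -> c <= y <= c + h -> analytic_at x y) ->
  contour a (a + w) c (c + h) = 0.
Proof.
move=> an; apply/eqP; rewrite -normc_eq0 -/r; apply: contrapT => /negP r0.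
have r0' : 0 < r by rewrite lt_def r0 /r normc_ge0.
have p2 n : 0 <= 2 ^+ n :> R by rewrite exprn_ge0.
have [x hx] := nested (fun n => divr_ge0 w0 (p2 n)) corner1.
have [y hy] := nested (fun n => divr_ge0 h0 (p2 n)) corner2.
have [] := an x y; first by have := hx 0%N; rewrite /= expr0 divr1.
  by have := hy 0%N; rewrite /= expr0 divr1.
move=> L HL; set s := w + h.
have s0 : 0 <= s by rewrite addr_ge0.
(* Chosen so that 2 e s^2 <= r / 2; s + 1 instead of s covers a degenerate rectangle. *)
pose e := r / (4 * (s + 1) ^+ 2).
have e0 : 0 < e by rewrite divr_gt0// mulr_gt0// exprn_gt0// ltr_wpDl.
have [dl dl0 Hd] := HL e e0.
have [n hn] : exists n, s / 2 ^+ n < dl.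
  exists (Num.truncn (s / dl)); set n := Num.truncn _.
  rewrite ltr_pdivrMr ?exprn_gt0// mulrC -ltr_pdivrMr//.
  apply: (lt_le_trans (truncnS_gt _)); rewrite -/n -natrX ler_nat.
  exact: ltn_expl.
have /andP[hx1 hx2] := hx n; have /andP[hy1 hy2] := hy n.
have w'0 : 0 <= w / 2 ^+ n by rewrite divr_ge0.
have h'0 : 0 <= h / 2 ^+ n by rewrite divr_ge0.
have ws : w / 2 ^+ n <= s / 2 ^+ n by rewrite ler_wpM2r ?invr_ge0// /s lerDl.
have hs : h / 2 ^+ n <= s / 2 ^+ n by rewrite ler_wpM2r ?invr_ge0// /s lerDr.
have := cornerP n; rewrite leNgt => /negP; apply.
apply: (le_lt_trans (@contour_le _ _ _ _ x y L e _ _ (hx n) (hy n) (ltW e0) _)).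
- by rewrite lerDl.
- by rewrite lerDl.
- move=> u v /andP[u1 u2] /andP[v1 v2]; apply: Hd; apply: le_lt_trans hn.
    by apply: le_trans ws; rewrite ler_norml; apply/andP; split; lra.
  by apply: le_trans hs; rewrite ler_norml; apply/andP; split; lra.
have -> : (corner n).1 + w / 2 ^+ n - (corner n).1 + ((corner n).2 + h / 2 ^+ n - (corner n).2) = s / 2 ^+ n.
  by rewrite /s; ring.
rewrite expr_div_n -exprM mulnC exprM (_ : 2 ^+ 2 = 4 :> R); last by rewrite expr2; ring.
rewrite mulrA ltr_pM2r ?invr_gt0 ?exprn_gt0//.
have s1 : 0 < (s + 1) ^+ 2 by rewrite exprn_gt0// ltr_wpDl.
rewrite /e (_ : 2 * _ * _ = r * (2^-1 * (s ^+ 2 / (s + 1) ^+ 2))); last by field; rewrite gt_eqF// ltr_wpDl.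
rewrite gtr_pMr// -ltr_pdivlMl ?invr_gt0// invrK mulr1 ltr_pdivrMr//.
rewrite (@le_lt_trans _ _ (1 * (s + 1) ^+ 2))// ?ltr_pM2r ?ltr1n// mul1r.
by rewrite lerXn2r ?nnegrE ?lerDl ?addr_ge0.
Qed.
End Bisection.
End Goursat.

(** * Measurability in two variables and truncated integrals *)

Section JointMeasurability.
Context {R : realType}.
Local Notation mu := (@lebesgue_measure R).

(** The preimage of an open interval is the union of the countably many rational boxes inside it.
    This prepares Tonelli's theorem on the product. *)
Lemma measurable_jointly_continuous (k : R -> R -> R) :
  (forall x y e, 0 < e -> exists2 d, 0 < d & forall u v, `|u - x| < d -> `|v - y| < d ->
     `|k u v - k x y| < e) ->
  measurable_fun [set: R * R] (fun p => k p.1 p.2).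
Proof.
move=> kc; apply: (measurability _ (RGenOpens.measurableE R)).
move=> _ [_ [a [b ->] <-]]; rewrite setTI.
pose U := (fun p : R * R => k p.1 p.2) @^-1` [set` Interval (BRight a) (BLeft b)].
pose box (q : rat * rat * (rat * rat)) : set (R * R) :=
  `]ratr q.1.1, ratr q.1.2[%classic `*` `]ratr q.2.1, ratr q.2.2[%classic.
change (measurable U).
have -> : U = \bigcup_q (if `[< box q `<=` U >] then box q else set0).
  apply/seteqP; split => [[x y] Uxy|p [q _]]; last by case: asboolP => // H; exact: H.
  have [e e0 He] : exists2 e, 0 < e & forall t, `|t - k x y| < e -> a < t < b.
    move: Uxy; rewrite /U /= in_itv /= => /andP[ak kb].
    exists (Num.min (k x y - a) (b - k x y)); first by rewrite lt_min !subr_gt0 ak.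
    by move=> t; rewrite lt_min => /andP[]; rewrite !ltr_norml => /andP[? ?] /andP[? ?]; apply/andP; split; lra.
  have [d d0 Hd] := kc x y e e0.
  have l (t : R) : exists q : rat, t - d < ratr q < t.
    have [q qq] := rat_in_itvoo (ltac:(by rewrite ltrBlDr ltrDl) : t - d < t).
    by exists q; move: qq; rewrite in_itv.
  have g (t : R) : exists q : rat, t < ratr q < t + d.
    have [q qq] := rat_in_itvoo (ltac:(by rewrite ltrDl) : t < t + d).
    by exists q; move: qq; rewrite in_itv.
  have [x1 /andP[? ?]] := l x; have [x2 /andP[? ?]] := g x.
  have [y1 /andP[? ?]] := l y; have [y2 /andP[? ?]] := g y.
  exists ((x1, x2), (y1, y2)) => //.
  rewrite ifT; first by split => /=; rewrite in_itv /=; apply/andP; split.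
  apply/asboolP => -[u v] [/=]; rewrite !in_itv /= => /andP[? ?] /andP[? ?].
  rewrite /U /= in_itv /=; apply: He; apply: Hd; rewrite ltr_norml; apply/andP; split; lra.
apply: countable_bigcupT_measurable => [|q]; first exact: countableP.
case: ifP => // _; apply: measurableX; exact: measurable_itv.
Qed.

Lemma small_value (h : R -> \bar R) (D : set R) (e : R) : 0 < e -> measurable D -> mu D = +oo%E ->
  measurable_fun [set: R] h -> (forall x, 0 <= h x)%E ->
  (\int[mu]_(x in [set: R]) h x < +oo)%E -> exists2 x, D x & (h x < e%:E)%E.
Proof.
move=> e0 mD muD mh h0 fin; apply: contrapT => N.
have he x : D x -> (e%:E <= h x)%E.
  by move=> Dx; rewrite leNgt; apply/negP => hx; apply: N; exists x.
have : (\int[mu]_(x in D) e%:E <= \int[mu]_(x in [set: R]) h x)%E.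
  apply: (@le_trans _ _ (\int[mu]_(x in D) h x)%E).
    apply: ge0_le_integral => //; first by move=> x _; rewrite lee_fin ltW.
    exact: measurable_funTS.
  by apply: ge0_subset_integral.
have -> : (\int[mu]_(x in D) e%:E = +oo)%E.
  transitivity (e%:E * mu D)%E; first exact: integral_cst.
  by rewrite muD gt0_muley ?lte_fin.
rewrite leye_eq => /eqP E.
by rewrite E in fin.
Qed.

Lemma rdominated_cvg0 (t : nat -> R -> R) (k : R -> R) :
  (forall n, measurable_fun [set: R] (t n)) -> (forall n x, 0 <= t n x <= k x) -> rintegrable k ->
  (forall x, t n x @[n --> \oo] --> (0 : R)) ->
  \int[mu]_(x in [set: R]) t n x @[n --> \oo] --> (0 : R).
Proof.
move=> mt tk ki t0.
have tb : {ae mu, forall x, forall n, [set: R] x -> (`|(t n x)%:E| <= (k x)%:E)%E}.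
  by apply: aeT => x n _; have /andP[? ?] := tk n x; rewrite gee0_abs lee_fin.
have tl : {ae mu, forall x, [set: R] x -> (t n x)%:E @[n --> \oo] --> 0%E}.
  by apply: aeT => x _; apply/cvg_EFin; [exact: nearW|exact: t0].
have mt' n : measurable_fun [set: R] (fun x => (t n x)%:E) by apply/measurable_EFinP.
have [_ dc _] := @dominated_convergence _ _ R mu _ measurableT
  (fun n x => (t n x)%:E) (fun=> 0%E) (EFin \o k) mt' (@measurable_cst _ _ _ _ _ _) tl ki tb.
move/fine_cvgP : dc => [_].
apply: cvg_trans; apply: near_eq_cvg; apply: nearW => n /=.
rewrite /Rintegral; congr fine; apply: eq_integral => x _ /=.
by rewrite subr0 ger0_norm//; case/andP: (tk n x).
Qed.

(** Uniform over all intervals that cover [-N, N[, because the two vertical sides of the rectangle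
    will be chosen independently of each other. *)
Lemma CI_cvg_cintegral (f : R -> R[i]) e : 0 < e -> cintegrable f -> exists N : R,
  forall a b, a <= - N -> N <= b -> normc (CI a b f - cintegral f) <= e.
Proof.
move=> e0 fi.
have ni := cintegrable_normc fi.
have mf : cmeasurable f by exact: cintegrable_measurable.
pose o (n : nat) x : R := 1 - \1_(`[- n%:R, n%:R[%classic : set R) x.
have o01 n x : 0 <= o n x <= 1.
  by rewrite /o indicE; case: (_ \in _); rewrite ?subrr ?subr0 lexx ?ler01.
have mo n : measurable_fun [set: R] (o n).
  by apply: measurable_funB => //; exact: measurable_indic.
pose t n x := normc (f x) * o n x.
have mt n : measurable_fun [set: R] (t n).
  by apply: measurable_funM => //; exact: measurable_normc.
have t_le n x : 0 <= t n x <= normc (f x).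
  by have /andP[? ?] := o01 n x; rewrite /t; apply/andP; split; [exact: mulr_ge0|exact: ler_piMr].
have t_cvg x : t n x @[n --> \oo] --> (0 : R).
  apply: (@cvg_near_cst _ _ _ _ _); exists (Num.truncn `|x|).+1 => // n /= hn.
  rewrite /t /o indicE mem_setE in_itv /=.
  have xn : `|x| < n%:R by apply: lt_le_trans (truncnS_gt _) _; rewrite ler_nat.
  by move: xn; rewrite ltr_norml => /andP[/ltW -> ->]; rewrite subrr mulr0.
have It0 n : 0 <= \int[mu]_(x in [set: R]) t n x.
  by apply: Rintegral_ge0 => x _; case/andP: (t_le n x).
have [N /(_ N (leqnn N)) HN] := (cvg0_seqP It0).1 (rdominated_cvg0 mt t_le ni t_cvg) e e0.
exists N%:R => a b aN Nb.
have mc : cmeasurable (cind a b f) by exact: cmeasurable_cind.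
have ci : cintegrable (cind a b f).
  apply: (cintegrable_le mc _ ni) => x; rewrite /cind Normc.normcM normc_real indicE.
  by case: (_ \in _); rewrite ?normr1 ?normr0 ?mul1r ?mul0r.
rewrite /CI -cintegralB//.
have di := cintegrableB ci fi.
apply: (le_trans (normc_cintegral di)); apply: le_trans (ltW HN).
apply: le_Rintegral => //.
- exact: cintegrable_normc.
- apply: rintegrable_le (ni) => // x; rewrite ger0_norm; by case/andP: (t_le N x).
move=> x _; rewrite /cind /t /o !indicE !mem_setE !in_itv /=.
have [/andP[h1 h2]|H] := boolP (- N%:R <= x < N%:R).
  by rewrite (le_trans aN h1) (lt_le_trans h2 Nb) /= mul1r subrr Normc.normc0 subrr mulr0.
rewrite subr0 mulr1; case: (_ && _) => /=.
  by rewrite mul1r subrr Normc.normc0 normc_ge0.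
by rewrite mul0r sub0r normcN.
Qed.
End JointMeasurability.

(** * Integrals along horizontal lines in the upper half-plane *)

Section HalfPlane.
Context {R : realType}.
Local Notation mu := (@lebesgue_measure R).

Lemma normc_Complex_le (p q : R) : normc (Complex p q) <= `|p| + `|q|.
Proof. exact: (normc_le_ReIm (Complex p q)). Qed.

Section Clamp.
Variable G : R[i] -> R[i].
Hypothesis dG : forall w, 0 < complex.Im w -> derivable G w 1.
Variable y0 : R.
Hypothesis y0_gt0 : 0 < y0.

(* Freezing [y] below [y0] makes [G] continuous on the whole plane. *)
Definition clamp x y := G (upt x (Num.max y y0)).

Lemma clampE x y : y0 <= y -> clamp x y = G (upt x y).
Proof. by move=> yy; rewrite /clamp max_l. Qed.

Let max_dist (v y : R) : `|Num.max v y0 - Num.max y y0| <= `|v - y|.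
Proof.
have h1 := ler_norm (v - y); have := ler_norm (y - v); rewrite distrC => h2.
rewrite ler_norml maxEle maxEle; do 2 case: ifPn; rewrite -?ltNge => *; apply/andP; split; lra.
Qed.

Lemma clamp_cont x y e : 0 < e -> exists2 d, 0 < d & forall u v, `|u - x| < d -> `|v - y| < d ->
  normc (clamp u v - clamp x y) < e.
Proof.
move=> e0; set w := upt x (Num.max y y0).
have w0 : 0 < complex.Im w by rewrite /w /= lt_max y0_gt0 orbT.
have [L HL] := derivable_linear_approx (dG w0).
have [d d0 Hd] := HL 1 ltr01.
have L0 : 0 < normc L + 1 by rewrite ltr_wpDl.
exists (Num.min (d / 2) (e / (2 * (normc L + 1)))).
  by rewrite lt_min !divr_gt0// mulr_gt0.
move=> u v; rewrite !lt_min => /andP[u1 u2] /andP[v1 v2].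
set h := Complex (u - x) (Num.max v y0 - Num.max y y0).
have hle : normc h <= `|u - x| + `|v - y|.
  by apply: (le_trans (normc_Complex_le _ _)); rewrite lerD2l.
have hd : normc h < d by apply: (le_lt_trans hle); rewrite [d]splitr ltrD.
have he : normc h < e / (normc L + 1).
  apply: (le_lt_trans hle); rewrite [ltRHS]splitr.
  by rewrite (_ : e / (normc L + 1) / 2 = e / (2 * (normc L + 1))) ?ltrD//; field; rewrite gt_eqF.
have := Hd h hd; have -> : w + h = upt u (Num.max v y0).
  by apply/eqP; rewrite eq_complex /=; apply/andP; split; apply/eqP; ring.
rewrite -/(clamp u v) -/(clamp x y) mul1r => K.
have -> : clamp u v - clamp x y = (clamp u v - clamp x y - L * h) + L * h by ring.
apply: (le_lt_trans (le_normcD _ _)).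
apply: (@le_lt_trans _ _ (normc h + normc L * normc h)).
  by rewrite lerD// Normc.normcM.
rewrite -{1}[normc h]mul1r -mulrDl [1 + _]addrC mulrC -ltr_pdivlMr//.
Qed.

Lemma clamp_x y : ccont (clamp ^~ y).
Proof.
move=> x e e0; have [d d0 H] := clamp_cont x y e0; exists d => // u ux.
by apply: H => //; rewrite subrr normr0.
Qed.

Lemma clamp_y x : ccont (clamp x).
Proof.
move=> y e e0; have [d d0 H] := clamp_cont x y e0; exists d => // v vy.
by apply: H => //; rewrite subrr normr0.
Qed.

Lemma clamp_analytic x y : y0 < y -> analytic_at clamp x y.
Proof.
move=> yy; have w0 : 0 < complex.Im (upt x y) by rewrite /= (lt_trans y0_gt0).
have [L HL] := derivable_linear_approx (dG w0).
exists L => e e0; have [d d0 Hd] := HL e e0.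
exists (Num.min (d / 2) (y - y0)); first by rewrite lt_min divr_gt0// subr_gt0.
move=> u v; rewrite !lt_min => /andP[u1 u2] /andP[v1 v2].
have vy : y0 <= v by move: v2; rewrite ltr_norml => /andP[? ?]; lra.
rewrite !clampE ?(ltW yy)//.
set h := Complex (u - x) (v - y).
have hle : normc h <= `|u - x| + `|v - y| by exact: normc_Complex_le.
have hd : normc h < d by apply: (le_lt_trans hle); rewrite [d]splitr ltrD.
have -> : upt u v = upt x y + h.
  by apply/eqP; rewrite eq_complex /=; apply/andP; split; apply/eqP; ring.
by apply: (le_trans (Hd h hd)); rewrite ler_wpM2l// ltW.
Qed.

Variables (c d B : R).
Hypothesis yc : y0 < c.
Hypothesis cd : c <= d.
Hypothesis G_int : forall y, c <= y <= d -> cintegrable (fun x => G (upt x y)) /\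
  \int[mu]_(x in [set: R]) normc (G (upt x y)) <= B.

Let f (p : R * R) : \bar R := (normc (clamp p.1 p.2) * \1_(`[c, d[%classic : set R) p.2)%:E.

Let f0 p : (0 <= f p)%E.
Proof. rewrite lee_fin; apply: mulr_ge0; first exact: normc_ge0.
by rewrite indicE; case: (_ \in _). Qed.

Let mf : measurable_fun [set: R * R] f.
Proof.
apply/measurable_EFinP; apply: measurable_funM.
  apply: (@measurable_jointly_continuous R (fun x y => normc (clamp x y))) => x y e e0.
  have [dd d0 H] := clamp_cont x y e0; exists dd => // u v u1 v1.
  exact: le_lt_trans (normc_dist _ _) (H u v u1 v1).
have -> : (fun p : R * R => \1_(`[c, d[%classic : set R) p.2 : R) =
  \1_(`[c, d[%classic : set R) \o snd by [].
apply: measurableT_comp => //; exact: measurable_indic.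
Qed.

Let H x := (\int[mu]_(y in [set: R]) f (x, y))%E.

Let mH : measurable_fun [set: R] H.
Proof. exact: measurable_fun_fubini_tonelli_F. Qed.

Let H0 x : (0 <= H x)%E.
Proof. exact: integral_ge0. Qed.

Let H_fin : (\int[mu]_(x in [set: R]) H x < +oo)%E.
Proof.
rewrite /H fubini_tonelli//.
apply: (@le_lt_trans _ _ (\int[mu]_(y in [set: R]) (B * \1_(`[c, d[%classic : set R) y)%:E)%E).
  apply: ge0_le_integral => //.
  - by move=> y _; exact: integral_ge0.
  - exact: measurable_fun_fubini_tonelli_G.
  - by apply/measurable_EFinP; apply: measurable_funM => //; exact: measurable_indic.
  move=> y _; rewrite /f /= indicE mem_setE in_itv /=.
  have [/andP[cy yd]|_] := boolP (c <= y < d); last first.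
    by under eq_integral do rewrite mulr0; rewrite integral0 mulr0.
  under eq_integral do rewrite mulr1.
  have [ci cB] := G_int (ltac:(by rewrite cy ltW) : c <= y <= d).
  rewrite mulr1; under eq_integral do rewrite clampE ?(ltW (lt_le_trans yc cy))//.
  have ni := cintegrable_normc ci.
  rewrite -[leLHS]fineK ?lee_fin//.
  exact: integrable_fin_num.
have ib : rintegrable (fun y : R => B * \1_(`[c, d[%classic : set R) y).
  by apply: rintegrableZ; exact: integrable_indic_itv.
by rewrite ltey_eq (integrable_fin_num measurableT ib).
Qed.

Let CI_le_H x e : (H x < e%:E)%E -> normc (CI c d (clamp x)) <= e.
Proof.
move=> He; have ci := cind_integrable c d (clamp_y x).
apply: (le_trans (normc_cintegral ci)).
have ni := cintegrable_normc ci.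
rewrite -lee_fin /Rintegral fineK; last exact: integrable_fin_num.
apply: le_trans (ltW He); rewrite le_eqVlt; apply/orP; left; apply/eqP.
apply: eq_integral => y _; rewrite /f /cind Normc.normcM normc_real /= mulrC.
by rewrite [`|_|]ger0_norm// indicE; case: (_ \in _).
Qed.

(* The vertical sides are chosen where [H x], the integral of [|G|] over the side at [x], is
   small; such abscissas exist near both ends since [H] is integrable by Tonelli. *)
Lemma horizontal_integral_cst :
  cintegral (fun x => G (upt x c)) = cintegral (fun x => G (upt x d)).
Proof.
have [ic _] := G_int (ltac:(by rewrite lexx) : c <= c <= d).
have [id _] := G_int (ltac:(by rewrite cd lexx) : c <= d <= d).
apply/eqP; rewrite -subr_eq0 -normc_eq0; set r := normc _; apply: contrapT => /negP r0.
have {}r0 : 0 < r by rewrite lt_def r0 /r normc_ge0.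
(* Two truncated horizontal sides and two vertical sides cost [e] each, 4 e = r / 2 in total. *)
pose e := r / 8; have e0 : 0 < e by rewrite divr_gt0.
have [N1 HN1] := CI_cvg_cintegral e0 ic; have [N2 HN2] := CI_cvg_cintegral e0 id.
pose N := Num.max 0 (Num.max N1 N2).
have N0 : 0 <= N by rewrite le_max lexx.
have N11 : N1 <= N by rewrite !le_max lexx orbT.
have N22 : N2 <= N by rewrite !le_max lexx !orbT.
have muT : mu `[N, +oo[%classic = +oo%E by rewrite lebesgue_measure_itv /= ltry.
have muS : mu `]-oo, - N]%classic = +oo%E by rewrite lebesgue_measure_itv /= ltNyr.
have [T TN HT] := small_value e0 (measurable_itv _) muT mH H0 H_fin.
have [S SN HS] := small_value e0 (measurable_itv _) muS mH H0 H_fin.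
move: TN SN; rewrite /= !in_itv /= andbT => TN SN.
have ST : S <= T by apply: le_trans TN; apply: (le_trans SN); rewrite (le_trans _ N0)// oppr_le0.
have [w [hh [w0 h0 wE hE]]] : exists w h, [/\ 0 <= w, 0 <= h, T = S + w & d = c + h].
  by exists (T - S), (d - c); split; rewrite ?subr_ge0// addrC subrK.
have := contour_eq0_rect clamp_x clamp_y w0 h0 (a := S) (c := c).
rewrite -wE -hE => /(_ (fun x y _ hy => clamp_analytic x (lt_le_trans yc (andP hy).1))).
rewrite /contour (CI_B S T (clamp_x c) (clamp_x d)) (CI_B c d (clamp_y T) (clamp_y S)) => E0.
have cE : (fun x => clamp x c) = (fun x => G (upt x c)).
  by apply/funext => x; rewrite clampE// ltW.
have dE : (fun x => clamp x d) = (fun x => G (upt x d)).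
  by apply/funext => x; rewrite clampE// (le_trans (ltW yc)).
rewrite cE dE in E0.
have b1 := HN1 S T ltac:(by rewrite (le_trans SN)// lerN2) (le_trans N11 TN).
have b2 := HN2 S T ltac:(by rewrite (le_trans SN)// lerN2) (le_trans N22 TN).
have b3 := CI_le_H HT; have b4 := CI_le_H HS.
suff : r <= e + e + (e + e) by rewrite leNgt => /negP; apply; rewrite /e; lra.
move: b1 b2 E0; rewrite /r; set I1 := CI _ _ _; set I2 := CI _ _ _; set J1 := cintegral _; set J2 := cintegral _.
move=> b1 b2 E0; have -> : J1 - J2 = (I2 - J2) - (I1 - J1) - 'i%C * (CI c d (clamp T) - CI c d (clamp S)).
  by apply/eqP; rewrite -subr_eq0 -E0; apply/eqP; ring.
apply: (le_trans (le_normcD _ _)); rewrite normcN Normc.normcM normc_i mul1r; apply: lerD.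
  by apply: (le_trans (le_normcD _ _)); rewrite normcN lerD.
by apply: (le_trans (le_normcD _ _)); rewrite normcN lerD.
Qed.
End Clamp.
End HalfPlane.

(** * The Hardy space and the expansion of its elements *)

Section HardySpace.
Context {R : realType}.
Local Notation mu := (@lebesgue_measure R).

Lemma derivable_cmul (f g : R[i] -> R[i]) (w : R[i]) :
  derivable f w 1 -> derivable g w 1 -> derivable (fun v => f v * g v) w 1.
Proof. by move=> h1 h2; exact: (derivableM h1 h2). Qed.

Lemma cmeasurable_upt (G : R[i] -> R[i]) y : 0 < y ->
  (forall w, 0 < complex.Im w -> derivable G w 1) -> cmeasurable (fun x => G (upt x y)).
Proof.
move=> y0 dG; have -> : (fun x => G (upt x y)) = (clamp G y)^~ y.
  by apply/funext => x; rewrite clampE.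
exact/ccont_cmeasurable/(clamp_x dG y0).
Qed.

Lemma L2_ebasis k (y : R) : 0 < y -> L2 (fun x => ebasis k (upt x y)).
Proof.
move=> y0; apply: (L2_le (g := @basis_fun R 0)); [|exact: L2_basis_fun|].
  by apply: cmeasurable_upt => // w; exact: derivable_ebasis.
by move=> x; apply: normc_ebasis_le; exact: ltW.
Qed.

(** |den|^-2 is a multiple of the Poisson kernel at height 1/2 + y, whose integral is 1. The decay
    in [y] is what forces the constant horizontal integrals to be 0. *)
Lemma sqint_ebasis_le k (y : R) : 0 < y ->
  sqint (fun x => ebasis k (upt x y)) <= pi / (2^-1 + y).
Proof.
move=> y0; set s := 2^-1 + y; have s0 : 0 < s by rewrite addr_gt0.
have [ip Ip] := @poisson_ker_integral R 0 s s0.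
have -> : pi / s = \int[mu]_(x in [set: R]) (pi / s * poisson_ker 0 s x).
  by rewrite RintegralZl// Ip mulr1.
apply: le_Rintegral => //; first exact/L2_rintegrable/L2_ebasis.
  exact: rintegrableZ.
move=> x _; rewrite /poisson_ker subr0.
have D0 : 0 < x ^+ 2 + s ^+ 2 by rewrite ltr_wpDl ?sqr_ge0// exprn_gt0.
have -> : pi / s * (pi^-1 * (s / (x ^+ 2 + s ^+ 2))) = (x ^+ 2 + s ^+ 2)^-1.
  have p0 := @pi_gt0 R; move: (pi : R) p0 => q q0; field.
  by rewrite !gt_eqF.
rewrite /ebasis Normc.normcM normcX Normc.normcV exprMn exprVn normc_den -/s [x ^+ 2 + _]addrC.
rewrite ler_piMl ?invr_ge0 ?addr_ge0 ?sqr_ge0//.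
by rewrite exprn_ile1 ?exprn_ge0 ?normc_ge0// exprn_ile1 ?normc_ge0// normc_cayley_le1// ltW.
Qed.

(** The difference of the two 1 / den is at most 2 y |e_0|, which is also the error of one factor
    [cayley]. As |e_0| <= 2, each of the [k] factors adds at most 4 y |e_0|. *)
Lemma ebasis_boundary k (x y : R) : 0 <= y ->
  normc (ebasis k (upt x y) - basis_fun k x) <= (4 * k%:R + 2) * y * normc (basis_fun 0 x).
Proof.
move=> y0.
have x0 := den_neq0 x (lexx 0); have xy := den_neq0 x y0.
have b0 : normc (basis_fun 0 x) = (normc (den (upt x 0)))^-1.
  by rewrite basis_funE /ebasis expr0 mul1r Normc.normcV.
have nx : 0 < normc (den (upt x 0)) by rewrite normc_gt0.
have d0 : normc ((den (upt x y))^-1 - (den (upt x 0))^-1) <= 2 * y * normc (basis_fun 0 x).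
  have -> : (den (upt x y))^-1 - (den (upt x 0))^-1 = - (y%:C%C / (den (upt x y) * den (upt x 0))).
    have -> : y%:C%C = den (upt x y) - den (upt x 0) :> R[i].
      by rewrite !den_upt; apply/eqP; rewrite eq_complex /=; apply/andP; split; apply/eqP; ring.
    by field; rewrite x0 xy.
  rewrite normcN Normc.normcM normc_real (ger0_norm y0) Normc.normcV Normc.normcM invfM b0 mulrA.
  rewrite ler_wpM2r ?invr_ge0 ?normc_ge0// mulrC ler_wpM2r//.
  rewrite -[leRHS]invrK lef_pV2 ?posrE ?invr_gt0// ?normc_gt0//.
  by apply: le_trans (normc_den_ge x y0); rewrite lerDl.
have b2 : normc (basis_fun 0 x) <= 2.
  rewrite b0 -[leRHS]invrK lef_pV2 ?posrE ?invr_gt0//.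
  by apply: le_trans (normc_den_ge x (lexx 0)); rewrite addr0.
elim: k => [|k IH].
  have e0 w : ebasis 0 w = (den w)^-1 :> R[i] by rewrite /ebasis expr0 mul1r.
  by rewrite mulr0 add0r {1}basis_funE !e0.
have eS w : ebasis k.+1 w = ebasis k w * cayley w :> R[i] by rewrite /ebasis exprSr mulrAC.
rewrite basis_funE !eS -basis_funE.
have -> (a b c d : R[i]) : a * b - c * d = (a - c) * b + c * (b - d) by ring.
apply: (le_trans (le_normcD _ _)).
rewrite (Normc.normcM (ebasis k (upt x y) - basis_fun k x)) (Normc.normcM (basis_fun k x)).
have -> : (4 * k.+1%:R + 2) * y * normc (basis_fun 0 x) =
  (4 * k%:R + 2) * y * normc (basis_fun 0 x) + normc (basis_fun 0 x) * (4 * y).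
  by rewrite -natr1; ring.
apply: lerD.
  by apply: le_trans IH; rewrite ler_piMr// normc_cayley_le1.
rewrite normc_basis_fun ler_wpM2l//.
have -> : cayley (upt x y) - cayley (upt x 0) = (den (upt x y))^-1 - (den (upt x 0))^-1 :> R[i].
  by rewrite /cayley; ring.
apply: (le_trans d0); rewrite mulrC (_ : 4 * y = 2 * (2 * y)); last by ring.
by rewrite ler_wpM2r// mulr_ge0.
Qed.

(* The integral of [F e_k] along the line of height [y] does not depend on [y] and is
   [O(1 / sqrt y)], hence is 0; then let [y] tend to 0. *)
Lemma L2plus_orthogonal (f : R -> R[i]) k : L2plus f ->
  cintegral (fun x => f x * basis_fun k x) = 0.
Proof.
move=> [Lf [F [dF [M0 HM] bdry]]].
pose M := Num.max 0 M0; have M_ge0 : 0 <= M by rewrite le_max lexx.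
have LF y : 0 < y -> L2 (fun x => F (upt x y)).
  move=> y0; split; first exact: cmeasurable_upt.
  exact: le_lt_trans (HM y y0) (ltry _).
have nF y : 0 < y -> nrm (fun x => F (upt x y)) <= M.
  move=> y0; have := HM y y0; rewrite -/(upt _ _) (L2normE (LF y y0)) lee_fin => h.
  by rewrite le_max h orbT.
pose G w := F w * ebasis k w.
have dG w : 0 < complex.Im w -> derivable G w 1.
  by move=> w0; apply: derivable_cmul; [exact: dF|exact: derivable_ebasis].
have iG y : 0 < y -> cintegrable (fun x => G (upt x y)).
  by move=> y0; apply: L2_mul_cintegrable; [exact: LF|exact: L2_ebasis].
have nE y : 0 < y -> nrm (fun x => ebasis k (upt x y)) <= nrm (@basis_fun R 0).
  move=> y0; apply: nrm_le; [exact/L2_cmeasurable/L2_ebasis|exact: L2_basis_fun|].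
  by move=> x; apply: normc_ebasis_le; exact: ltW.
have J0 y : 0 < y -> cintegral (fun x => G (upt x y)) = 0.
  move=> y0; apply/eqP; rewrite -normc_eq0; apply: contrapT => /negP r0.
  set r := normc _ in r0; have {}r0 : 0 < r by rewrite lt_def r0 normc_ge0.
  (* A height above [y] where the bound M^2 pi / (1/2 + d) has dropped below r^2. *)
  pose d := M ^+ 2 * pi / r ^+ 2 + y.
  have pi0 := @pi_gt0 R.
  have yd : y <= d by rewrite lerDr divr_ge0 ?mulr_ge0 ?sqr_ge0// ltW.
  have d0 : 0 < d by exact: lt_le_trans yd.
  have y2 : 0 < y / 2 by rewrite divr_gt0.
  have E := @horizontal_integral_cst R G dG (y / 2) y2 y d (M * nrm (@basis_fun R 0))
    (ltac:(lra)) yd.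
  have : r ^+ 2 <= M ^+ 2 * (pi / (2^-1 + d)).
    rewrite /r E; last first.
      move=> v /andP[yv _]; have v0 : 0 < v by exact: lt_le_trans yv.
      split; first exact: iG.
      rewrite /G; under eq_Rintegral do rewrite Normc.normcM.
      apply: (le_trans (cauchy_schwarz_real (LF v v0) (L2_ebasis k v0))).
      by apply: ler_pM; [exact: nrm_ge0|exact: nrm_ge0|exact: nF|exact: nE].
    have := cauchy_schwarz (LF d d0) (L2_ebasis k d0); rewrite -/(G _) => cs.
    apply: (@le_trans _ _ ((M * nrm (fun x => ebasis k (upt x d))) ^+ 2)).
      rewrite ler_pXn2r ?nnegrE ?mulr_ge0 ?nrm_ge0 ?normc_ge0//.
      by apply: (le_trans cs); rewrite ler_wpM2r ?nrm_ge0// nF.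
    by rewrite exprMn sqr_nrm ler_wpM2l ?sqr_ge0// sqint_ebasis_le.
  apply/negP; rewrite -ltNge mulrA ltr_pdivrMr; last by rewrite addr_gt0.
  have -> : r ^+ 2 * (2^-1 + d) = r ^+ 2 * (2^-1 + y) + M ^+ 2 * pi.
    by rewrite /d; move: (pi : R) => q; field; rewrite gt_eqF.
  by rewrite ltrDr mulr_gt0 ?exprn_gt0// addr_gt0.
apply/eqP; rewrite -normc_eq0; apply: contrapT => /negP r0.
set r := normc _ in r0; have {}r0 : 0 < r by rewrite lt_def r0 normc_ge0.
have Ld y : 0 < y -> L2 (fun x => F (upt x y) - f x) by move=> y0; apply: L2B => //; exact: LF.
(* By [J0], F_y [ebasis k] integrates to 0, so the integral of f e_k equals, up to sign, that of
   (F_y - f) e_k plus that of F_y ([ebasis k] - e_k). *)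
have key y : 0 < y -> r <= nrm (fun x => F (upt x y) - f x) * nrm (@basis_fun R k) +
    M * (4 * k%:R + 2) * nrm (@basis_fun R 0) * y.
  move=> y0.
  have Lb : L2 (fun x => ((4 * k%:R + 2) * y)%:C%C * basis_fun 0 x) by apply: L2Z; exact: L2_basis_fun.
  have c0 : 0 <= (4 * k%:R + 2) * y by rewrite mulr_ge0 ?addr_ge0 ?mulr_ge0// ltW.
  have Lbb : L2 (fun x => ebasis k (upt x y) - basis_fun k x).
    by apply: L2B; [exact: L2_ebasis|exact: L2_basis_fun].
  have nbb : nrm (fun x => ebasis k (upt x y) - basis_fun k x) <= (4 * k%:R + 2) * y * nrm (@basis_fun R 0).
    rewrite -[(4 * k%:R + 2) * y](ger0_norm c0) -normc_real -nrmZ; last exact: L2_basis_fun.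
    apply: nrm_le => //; first exact: L2_cmeasurable.
    by move=> x; rewrite Normc.normcM normc_real (ger0_norm c0); apply: ebasis_boundary; exact: ltW.
  have i1 := L2_mul_cintegrable (Ld y y0) (L2_basis_fun k).
  have i2 := L2_mul_cintegrable (LF y y0) Lbb.
  have -> : r = normc (cintegral (fun x => (F (upt x y) - f x) * basis_fun k x) +
      cintegral (fun x => F (upt x y) * (ebasis k (upt x y) - basis_fun k x))).
    rewrite -cintegralD// /r -[in LHS]normcN -[in LHS]cintegralN; last first.
      by apply: L2_mul_cintegrable => //; exact: L2_basis_fun.
    have iG' := iG y y0; have if' := cintegrableN (L2_mul_cintegrable Lf (L2_basis_fun k)).
    rewrite -[in LHS](add0r (cintegral _)) -{1}(J0 y y0) -cintegralD//; congr (normc _).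
    by apply: eq_cintegral => x; rewrite /G; ring.
  apply: (le_trans (le_normcD _ _)); apply: lerD.
    apply: cauchy_schwarz; [exact: Ld|exact: L2_basis_fun].
  apply: (le_trans (cauchy_schwarz (LF y y0) Lbb)).
  rewrite (_ : M * _ * _ * y = M * ((4 * k%:R + 2) * y * nrm (@basis_fun R 0))); last by ring.
  by apply: ler_pM; [exact: nrm_ge0|exact: nrm_ge0|exact: nF|].
have nc : nrm (fun x => F (upt x y) - f x) @[y --> 0^'+] --> (0 : R).
  apply/L2norm_cvg0; last exact: bdry.
  by near=> y; apply: Ld; near: y; exact: nbhs_right_gt.
have uc : nrm (fun x => F (upt x y) - f x) * nrm (@basis_fun R k) +
    M * (4 * k%:R + 2) * nrm (@basis_fun R 0) * y @[y --> 0^'+] --> (0 : R).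
  rewrite -[X in _ --> X](addr0 0); apply: cvgD.
    by rewrite -[X in _ --> X](mul0r (nrm (@basis_fun R k))); apply: cvgM => //; exact: cvg_cst.
  rewrite -[X in _ --> X](mulr0 (M * (4 * k%:R + 2) * nrm (@basis_fun R 0))); apply: cvgM.
    exact: cvg_cst.
  exact: cvg_at_right_filter.
have : \forall y \near (0 : R)^'+, 0 < y /\ normc (0 : R[i]) < r.
  by near=> y; split; [near: y; exact: nbhs_right_gt|rewrite Normc.normc0].
have /cvgrPdist_lt /(_ r r0) ur := uc.
move=> pos; have [y [[y0 _]]] := filter_ex (filterI pos ur).
rewrite sub0r normrN => /(le_lt_trans (ler_norm _)); rewrite ltNge => /negP; apply.
exact: key.
Unshelve. all: by end_near. Qed.

Lemma L2plus_L2 (f : R -> R[i]) : L2plus f -> L2 f.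
Proof. by case. Qed.

Lemma L2plus_represents (f : R -> R[i]) : L2plus f -> represents f (fcoef f).
Proof.
move=> Hf; apply: represents_of_orthogonal; first exact: L2plus_L2.
by move=> k; exact: L2plus_orthogonal.
Qed.

(** The extension is the same combination of the [ebasis k]; it has one L_2 majorant for all heights
    and converges to its boundary values at rate O(y). *)
Lemma comb_L2plus (c : nat -> R[i]) n : L2plus (comb c 0 n).
Proof.
pose F w := \sum_(0 <= k < n) c k * ebasis k w.
have dF w : 0 < complex.Im w -> derivable F w 1.
  move=> w0; rewrite /F; elim: (n) => [|m IH].
    have -> : (fun w => \sum_(0 <= k < 0) c k * ebasis k w) = fun=> 0 :> R[i].
      by apply/funext => v; rewrite big_geq.
    exact: derivable_cst.
  have -> : (fun w => \sum_(0 <= k < m.+1) c k * ebasis k w) =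
     fun w => (\sum_(0 <= k < m) c k * ebasis k w) + c m * ebasis m w.
    by apply/funext => v; rewrite big_nat_recr.
  have dc : derivable (fun w : R[i] => c m) w 1 by exact: derivable_cst.
  have dm : derivable (fun v => c m * ebasis m v) w 1.
    by apply: (derivable_cmul dc); exact: derivable_ebasis.
  exact: (derivableD IH dm).
pose C := \sum_(0 <= k < n) normc (c k).
have C0 : 0 <= C by apply: sumr_ge0.
have FC x y : 0 <= y -> normc (F (upt x y)) <= normc (C%:C%C * basis_fun 0 x).
  move=> y0; rewrite Normc.normcM normc_real ger0_norm// /C mulr_suml.
  apply: (le_trans (normc_sum _ _ _)); apply: ler_sum => k _.
  by rewrite Normc.normcM ler_wpM2l// normc_ebasis_le.
have LC : L2 (fun x => C%:C%C * basis_fun 0 x) by apply: L2Z; exact: L2_basis_fun.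
have mF y : 0 < y -> cmeasurable (fun x => F (upt x y)) by move=> y0; exact: cmeasurable_upt.
have LF y : 0 < y -> L2 (fun x => F (upt x y)).
  by move=> y0; apply: (L2_le (mF y y0) LC) => x; apply: FC; exact: ltW.
have Lc := L2_comb c 0 n.
split => //; exists F; split => //.
  exists (nrm (fun x => C%:C%C * basis_fun 0 x)) => y y0.
  rewrite -/(upt _ _) (L2normE (LF y y0)) lee_fin.
  by apply: nrm_le => // [|x]; [exact: mF|apply: FC; exact: ltW].
apply/L2norm_cvg0.
  near=> y; apply: L2B => //; apply: LF; near: y; exact: nbhs_right_gt.
pose D := \sum_(0 <= k < n) normc (c k) * (4 * k%:R + 2).
have D0 : 0 <= D.
  by apply: sumr_ge0 => k _; rewrite mulr_ge0// addr_ge0// mulr_ge0.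
have key y : 0 < y -> nrm (fun x => F (upt x y) - comb c 0 n x) <= nrm (@basis_fun R 0) * D * y.
  move=> y0; have Dy0 : 0 <= D * y by rewrite mulr_ge0// ltW.
  have -> : nrm (@basis_fun R 0) * D * y = nrm (fun x => (D * y)%:C%C * basis_fun 0 x).
    by rewrite (nrmZ _ (L2_basis_fun 0)) normc_real ger0_norm// -mulrA mulrC.
  apply: nrm_le; [by apply: cmeasurableB; [exact: mF|exact: L2_cmeasurable]| |].
    by apply: L2Z; exact: L2_basis_fun.
  move=> x; rewrite Normc.normcM normc_real ger0_norm// /F /comb -sumrB /D !mulr_suml.
  apply: (le_trans (normc_sum _ _ _)); apply: ler_sum => k _.
  rewrite -mulrBr Normc.normcM -!mulrA ler_wpM2l// mulrA.
  by apply: ebasis_boundary; exact: ltW.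
have kc : nrm (@basis_fun R 0) * D * y @[y --> 0^'+] --> (0 : R).
  rewrite -[X in _ --> X](mulr0 (nrm (@basis_fun R 0) * D)); apply: cvgM.
    exact: cvg_cst.
  exact: cvg_at_right_filter.
apply: (squeeze_cvgr _ (cvg_cst 0) kc).
near=> y; have y0 : 0 < y by near: y; exact: nbhs_right_gt.
by rewrite nrm_ge0 key.
Unshelve. all: by end_near. Qed.
End HardySpace.

(** * Compactness of the Hankel operator *)

Section UniformContinuity.
Context {R : realType}.
Local Notation opc := (one_point_compactification R).

(** z extended by its limit -1 at infinity. Distances in the compactified line are measured by
    chords of the unit circle. *)
Definition chord (p : opc) : R[i] := if p is Some t then zmap t else -1.

Lemma chord_inj : injective chord.
Proof.
have n1 (t : R) : zmap t != -1.
  by rewrite -subr_eq0 opprK addrC zmap_basis0 -normc_eq0 gt_eqF// normc_gt0 basis_funE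
    /ebasis expr0 mul1r invr_eq0 den_neq0.
move=> [s|] [t|] //= h.
- have : 1 + zmap s = 1 + zmap t by rewrite h.
  rewrite !zmap_basis0 !basis_funE /ebasis !expr0 !mul1r => /invr_inj.
  by move/eqP; rewrite !den_upt eq_complex /= => /andP[_ /eqP/oppr_inj ->].
- by case/eqP: (n1 s).
- by case/eqP: (n1 t).
Qed.

Lemma normc_basis0_small (e : R) : 0 < e -> forall t : R, e^-1 < `|t| -> normc (basis_fun 0 t) < e.
Proof.
move=> e0 t et; rewrite basis_funE /ebasis expr0 mul1r Normc.normcV.
have t0 : 0 < `|t| by apply: lt_trans et; rewrite invr_gt0.
have h : `|t| <= normc (den (upt t 0)).
  by rewrite den_upt -normrN; exact: (normc_Im (Complex (2^-1 + 0) (- t))).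
by rewrite -[e]invrK ltf_pV2 ?posrE ?invr_gt0 ?(lt_le_trans et)// (lt_le_trans t0).
Qed.

Lemma normc_den0_ge (t : R) : 2^-1 <= normc (den (upt t 0)).
Proof. by have := normc_den_ge t (lexx 0); rewrite addr0. Qed.

Lemma zmap_lipschitz (s t : R) : normc (zmap s - zmap t) <= 4 * `|s - t|.
Proof.
have s0 := den_neq0 s (lexx 0); have t0 := den_neq0 t (lexx 0).
have -> : zmap s - zmap t = 'i%C * (s - t)%:C%C / (den (upt s 0) * den (upt t 0)).
  have -> : zmap s - zmap t = (den (upt s 0))^-1 - (den (upt t 0))^-1.
    by rewrite !zmapE /cayley; ring.
  have -> : 'i%C * (s - t)%:C%C = den (upt t 0) - den (upt s 0) :> R[i].
    by rewrite !den_upt; apply/eqP; rewrite eq_complex /=; apply/andP; split; apply/eqP; ring.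
  by field; rewrite s0 t0.
rewrite !Normc.normcM normc_i mul1r normc_real mulrC ler_wpM2r//.
rewrite Normc.normcV Normc.normcM -[leRHS]invrK lef_pV2 ?posrE ?invr_gt0 ?mulr_gt0 ?normc_gt0//.
rewrite (_ : 4^-1 = 2^-1 * 2^-1); last by field.
by rewrite ler_pM ?invr_ge0 ?normc_den0_ge.
Qed.

Lemma chord_continuous (p : opc) e : 0 < e -> \forall q \near p, normc (chord q - chord p) < e.
Proof.
move=> e0; case: p => [t|].
  change (\forall s \near t, normc (zmap s - zmap t) < e).
  exists (e / 4) => [|s] /=; first by rewrite divr_gt0.
  rewrite ltr_pdivlMr// distrC mulrC => st; exact: le_lt_trans (zmap_lipschitz s t) st.
(* Outside this compact set |z + 1| = |e_0| is at most 1 / |t|, hence below [e]. *)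
exists `[- e^-1, e^-1]%classic.
  by split; [exact: segment_compact|exact: interval_closed].
move=> q [[t tK <-]|->] /=; last by rewrite subrr Normc.normc0.
rewrite opprK addrC zmap_basis0; apply: normc_basis0_small => //.
rewrite ltNge; apply/negP => te; apply: tK.
by rewrite /= in_itv /=; move: te; rewrite ler_norml.
Qed.

Variable phi : opc -> R[i].
Hypothesis phi_cont : continuous phi.

Lemma cvg_dist (f : opc -> R[i]) (p : opc) : (forall e, 0 < e -> \forall q \near p, normc (f q - f p) < e) ->
  forall q, (forall e, 0 < e -> \forall q' \near q, normc (f q' - f q) < e) ->
  normc (f pq.1 - f pq.2) @[pq --> (p, q)] --> normc (f p - f q).
Proof.
move=> fp q fq; apply/(@cvgrPdist_lt _ _ _ (nbhs (p, q)) _) => e e0.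
have e2 : 0 < e / 2 by rewrite divr_gt0.
exists ([set p' | normc (f p' - f p) < e / 2], [set q' | normc (f q' - f q) < e / 2]).
  by split; [exact: fp|exact: fq].
move=> [p' q'] [/= hp hq]; rewrite distrC; apply: (le_lt_trans (normc_dist _ _)).
have -> : f p' - f q' - (f p - f q) = (f p' - f p) - (f q' - f q) by ring.
by rewrite (le_lt_trans (le_normcD _ _))// normcN [e]splitr ltrD.
Qed.

(** Pairs of points where [phi] differs by at least [e] form a compact set, on which the chord
    length attains a minimum; it is positive because [chord] is injective. *)
Lemma symb_unif_cont (e : R) : 0 < e -> exists2 eta, 0 < eta &
  forall s t, normc (zmap s - zmap t) < eta -> normc (symb phi s - symb phi t) < e.
Proof.
move=> e0; pose dphi (pq : opc * opc) := normc (phi pq.1 - phi pq.2).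
pose dc (pq : opc * opc) := normc (chord pq.1 - chord pq.2).
have phiN p d : 0 < d -> \forall q \near p, normc (phi q - phi p) < d.
  move=> d0; have := @phi_cont p; move=> /(@cvg_normcP _ _ (nbhs p) _).
  move=> /(@cvgrPdist_lt _ _ _ (nbhs p) _)/(_ d d0); apply: filterS => q.
  by rewrite sub0r normrN ger0_norm ?normc_ge0.
have cphi : continuous dphi.
  by move=> [p q]; apply: cvg_dist => d d0; exact: phiN.
have cdc : continuous dc.
  by move=> [p q]; apply: cvg_dist => d d0; exact: chord_continuous.
pose S := [set pq | e <= dphi pq].
have cS : closed S.
  have -> : S = dphi @^-1` [set x | e <= x] by [].
  by apply: preimage_closed; [move=> pq _; exact: cphi|exact: closed_ge].
have KS : compact S.
  apply: (subclosed_compact cS (B := [set: opc * opc])) => //.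
  rewrite -setXTT; apply: compact_setX; exact: one_point_compactification_compact.
have [S0|S0] := pselect (S !=set0); last first.
  exists 1 => // s t _; rewrite ltNge; apply/negP => h; apply: S0.
  by exists (Some s, Some t).
have [[p q] pqS pqmin] := compact_EVT_min S0 KS (continuous_subspaceT cdc).
exists (dc (p, q)).
  rewrite normc_gt0 subr_eq0; apply/eqP => /chord_inj /= E.
  by move: pqS; rewrite inE /S /= /dphi /= E subrr Normc.normc0 leNgt e0.
move=> s t; rewrite ltNge => st; rewrite ltNge; apply: contra st => st.
by apply: (pqmin (Some s, Some t)); rewrite inE.
Qed.
End UniformContinuity.

(** * An approximate identity on the circle *)

Section TrigonometricApproximation.
Context {R : realType}.
Local Notation mu := (@lebesgue_measure R).
Implicit Types s t : R.

(* |1 + zeta|^(2N) / 4^N with zeta = z(t) / z(s): up to normalization an approximate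
   identity on the circle, and a Laurent polynomial in z(t). *)
Definition chord_ker N s t : R := (normc (1 + zmap t * conjc (zmap s)) ^+ 2 / 4) ^+ N.

(** Parallelogram law for |zeta| = 1: |1 + zeta|^2 = 4 - |1 - zeta|^2. In this form the kernel
    visibly decays away from the diagonal. *)
Lemma chord_kerE N s t : chord_ker N s t = (1 - normc (zmap t - zmap s) ^+ 2 / 4) ^+ N.
Proof.
congr (_ ^+ N); have := normc_zmap s; have := normc_zmap t.
move=> /(congr1 (fun x => x ^+ 2)) + /(congr1 (fun x => x ^+ 2)).
rewrite !normc_sqrE !expr1n; case: (zmap s) => a b; case: (zmap t) => c d /=.
move=> h1 h2; have e1 : c ^+ 2 = 1 - d ^+ 2 by rewrite -h1 addrK.
have e2 : a ^+ 2 = 1 - b ^+ 2 by rewrite -h2 addrK.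
have -> : (1 + (c * a - d * - b)) ^+ 2 + (0 + (c * - b + d * a)) ^+ 2 =
  1 + 2 * (c * a + d * b) + (c ^+ 2 + d ^+ 2) * (a ^+ 2 + b ^+ 2) by ring.
have -> : (c - a) ^+ 2 + (d - b) ^+ 2 = (c ^+ 2 + d ^+ 2) + (a ^+ 2 + b ^+ 2) - 2 * (c * a + d * b) by ring.
by rewrite h1 h2; field.
Qed.

Lemma chord_ker_bounds N s t : 0 <= chord_ker N s t <= 1.
Proof.
rewrite exprn_ge0 ?divr_ge0 ?exprn_ge0 ?normc_ge0//= chord_kerE exprn_ile1//; last first.
  by rewrite gerBl divr_ge0// exprn_ge0 ?normc_ge0.
rewrite subr_ge0 ler_pdivrMr// mul1r (_ : 4 = 2 ^+ 2); last by rewrite expr2; ring.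
rewrite ler_pXn2r ?nnegrE ?normc_ge0// (le_trans (le_normcD _ _))// normcN !normc_zmap.
by rewrite (_ : 1 + 1 = 2)//; ring.
Qed.

(** For |zeta| = 1, |1 + zeta|^2 = (1 + zeta)^2 / zeta; the N-th power is then expanded by the
    binomial formula with exponent 2N. *)
Lemma chord_ker_expand N s t : (chord_ker N s t)%:C%C =
  \sum_(j < N.*2.+1) ('C(N.*2, j)%:R / 4 ^+ N)%:C%C * (zmap t ^+ j / zmap t ^+ N) *
    (zmap s ^+ N / zmap s ^+ j).
Proof.
have zs := zmap_neq0 s; have zt := zmap_neq0 t.
have four : (4 : R)%:C%C = 4 :> R[i] by rewrite rmorph_nat.
have E : (chord_ker 1 s t)%:C%C =
    (1 + zmap t / zmap s) ^+ 2 * (zmap s / zmap t) / 4.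
  have cz : conjc (zmap t / zmap s) = zmap s / zmap t.
    by rewrite -{1}conj_zmap (conjcM (zmap t)) conjcK (conj_zmap t) mulrC.
  rewrite /chord_ker expr1 conj_zmap rmorphM fmorphV /= four -mul_conjc (conjcD 1) cz.
  rewrite (_ : conjc 1 = 1 :> R[i]); last exact: conjc_real.
  by move: (zmap s) (zmap t) zs zt => a b a0 b0; field; rewrite a0 b0.
have -> : (chord_ker N s t)%:C%C = (1 + zmap t / zmap s) ^+ N.*2 *
    (zmap s ^+ N / zmap t ^+ N) / 4 ^+ N.
  rewrite -[chord_ker N s t]/((chord_ker 1 s t) ^+ N) rmorphXn /= E.
  by move: (zmap s) (zmap t) => a b; rewrite -addnn exprD !exprMn !exprVn.
rewrite addrC exprD1n !mulr_suml; apply: eq_bigr => j _.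
rewrite rmorphM fmorphV /= rmorphXn /= four rmorph_nat -mulr_natl.
move: (zmap s) (zmap t) zs zt => a b a0 b0; rewrite exprMn exprVn.
have q0 : 4 ^+ N != 0 :> R[i] by rewrite expf_neq0// pnatr_eq0.
move: (expf_neq0 N b0) (expf_neq0 j a0) q0.
move: (a ^+ N) (b ^+ N) (a ^+ j) (b ^+ j) (4 ^+ N : R[i]) => a1 b1 a2 b2 q b10 a20 q0.
by field; rewrite b10 a20 q0.
Qed.

Lemma cintegral_zmap_ratio N j : cintegrable (fun s => zmap s ^+ N / zmap s ^+ j * (qker s)%:C%C) /\ cintegral (fun s => zmap s ^+ N / zmap s ^+ j * (qker s)%:C%C) = (2 * pi * (N == j)%:R)%:C%C.
Proof.
have [jN|/ltnW Nj] := leqP j N.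
  have e s : zmap s ^+ N / zmap s ^+ j = zmap s ^+ (N - j).
    by rewrite -{1}(subnK jN) exprD mulfK// expf_neq0// zmap_neq0.
  under [X in cintegrable X]eq_fun do rewrite e.
  under eq_cintegral do rewrite e.
  by split; [exact: cintegrable_zmapX|rewrite cintegral_zmapX subn_eq0 eqn_leq jN andbT].
have e s : zmap s ^+ N / zmap s ^+ j * (qker s)%:C%C = conjc (zmap s ^+ (j - N) * (qker s)%:C%C).
  rewrite conjcM conjcX conj_zmap -{1}(subnK Nj) exprD invfM mulrCA divff ?expf_neq0 ?zmap_neq0//.
  by rewrite mulr1 exprVn conjc_real.
under [X in cintegrable X]eq_fun do rewrite e.
under eq_cintegral do rewrite e.
split; first by apply: cintegrable_conj; exact: cintegrable_zmapX.
rewrite cintegral_conj ?cintegral_zmapX ?conjc_real ?subn_eq0; last exact: cintegrable_zmapX.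
by rewrite [N == j]eq_sym [j == N]eqn_leq Nj andbT.
Qed.

(** The constant term (j = N) of [chord_ker_expand], that is, the mean of the kernel over the
    circle. *)
Definition central (N : nat) : R := 'C(N.*2, N)%:R / 4 ^+ N.

(** Follows from central(N + 1) = central(N) (2N + 1) / (2N + 2). A polynomial lower bound suffices,
    since it competes with geometric decay off the diagonal. *)
Lemma central_ge N : (N.*2.+1%:R)^-1 <= central N.
Proof.
elim: N => [|N IH]; first by rewrite /central bin0 expr0 divr1 invr1.
have e : central N.+1 = central N * (N.*2.+1%:R / N.*2.+2%:R).
  have h1 := mul_bin_diag N.*2.+2 N; have h2 := mul_bin_down N.*2.+1 N.
  have h3 : ('C(N.*2.+2, N.+1) * (N.+1 * N.+1) = N.*2.+2 * (N.*2.+1 * 'C(N.*2, N)))%N.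
    move: h1 h2; rewrite /= (_ : N.*2.+1 - N = N.+1)%N; last by rewrite -addnn subSn ?leq_addr// addnK.
    by move=> h1 ->; rewrite [RHS]mulnCA h1; ring.
  have {}h3 := congr1 (fun n => n%:R : R) h3.
  rewrite /= !natrM in h3.
  have n0 : (N.+1%:R : R) != 0 by rewrite pnatr_eq0.
  have e2 : N.*2.+2%:R = 2 * N.+1%:R :> R by rewrite -natrM mul2n doubleS.
  have e4 : (4 ^+ N : R) != 0 by rewrite expf_neq0.
  rewrite /central doubleS exprS.
  have -> : 'C(N.*2.+2, N.+1)%:R = N.*2.+2%:R * (N.*2.+1%:R * 'C(N.*2, N)%:R) / (N.+1%:R * N.+1%:R) :> R.
    by rewrite -h3 mulfK// mulf_neq0.
  rewrite e2; move: (4 ^+ N : R) (N.+1%:R : R) (N.*2.+1%:R : R) ('C(N.*2, N)%:R : R) e4 n0.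
  by move=> a b c d a0 b0; field; rewrite a0 b0.
have p n : 0 < n.+1%:R :> R by rewrite ltr0n.
rewrite e doubleS; apply: (@le_trans _ _ ((N.*2.+1%:R)^-1 * (N.*2.+1%:R / N.*2.+2%:R))).
  by rewrite mulrA mulVf ?gt_eqF// mul1r lef_pV2 ?posrE// ler_nat.
by rewrite ler_wpM2r// divr_ge0 ?ltW.
Qed.

Lemma rintegral_chord_ker N t : rintegrable (fun s => chord_ker N s t * qker s) /\ \int[mu]_(s in [set: R]) (chord_ker N s t * qker s) = 2 * pi * central N.
Proof.
have F (j : 'I_(N.*2.+1)) : cintegrable (fun s => ('C(N.*2, j)%:R / 4 ^+ N)%:C%C *
    (zmap t ^+ j / zmap t ^+ N) * (zmap s ^+ N / zmap s ^+ j * (qker s)%:C%C)).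
  by apply: cintegrableZ; case: (cintegral_zmap_ratio N j).
have E s : (chord_ker N s t * qker s)%:C%C = \sum_(j < N.*2.+1) ('C(N.*2, j)%:R / 4 ^+ N)%:C%C *
    (zmap t ^+ j / zmap t ^+ N) * (zmap s ^+ N / zmap s ^+ j * (qker s)%:C%C).
  by rewrite rmorphM /= chord_ker_expand mulr_suml; apply: eq_bigr => j _; rewrite !mulrA.
have ci : cintegrable (fun s => (chord_ker N s t * qker s)%:C%C).
  by under eq_fun do rewrite E; exact: cintegrable_sum.
split; first by case: ci.
have : cintegral (fun s => (chord_ker N s t * qker s)%:C%C) = (2 * pi * central N)%:C%C.
  under eq_cintegral do rewrite E.
  have NN : (N < N.*2.+1)%N by rewrite ltnS -addnn leq_addr.
  rewrite cintegral_sum// (bigD1 (Ordinal NN)) //= big1 ?addr0 => [|j jN].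
    rewrite cintegralZ; last by case: (cintegral_zmap_ratio N N).
    rewrite (cintegral_zmap_ratio N N).2 eqxx mulr1 divff ?expf_neq0 ?zmap_neq0// mulr1.
    by rewrite mulrC -rmorphM.
  rewrite cintegralZ; last by case: (cintegral_zmap_ratio N j).
  rewrite (cintegral_zmap_ratio N j).2 eq_sym (_ : _ == _ = false) ?mulr0 ?mulr0//.
  by apply/negbTE; apply: contra jN => /eqP jN; apply/eqP/val_inj.
by rewrite /cintegral /= => -[].
Qed.
End TrigonometricApproximation.

(** * Laurent approximation of the symbol and tails of the Hankel operator *)

Section TailEstimate.
Context {R : realType}.
Local Notation mu := (@lebesgue_measure R).

(** With q = sqrt(rho), rho^N = q^N q^N: one factor keeps N q^N below 1 / (1 - q), and the other
    tends to 0. *)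
Lemma linear_geometric_small (rho C e : R) : 0 <= rho < 1 -> 0 <= C -> 0 < e ->
  exists N : nat, C * (rho ^+ N * N.*2.+1%:R) <= e.
Proof.
move=> /andP[rho0 rho1] C0 e0; pose q := Num.sqrt rho.
have q0 : 0 <= q := sqrtr_ge0 _.
have q1 : q < 1 by rewrite -sqrtr1 ltr_sqrt.
have qn n : q ^+ n <= 1 by rewrite exprn_ile1// ltW.
have key n : n%:R * q ^+ n * (1 - q) <= 1 - q ^+ n.
  elim: n => [|n IH]; first by rewrite expr0 !mul0r subrr.
  have := ler_wpM2l q0 IH; have := qn n.+1; have : 0 <= 1 - q by rewrite subr_ge0 ltW.
  move=> h1 h2 h3; have := ler_wpM2r h1 h2; move: h3; rewrite exprS -natr1.
  move: (n%:R : R) (q ^+ n) => a b; lra.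
pose D := C * (2 / (1 - q) + 1) + 1.
have p1 : 0 < 1 - q by rewrite subr_gt0.
have D0 : 0 < D by rewrite ltr_wpDl// mulr_ge0// addr_ge0// divr_ge0// ltW.
have [N HN] : exists N, q ^+ N < e / D.
  have c : q ^+ n @[n --> \oo] --> (0 : R) by apply: cvg_expr; rewrite ger0_norm.
  have [N /(_ N (leqnn N)) H] := (cvg0_seqP (fun n => exprn_ge0 n q0)).1 c (e / D) (divr_gt0 e0 D0).
  by exists N.
exists N.
have -> : rho ^+ N = q ^+ N * q ^+ N by rewrite -exprMn -expr2 sqr_sqrtr.
have -> : N.*2.+1%:R = 2 * N%:R + 1 :> R by rewrite -addn1 natrD -mul2n natrM.
have k1 : N%:R * q ^+ N <= (1 - q)^-1.
  by rewrite -[leRHS]mul1r ler_pdivlMr//; apply: (le_trans (key N)); rewrite gerBl exprn_ge0.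
apply: (@le_trans _ _ (D * q ^+ N)); last by rewrite mulrC -ler_pdivlMr// ltW.
have qN0 : 0 <= q ^+ N by rewrite exprn_ge0.
have -> : C * (q ^+ N * q ^+ N * (2 * N%:R + 1)) = C * (2 * (N%:R * q ^+ N) + q ^+ N) * q ^+ N by ring.
apply: ler_wpM2r => //; rewrite /D (@le_trans _ _ (C * (2 / (1 - q) + 1)))// ?lerDl//.
by rewrite ler_wpM2l// lerD// ler_wpM2l.
Qed.

Variable phi : one_point_compactification R -> R[i].
Hypothesis phi_cont : continuous phi.
Local Notation symb := (symb phi).

(** The approximant is the convolution of the symbol with the normalized [chord_ker N], and
    [chord_ker_expand] shows it to be a Laurent polynomial in z(t). Close to the diagonal the error
    is governed by uniform continuity, elsewhere by 2 B rho^N / central(N) <= 2 B rho^N (2N + 1). *)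
Lemma symb_approx (e : R) : 0 < e -> exists N (b : nat -> R[i]), forall t,
  normc (symb t - \sum_(j < N.*2.+1) b j * (zmap t ^+ j / zmap t ^+ N)) <= e.
Proof.
move=> e0; have e2 : 0 < e / 2 by rewrite divr_gt0.
have [eta0 eta00 Heta0] := symb_unif_cont phi_cont e2.
(* The cap at 1 keeps rho = 1 - eta^2 / 4 in [0, 1[. *)
pose eta := Num.min eta0 1.
have eta_gt0 : 0 < eta by rewrite lt_min eta00 ltr01.
have eta1 : eta <= 1 by rewrite ge_min lexx orbT.
have Heta s t : normc (zmap s - zmap t) < eta -> normc (symb s - symb t) < e / 2.
  by rewrite lt_min => /andP[h _]; exact: Heta0.
have [B B0 HB] := symb_bounded phi_cont.
pose rho := 1 - eta ^+ 2 / 4.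
have eta2 : eta ^+ 2 <= 1 by rewrite exprn_ile1// ltW.
have eta20 : 0 < eta ^+ 2 by rewrite exprn_gt0.
have rho01 : 0 <= rho < 1 by apply/andP; rewrite /rho; split; lra.
have [N HN] := linear_geometric_small rho01 (mulr_ge0 (ler0n _ 2) B0) e2.
have p0 := @twopi_gt0 R; have c1 := @central_ge R N.
have c0 : 0 < @central R N by apply: lt_le_trans c1; rewrite invr_gt0 ltr0n.
set W : R := 2 * pi * central N; have W0 : 0 < W by rewrite mulr_gt0.
have WC : W%:C%C != 0 :> R[i] by rewrite -normc_eq0 normc_real gt_eqF// ger0_norm// ltW.
pose b j := W%:C%C^-1 * (('C(N.*2, j)%:R / 4 ^+ N)%:C%C *
  cintegral (fun s => symb s * (zmap s ^+ N / zmap s ^+ j * (qker s)%:C%C))).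
exists N, b => t.
have mS := cmeasurable_symb phi_cont.
have iS j : cintegrable (fun s => symb s * (zmap s ^+ N / zmap s ^+ j * (qker s)%:C%C)).
  have [ci _] := @cintegral_zmap_ratio R N j.
  apply: (cintegrable_le (h := fun s => B * qker s)).
  - by apply: cmeasurableM => //; exact: cintegrable_measurable.
  - move=> s; rewrite (Normc.normcM (symb s)) (Normc.normcM (_ / _)) normc_real.
    rewrite (Normc.normcM (zmap s ^+ N)) Normc.normcV !normc_zmapX invr1 !mul1r.
    by rewrite ger0_norm ?qker_ge0// ler_wpM2r ?qker_ge0.
  - by apply: rintegrableZ; case: (@rintegrable_qker R).
have [ik Ik] := rintegral_chord_ker N t; have [iq Iq] := @rintegrable_qker R.
have ikC : cintegrable (fun s => (chord_ker N s t * qker s)%:C%C).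
  by split => //=; exact: integrable0.
have IkC : cintegral (fun s => (chord_ker N s t * qker s)%:C%C) = W%:C%C.
  by rewrite /cintegral /= Ik; congr Complex; rewrite /Rintegral integral0.
have expand s : symb s * (chord_ker N s t * qker s)%:C%C = \sum_(j < N.*2.+1)
    (('C(N.*2, j)%:R / 4 ^+ N)%:C%C * (zmap t ^+ j / zmap t ^+ N)) *
    (symb s * (zmap s ^+ N / zmap s ^+ j * (qker s)%:C%C)).
  rewrite rmorphM /= chord_ker_expand mulr_suml mulr_sumr; apply: eq_bigr => j _.
  by move: (zmap t ^+ j / _) (zmap s ^+ N / _) (_ / 4 ^+ N)%:C%C => ? ? ?; ring.
have isk : cintegrable (fun s => symb s * (chord_ker N s t * qker s)%:C%C).
  by under eq_fun do rewrite expand; apply: cintegrable_sum => j; exact: cintegrableZ.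
have -> : \sum_(j < N.*2.+1) b j * (zmap t ^+ j / zmap t ^+ N) =
    W%:C%C^-1 * cintegral (fun s => symb s * (chord_ker N s t * qker s)%:C%C).
  under [in RHS]eq_cintegral do rewrite expand.
  rewrite cintegral_sum; last by move=> j; exact: cintegrableZ.
  rewrite mulr_sumr; apply: eq_bigr => j _; rewrite cintegralZ// /b.
  by move: (zmap t ^+ j / _) (cintegral _) (_ / 4 ^+ N)%:C%C => ? ? ?; ring.
have -> : symb t = W%:C%C^-1 * cintegral (fun s => symb t * (chord_ker N s t * qker s)%:C%C).
  by rewrite cintegralZ// IkC mulrCA mulVf// mulr1.
rewrite -mulrBr -cintegralB//; last exact: cintegrableZ.
have di := cintegrableB (cintegrableZ (symb t) ikC) isk.
rewrite Normc.normcM Normc.normcV normc_real (ger0_norm (ltW W0)) ler_pdivrMl//.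
apply: (le_trans (normc_cintegral di)).
apply: (@le_trans _ _ (\int[mu]_(s in [set: R])
    (e / 2 * (chord_ker N s t * qker s) + 2 * B * rho ^+ N * qker s))).
  apply: le_Rintegral => //; first exact: cintegrable_normc.
    by apply: rintegrableD; exact: rintegrableZ.
  move=> s _; rewrite -mulrBl Normc.normcM normc_real.
  have q0 := qker_ge0 s; have /andP[k0 k1] := chord_ker_bounds N s t.
  rewrite ger0_norm ?mulr_ge0// !mulrA -mulrDl ler_wpM2r//.
  have [st|st] := ltP (normc (zmap t - zmap s)) eta.
    rewrite -[leLHS]addr0 lerD//; last by rewrite !mulr_ge0// exprn_ge0//; case/andP: rho01.
    by rewrite ler_wpM2r// ltW// Heta.
  rewrite -[leLHS]add0r lerD//; first by rewrite mulr_ge0// ltW.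
  apply: ler_pM => //; first exact: normc_ge0.
    by rewrite (le_trans (le_normcD _ _))// normcN (_ : 2 * B = B + B) ?lerD//; ring.
  rewrite chord_kerE lerXn2r ?nnegrE//.
  - rewrite subr_ge0 ler_pdivrMr// mul1r (_ : 4 = 2 ^+ 2); last by rewrite expr2; ring.
    rewrite ler_pXn2r ?nnegrE ?normc_ge0// (le_trans (le_normcD _ _))// normcN !normc_zmap.
    by rewrite (_ : 1 + 1 = 2)//; ring.
  - by case/andP: rho01.
  rewrite /rho lerD2l lerN2 ler_pM2r ?invr_gt0//.
  by apply: lerXn2r => //; rewrite nnegrE ?normc_ge0// ltW.
have ri1 : rintegrable (fun s => e / 2 * (chord_ker N s t * qker s)) by exact: rintegrableZ.
have ri2 : rintegrable (fun s => 2 * B * rho ^+ N * qker s) by exact: rintegrableZ.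
rewrite RintegralD// !RintegralZl// Ik Iq -/W.
rewrite (_ : W * e = e / 2 * W + e / 2 * W); last by field.
rewrite lerD2l (_ : e / 2 * W = e / 2 * central N * (2 * pi)); last by rewrite /W mulrA mulrAC mulrA.
rewrite ler_wpM2r ?(ltW p0)//.
rewrite -ler_pdivrMr//; apply: le_trans HN; rewrite -!mulrA ler_wpM2l// ler_wpM2l//.
rewrite ler_wpM2l ?exprn_ge0//; first by case/andP: rho01.
by rewrite -[leRHS]invrK lef_pV2 ?posrE ?invr_gt0 ?ltr0n.
Qed.

(* If [psi = \sum_j b_j z^(j - N)], then [z^(j - N) e_k = e_(k + j - N)] for [k >= N] and so
   [H(psi) u] has no coefficient beyond [N] for [u] in L_2^+. *)
Lemma hankel_coef_tail (e : R) : 0 < e -> exists N, forall u, L2plus u -> forall n m, (N <= n)%N ->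
  nrm (comb (hcoef (fun t => symb t * u t)) n m) <= e * nrm u.
Proof.
move=> e0; have [N [b Hb]] := symb_approx e0; exists N => u Hu n m Nn.
have Lu := L2plus_L2 Hu.
pose psi t := \sum_(j < N.*2.+1) b j * (zmap t ^+ j / zmap t ^+ N).
have mS := cmeasurable_symb phi_cont.
have mpsi : cmeasurable psi.
  apply: cmeasurable_sum => j; apply: cmeasurableZ; apply: cmeasurableM.
    exact: cmeasurable_zmapX.
  by apply: cmeasurableV; exact: cmeasurable_zmapX.
have Lsu := L2_symb phi_cont Lu.
have md : cmeasurable (fun t => symb t - psi t) by exact: cmeasurableB.
have Ld : L2 (fun t => (symb t - psi t) * u t) := L2_bounded md Hb Lu.
have nd : nrm (fun t => (symb t - psi t) * u t) <= e * nrm u := nrm_bounded md Hb Lu.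
have E k : (N <= k)%N -> hcoef (fun t => symb t * u t) k = hcoef (fun t => (symb t - psi t) * u t) k.
  move=> Nk; rewrite /hcoef; congr (_ * _); apply/eqP; rewrite -subr_eq0.
  have i1 := L2_mul_cintegrable Lsu (L2_basis_fun k).
  have i2 := L2_mul_cintegrable Ld (L2_basis_fun k).
  have i3 (j : nat) : cintegrable (fun t => u t * basis_fun (k - N + j) t).
    exact: (L2_mul_cintegrable Lu (L2_basis_fun _)).
  rewrite -cintegralB//; apply/eqP.
  transitivity (cintegral (fun t => \sum_(j < N.*2.+1) b j * (u t * basis_fun (k - N + j) t))).
    apply: eq_cintegral => t; rewrite -mulrBl -mulrBl opprB addrC subrK /psi !mulr_suml.
    apply: eq_bigr => j _.
    have zt := expf_neq0 N (zmap_neq0 t).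
    have -> : basis_fun (k - N + j) t = zmap t ^+ j / zmap t ^+ N * basis_fun k t.
      rewrite /basis_fun -{2}(subnK Nk) !exprD.
      move: ((2^-1 -i* t)%C^-1 : R[i]) (zmap t ^+ j) (zmap t ^+ (k - N)) (zmap t ^+ N) zt.
      by move=> d a c q q0; field.
    by move: (basis_fun k t) (_ / _) => *; ring.
  rewrite cintegral_sum; last by move=> j; exact: cintegrableZ.
  by rewrite big1// => j _; rewrite cintegralZ// L2plus_orthogonal// mulr0.
rewrite -(ler_pXn2r (n := 2)) ?nnegrE ?mulr_ge0 ?nrm_ge0 ?(ltW e0)// sqr_nrm sqint_comb.
apply: (@le_trans _ _ (sqint (fun t => (symb t - psi t) * u t))); last first.
  by rewrite -sqr_nrm ler_pXn2r ?nnegrE ?mulr_ge0 ?nrm_ge0 ?(ltW e0).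
rewrite -ler_pdivlMl ?twopi_gt0//; apply: le_trans (hcoef_bessel m Ld).
have [nm|mn] := leqP n m; last first.
  by rewrite (big_geq (ltnW mn)); apply: sumr_ge0 => k _; exact: sqr_ge0.
rewrite [leRHS](big_cat_nat (leq0n n) nm) /= -[leLHS]add0r lerD//.
  by apply: sumr_ge0 => k _; exact: sqr_ge0.
rewrite !big_nat; apply: ler_sum => k /andP[nk _].
by rewrite E// (leq_trans Nn).
Qed.
End TailEstimate.

(** * The finite section method *)

Section FiniteSection.
Context {R : realType}.
Implicit Types (c : nat -> R[i]) (u y f g : R -> R[i]).

Lemma eq_comb c c' n m : (forall k, (n <= k < m)%N -> c k = c' k) -> comb c n m = comb c' n m.
Proof.
by move=> cc; apply/funext => x; apply: eq_big_nat => k knm; rewrite cc.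
Qed.

Lemma combB c c' n m x : comb (fun k => c k - c' k) n m x = comb c n m x - comb c' n m x.
Proof. by rewrite /comb -sumrB; apply: eq_bigr => k _; rewrite mulrBl. Qed.

Lemma section_projE n f : section_proj n f = comb (coeffs f) 0 n.
Proof. by apply/funext => x; rewrite /section_proj /comb big_mkord. Qed.

Lemma L2plus_coeffs f : L2plus f -> coeffs f = fcoef f.
Proof. by move=> Hf; apply: coeffsE; [exact: L2plus_L2|exact: L2plus_represents]. Qed.

Lemma fcoef_comb c n k : fcoef (comb c 0 n) k = if (k < n)%N then c k else 0.
Proof. by rewrite -(represents_fcoef (L2_comb c 0 n) (represents_comb c n)). Qed.

Lemma section_proj_comb c n : section_proj n (comb c 0 n) = comb c 0 n.
Proof.
rewrite section_projE (L2plus_coeffs (comb_L2plus c n)); apply: eq_comb => k /andP[_ kn].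
by rewrite fcoef_comb kn.
Qed.

Lemma hcoefD g g' (k : nat) : L2 g -> L2 g' -> hcoef (fun x => g x + g' x) k = hcoef g k + hcoef g' k.
Proof.
move=> Lg Lg'; rewrite /hcoef -mulrDr; congr (_ * _).
under eq_cintegral do rewrite mulrDl.
by rewrite cintegralD//; apply: L2_mul_cintegrable => //; exact: L2_basis_fun.
Qed.

Lemma hcoefZ (a : R[i]) g k : L2 g -> hcoef (fun x => a * g x) k = a * hcoef g k.
Proof.
move=> Lg; rewrite /hcoef [RHS]mulrCA; congr (_ * _).
under eq_cintegral do rewrite -mulrA.
by rewrite cintegralZ//; apply: L2_mul_cintegrable => //; exact: L2_basis_fun.
Qed.

Variable phi : one_point_compactification R -> R[i].
Hypothesis phi_cont : continuous phi.
Local Notation symb := (symb phi).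
Local Notation A := (id_plus_hankel phi).

Definition hankel_coef u k : R[i] := hcoef (fun t => symb t * u t) k.

Lemma hankel_coefB u u' k : L2 u -> L2 u' ->
  hankel_coef (fun x => u x - u' x) k = hankel_coef u k - hankel_coef u' k.
Proof.
move=> Lu Lu'; have Ls := L2_symb phi_cont Lu; have Ls' := L2_symb phi_cont Lu'.
rewrite /hankel_coef -[X in _ = _ + X]mulN1r -hcoefZ// -hcoefD//; last exact: L2Z.
by congr (hcoef _ k); apply/funext => x; rewrite mulrBr mulN1r.
Qed.

Lemma hankel_coef_comb c n k :
  hankel_coef (comb c 0 n) k = \sum_(0 <= j < n) c j * hankel_coef (@basis_fun R j) k.
Proof.
have Ls j := L2_symb phi_cont (@L2_basis_fun R j).
elim: n => [|n IH].
  rewrite big_geq// /hankel_coef /hcoef (_ : (fun t => _) = fun=> 0).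
    by rewrite cintegral0 mulr0.
  by apply/funext => x; rewrite /comb big_geq// mulr0 mul0r.
rewrite big_nat_recr//= -IH /hankel_coef -hcoefZ// -hcoefD; first last.
- exact: L2Z.
- by apply: (L2_symb phi_cont); exact: L2_comb.
by congr (hcoef _ k); apply/funext => x; rewrite comb_recr mulrDr [in LHS](mulrCA (symb x)).
Qed.

Hypothesis A_stable : forall u, L2plus u -> L2plus (A u).

Lemma represents_Au u : L2plus u -> represents (A u) (fun k => fcoef u k + hankel_coef u k).
Proof.
move=> Hu; have Lu := L2plus_L2 Hu; have LA := L2plus_L2 (A_stable Hu).
have [h Lh [hr hh]] := hankel_ae phi_cont Lu.
apply: (ae_represents _ _ _ (representsD Lu Lh (L2plus_represents Hu) hr)).
- exact: L2_cmeasurable.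
- by apply: cmeasurableD; exact: L2_cmeasurable.
- by apply: aeS hh => x hx; rewrite /id_plus_hankel hx.
Qed.

Lemma coeffs_A u : L2plus u -> coeffs (A u) = fun k => fcoef u k + hankel_coef u k.
Proof. by move=> Hu; apply: coeffsE; [exact/L2plus_L2/A_stable|exact: represents_Au]. Qed.

(* The first [n] coefficients of [(I + H)(\sum_(k < n) c_k e_k)]. *)
Definition trunc n c k : R[i] := c k + hankel_coef (comb c 0 n) k.

Lemma truncB n c c' k : trunc n (fun k => c k - c' k) k = trunc n c k - trunc n c' k.
Proof.
rewrite /trunc (_ : comb _ 0 n = fun x => comb c 0 n x - comb c' 0 n x); last first.
  by apply/funext => x; rewrite combB.
by rewrite (hankel_coefB k (L2_comb c 0 n) (L2_comb c' 0 n)) opprD addrACA.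
Qed.

Lemma section_proj_A n c : section_proj n (A (comb c 0 n)) = comb (trunc n c) 0 n.
Proof.
rewrite section_projE (coeffs_A (comb_L2plus c n)); apply: eq_comb => k /andP[_ kn].
by rewrite fcoef_comb kn.
Qed.

Variables (M : R) (M1 : 1 <= M).
Hypothesis A_below : forall u, L2plus u -> nrm u <= M * nrm (A u).

(** Since (I - P_n) A u has norm at most |u| / (2 M), |u| <= M |A u| <= |u| / 2 + M |P_n A u|, and
    the first term is absorbed on the left. *)
Lemma trunc_below : exists N, forall n c, (N <= n)%N ->
  nrm (comb c 0 n) <= 2 * M * nrm (comb (trunc n c) 0 n).
Proof.
have M0 : 0 < M by exact: lt_le_trans M1.
pose d := (2 * M)^-1; have d0 : 0 < d by rewrite invr_gt0 mulr_gt0.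
have [N HN] := hankel_coef_tail phi_cont d0; exists N => n c Nn.
set u := comb c 0 n; have Hu : L2plus u := comb_L2plus c n.
have Lu := L2plus_L2 Hu; have LA := L2plus_L2 (A_stable Hu).
(* A u is replaced by a long partial sum m >= n up to any error. Beyond index n the coefficients of
   [u] vanish, so the difference of partial sums involves only Hankel coefficients and
   [hankel_coef_tail] applies. *)
have tail : nrm (fun x => A u x - comb (trunc n c) 0 n x) <= d * nrm u.
  apply/ler_addgt0Pl => e e0.
  have [K HK] := (cvg0_seqP (fun n => nrm_ge0 _)).1 (represents_Au Hu) e e0.
  set m := (n + K)%N; have nm : (n <= m)%N := leq_addr _ _.
  have Lm := L2_comb (fun k => fcoef u k + hankel_coef u k) 0 m.
  apply: (le_trans (nrm_triangle LA Lm (L2_comb _ _ _))).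
  rewrite lerD//; first exact/ltW/HK/leq_addl.
  rewrite (_ : (fun x => _) = comb (hankel_coef u) n m); first exact: HN.
  apply/funext => x.
  rewrite (_ : comb (trunc n c) 0 n = comb (fun k => fcoef u k + hankel_coef u k) 0 n); last first.
    by apply: eq_comb => k /andP[_ kn]; rewrite fcoef_comb kn.
  rewrite comb_cat//; apply: eq_big_nat => k /andP[nk _].
  by rewrite fcoef_comb ltnNge nk add0r.
have h1 := A_below Hu.
have h2 := nrmD (L2B LA (L2_comb (trunc n c) 0 n)) (L2_comb (trunc n c) 0 n).
have {}h2 : nrm (A u) <= nrm (fun x => A u x - comb (trunc n c) 0 n x) + nrm (comb (trunc n c) 0 n).
  by apply: le_trans h2; under [X in _ <= nrm X]eq_fun do rewrite subrK.
have h3 := le_trans h2 (lerD tail (lexx _)).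
have := le_trans h1 (ler_wpM2l (ltW M0) h3).
rewrite mulrDr mulrA (_ : M * d = 2^-1); last by rewrite /d; field; rewrite gt_eqF.
set b := nrm (comb _ 0 n) => h; rewrite -mulrA; move: (M * b) (nrm u) h => ? ?; lra.
Qed.

(** Row k is the image of e_k: coefficient sequences act as row vectors, multiplied from the
    left. *)
Definition section_mx n : 'M[R[i]]_n :=
  \matrix_(k, m) ((k == m)%:R + hankel_coef (@basis_fun R k) m).

Lemma trunc_mx n c (m : 'I_n) : trunc n c m = \sum_(k < n) c k * section_mx n k m.
Proof.
rewrite /trunc hankel_coef_comb big_mkord.
under [RHS]eq_bigr do rewrite mxE mulrDr.
rewrite big_split /=; congr (_ + _).
rewrite (bigD1 m)//= eqxx mulr1 big1 ?addr0// => k km.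
by rewrite (negPf km) mulr0.
Qed.

Lemma nrm_comb_eq0 c n : nrm (comb c 0 n) = 0 -> forall k, (k < n)%N -> c k = 0.
Proof.
move=> n0 k kn; have := sqint_comb c 0 n; rewrite -sqr_nrm n0 expr0n /= => /esym/eqP.
rewrite mulf_eq0 gt_eqF ?twopi_gt0//= big_mkord psumr_eq0 => [/allP|j _]; last exact: sqr_ge0.
move=> /(_ (Ordinal kn)); rewrite mem_index_enum /= => /(_ isT).
by rewrite sqrf_eq0 normc_eq0 => /eqP.
Qed.

Lemma section_solvable n (d : nat -> R[i]) :
  (forall c, nrm (comb c 0 n) <= 2 * M * nrm (comb (trunc n c) 0 n)) ->
  exists c, comb (trunc n c) 0 n = comb d 0 n.
Proof.
move=> below.
have row_sum (v : 'rV[R[i]]_n) c : (forall k : 'I_n, c k = v 0 k) ->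
    forall m : 'I_n, trunc n c m = (v *m section_mx n) 0 m.
  by move=> cv m; rewrite trunc_mx mxE; apply: eq_bigr => k _; rewrite cv.
(* Coefficient sequences are infinite, so a row vector is padded with zeros. *)
pose ext (v : 'rV[R[i]]_n) k : R[i] := if insub k is Some i then v 0 i else 0.
have extE v (k : 'I_n) : ext v k = v 0 k by rewrite /ext valK.
have free : row_free (section_mx n).
  apply: inj_row_free => v v0.
  have := below (ext v); rewrite (_ : comb (trunc n (ext v)) 0 n = fun=> 0); last first.
    apply/funext => x; rewrite /comb big_mkord big1// => m _.
    by rewrite (row_sum v)// v0 mxE mul0r.
  rewrite nrm0 mulr0 => h.
  have {}h : nrm (comb (ext v) 0 n) = 0 by apply/eqP; rewrite eq_le h nrm_ge0.
  by apply/rowP => k; rewrite mxE -extE (nrm_comb_eq0 h).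
have un : section_mx n \in unitmx by rewrite -row_free_unit.
pose w : 'rV[R[i]]_n := \row_k d k.
exists (ext (w *m invmx (section_mx n))).
apply/funext => x; rewrite /comb !big_mkord; apply: eq_bigr => m _.
by rewrite (row_sum (w *m invmx (section_mx n)))// mulmxKV// mxE.
Qed.

Lemma section_range n : (@section_proj R n @` (@L2plus R)) = [set comb c 0 n | c in [set: nat -> R[i]]].
Proof.
apply/seteqP; split => [_ [f _ <-]|_ [c _ <-]]; first by exists (coeffs f); rewrite ?section_projE.
by exists (comb c 0 n); [exact: comb_L2plus|exact: section_proj_comb].
Qed.

Lemma section_proj_truncE n c :
  (@section_proj R n \o A \o @section_proj R n) (comb c 0 n) = comb (trunc n c) 0 n.
Proof. by rewrite /= section_proj_comb section_proj_A. Qed.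

Lemma L2norm_comb_le c c' n m (K : R) : nrm (comb c 0 n) <= K * nrm (comb c' 0 m) ->
  (L2norm (comb c 0 n) <= K%:E * L2norm (comb c' 0 m))%E.
Proof. by move=> h; rewrite !L2normE ?lee_fin//; exact: L2_comb. Qed.

(** By Bessel's inequality P_n H(phi) u is no larger than phi u, uniformly in [n]. *)
Lemma nrm_hankel_comb u n (B : R) : L2 u -> (forall t, normc (symb t) <= B) ->
  nrm (comb (hankel_coef u) 0 n) <= B * nrm u.
Proof.
move=> Lu HB; have Ls := L2_symb phi_cont Lu.
apply: le_trans (nrm_bounded (cmeasurable_symb phi_cont) HB Lu).
rewrite -(ler_pXn2r (n := 2)) ?nnegrE ?nrm_ge0// !sqr_nrm sqint_comb.
by rewrite -ler_pdivlMl ?twopi_gt0//; exact: hcoef_bessel.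
Qed.

Lemma finite_section : finite_section_applicable (@L2plus R) (@section_proj R) A.
Proof.
have [N HN] := trunc_below.
have uniq n c c' : (N <= n)%N -> ae_same (comb (trunc n c) 0 n) (comb (trunc n c') 0 n) ->
    nrm (fun x => comb c 0 n x - comb c' 0 n x) = 0.
  move=> Nn /(ae_same_nrm (L2_cmeasurable (L2_comb _ _ _)) (L2_cmeasurable (L2_comb _ _ _))) h.
  apply/eqP; rewrite eq_le nrm_ge0 andbT.
  under eq_fun do rewrite -combB.
  apply: (le_trans (HN n _ Nn)).
  rewrite (_ : comb _ 0 n = fun x => comb (trunc n c) 0 n x - comb (trunc n c') 0 n x).
    by rewrite h mulr0.
  by apply/funext => x; rewrite -combB; apply: eq_big_nat => k _; rewrite truncB.
exists (2 * M), N; split => [n Nn|f y u Hf Hy Ayf Hu].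
  rewrite section_range; split.
  - by move=> _ [c _ <-]; exists (trunc n c) => //; rewrite section_proj_truncE.
  - move=> _ [d _ <-]; have [c cd] := section_solvable d (fun c => HN n c Nn).
    by exists (comb c 0 n); [exists c|rewrite section_proj_truncE cd; exact: aeT].
  - move=> _ _ [c _ <-] [c' _ <-]; rewrite !section_proj_truncE => /(uniq _ _ _ Nn).
    by apply: nrm_eq0_ae; exact: L2_comb.
  - by move=> _ [c _ <-]; rewrite section_proj_truncE; apply: L2norm_comb_le; exact: HN.
have [B B0 HB] := symb_bounded phi_cont.
have Ly := L2plus_L2 Hy; have ry := L2plus_represents Hy.
have Lf := L2plus_L2 Hf; have LAy := L2plus_L2 (A_stable Hy).
have cf : coeffs f = fun k => fcoef y k + hankel_coef y k.
  apply: coeffsE => //; apply: (ae_represents _ _ _ (represents_Au Hy)).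
  - exact: L2_cmeasurable.
  - exact: L2_cmeasurable.
  - exact: ae_sameC.
pose yn n := comb (fcoef y) 0 n.
have Lyn n : L2 (yn n) by exact: L2_comb.
have M0 : 0 < M by exact: lt_le_trans M1.
(* P_n A (u_n - P_n y) = P_n A (y - P_n y) = P_n H (y - P_n y), because P_n (y - P_n y) = 0. The
   lower bound for the sections contributes 2 M, the size of the symbol contributes B, and the final
   1 is the distance from P_n y to y. *)
have key n : (N <= n)%N -> L2 (u n) /\
    nrm (fun x => u n x - y x) <= (2 * M * B + 1) * nrm (fun x => y x - yn n x).
  move=> Nn; have [+ un] := Hu n Nn; rewrite section_range => -[c _ uc].
  have Lu : L2 (u n) by rewrite -uc; exact: L2_comb.
  split => //; apply: (le_trans (nrm_triangle Lu (Lyn n) Ly)).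
  rewrite [nrm (fun x => yn n x - y x)]nrm_distC mulrDl mul1r lerD2r.
  rewrite -uc; under eq_fun do rewrite /yn -combB.
  apply: (le_trans (HN n _ Nn)); rewrite -!mulrA ler_wpM2l// ler_wpM2l ?(ltW M0)//.
  move: un; rewrite -uc section_proj_comb section_proj_A section_projE cf => un.
  have E : nrm (comb (trunc n (fun k => c k - fcoef y k)) 0 n) =
      nrm (comb (hankel_coef (fun x => y x - yn n x)) 0 n).
    have e1 : comb (trunc n (fun k => c k - fcoef y k)) 0 n =
        fun x => comb (trunc n c) 0 n x - comb (trunc n (fcoef y)) 0 n x.
      by apply/funext => x; rewrite -combB; apply: eq_big_nat => k _; rewrite truncB.
    have e2 : comb (hankel_coef (fun x => y x - yn n x)) 0 n =
        fun x => comb (fun k => fcoef y k + hankel_coef y k) 0 n x - comb (trunc n (fcoef y)) 0 n x.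
      apply/funext => x; rewrite -combB; apply: eq_big_nat => k _.
      by rewrite hankel_coefB// /trunc opprD addrACA subrr add0r.
    rewrite e1 e2; apply: ae_nrm; [apply: L2_cmeasurable; apply: L2B; exact: L2_comb..|].
    by apply: aeS un => x ->.
  by rewrite E; apply: nrm_hankel_comb => //; exact: L2B.
apply/L2norm_cvg0.
  by exists N => // n /= Nn; apply: L2B => //; case: (key n Nn).
have kc : (2 * M * B + 1) * nrm (fun x => y x - yn n x) @[n --> \oo] --> (0 : R).
  by rewrite -[X in _ --> X](mulr0 (2 * M * B + 1)); apply: cvgM; [exact: cvg_cst|exact: ry].
apply: (squeeze_cvgr _ (cvg_cst 0) kc).
by exists N => // n /= Nn; rewrite nrm_ge0; case: (key n Nn).
Qed.
End FiniteSection.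

(** * Coordinate form of the equation *)

Section CoordinateForm.
Context {R : realType}.
Implicit Types (c a : nat -> R[i]) (u y f g : R -> R[i]).

(** Multiplication by z is isometric and sends e_k to e_(k+1), so coefficients are shifted and e_0
    receives 0. *)
Lemma represents_zmap f c : L2 f -> represents f c ->
  represents (fun x => zmap x * f x) (fun k => if k is k'.+1 then c k' else 0).
Proof.
move=> Lf rf; rewrite /represents -cvg_shiftS /=.
apply: cvg_trans rf; apply: near_eq_cvg; apply: nearW => n.
congr (Num.sqrt _); apply: eq_Rintegral => x _.
rewrite (_ : zmap x * f x - _ = zmap x * (f x - comb c 0 n x)).
  by rewrite (Normc.normcM (zmap x)) normc_zmap mul1r.
rewrite mulrBr; congr (_ - _); rewrite /comb big_nat_recl// mul0r add0r mulr_sumr.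
by apply: eq_bigr => k _; rewrite basis_funS mulrCA.
Qed.

Lemma cvg_affine (F : set_system R) {FF : ProperFilter F} (p q : R -> R[i]) (a l m : R[i]) :
  p x @[x --> F] --> l -> q x @[x --> F] --> m -> a + p x * q x @[x --> F] --> a + l * m.
Proof.
move=> /cvg_normcP pl /cvg_normcP qm; apply/cvg_normcP.
have H : (normc (p x - l) + normc l) * normc (q x - m) + normc (p x - l) * normc m @[x --> F] --> (0 : R).
  rewrite -[X in _ --> X](addr0 0); apply: cvgD.
    rewrite -[X in _ --> X](mulr0 (0 + normc l)); apply: cvgM => //.
    by apply: cvgD => //; exact: cvg_cst.
  by rewrite -[X in _ --> X](mul0r (normc m)); apply: cvgM => //; exact: cvg_cst.
apply: (squeeze_cvgr _ (cvg_cst 0) H); apply: nearW => x; rewrite normc_ge0 /=.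
have -> : a + p x * q x - (a + l * m) = ((p x - l) + l) * (q x - m) + (p x - l) * m by ring.
apply: (le_trans (le_normcD _ _)); rewrite !Normc.normcM lerD// ler_wpM2r//.
exact: le_normcD.
Qed.

Lemma sign_sqr (z : R[i]) m : (-1) ^+ m * ((-1) ^+ m * z) = z.
Proof. by rewrite mulrA -expr2 sqrr_sign mul1r. Qed.

Variable phi : one_point_compactification R -> R[i].
Hypothesis phi_cont : continuous phi.
Local Notation symb := (symb phi).
Local Notation A := (id_plus_hankel phi).

(** The sign belongs to the change of basis from e_k to (-1)^k e_k; the integrands agree by
    [basis_fun_mul]. *)
Lemma hankel_coef_basis k m :
  hankel_coef phi (@basis_fun R k) m = (-1) ^+ (k + m) * system_coef phi m k.
Proof.
rewrite /hankel_coef /hcoef /system_coef addn1 exprS mulN1r !mulNr mulrN; congr (- _).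
rewrite mulrA mulrA -expr2 sqrr_sign mul1r fmorphV; congr (_ * _).
apply: eq_cintegral => t; rewrite -mulrA basis_fun_mul addn1 mulrA.
by rewrite /qker fmorphV.
Qed.

(** One factor z = (1/2 + i t) / (1/2 - i t) exchanges the denominators. *)
Lemma system_rhs_integrandE m t : system_rhs_integrand phi m t = symb t * basis_fun m t.
Proof.
rewrite /system_rhs_integrand addn1 -mulrA; congr (_ * _).
rewrite exprSr /basis_fun -mulrA; congr (_ * _); rewrite /zmap mulrAC divff ?mul1r//.
by rewrite eq_complex /= negb_and invr_eq0 pnatr_eq0.
Qed.

Lemma system_rhsE m : system_rhs phi m = - ((-1) ^+ m * hcoef symb m).
Proof.
rewrite /system_rhs /hcoef mulNr mulrN opprK -mulrA fmorphV; congr (_ * (_ * _)).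
by apply: eq_cintegral => t; rewrite system_rhs_integrandE.
Qed.

Section Stable.
Hypothesis A_stable : forall u, L2plus u -> L2plus (A u).

Lemma section_system n a :
  section_proj n (A (section_proj n
    (fun rho => \sum_(k < n) (-1) ^+ k * a k * basis_fun k rho))) =
  (fun rho => \sum_(m < n) (-1) ^+ m *
     (a m + \sum_(k < n) system_coef phi m k * a k) * basis_fun m rho).
Proof.
pose c k := (-1) ^+ k * a k.
have -> : (fun rho => \sum_(k < n) (-1) ^+ k * a k * basis_fun k rho) = comb c 0 n.
  by apply/funext => x; rewrite /comb big_mkord.
rewrite section_proj_comb section_proj_A//; apply/funext => x.
rewrite /comb big_mkord; apply: eq_bigr => m _; congr (_ * _).
rewrite /trunc hankel_coef_comb// big_mkord mulrDr; congr (_ + _).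
rewrite mulr_sumr; apply: eq_bigr => k _.
rewrite hankel_coef_basis /c exprD.
transitivity ((-1) ^+ k * ((-1) ^+ k * ((-1) ^+ m * (system_coef phi m k * a k)))); first by ring.
exact: sign_sqr.
Qed.

Hypothesis rhs_int : forall m, cintegrable (system_rhs_integrand phi m).

Let symb_int m : cintegrable (fun t => symb t * basis_fun m t).
Proof. by under eq_fun do rewrite -system_rhs_integrandE; exact: rhs_int. Qed.

Let mS := cmeasurable_symb phi_cont.

(* Partial fractions for 1 / ((1/2 - i t) (t + w)) with w = x + i y. *)
Lemma cauchyT_symb (x y : R) : 0 < y -> cauchyT symb x y = hcoef symb 0 +
  (2^-1%:C%C + 'i%C * upt x y) * cauchyT (fun t => symb t * basis_fun 0 t) x y.
Proof.
move=> y0; have Le := L2_symb phi_cont (@L2_basis_fun R 0).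
have i1 := cintegrable_cauchy x y0 mS (symb_int 0).
have i2 := cintegrable_cauchy x y0 (L2_cmeasurable Le) (L2_cintegrable0 Le).
have y1 : y != 0 by rewrite gt_eqF.
have pf t : symb t / Complex (t + x) y = - 'i%C * (symb t * basis_fun 0 t) +
    (2^-1%:C%C + 'i%C * upt x y) * (symb t * basis_fun 0 t / Complex (t + x) y).
  have d1 := cauchy_neq0 (t + x) y1; have d2 := den_neq0 t (lexx 0).
  rewrite basis_funE /ebasis expr0 mul1r.
  have -> : 2^-1%:C%C + 'i%C * upt x y = den (upt t 0) + 'i%C * Complex (t + x) y :> R[i].
    by rewrite den_upt; apply/eqP; rewrite eq_complex /=; apply/andP; split; apply/eqP; ring.
  move: (den (upt t 0)) (Complex (t + x) y) d1 d2 => p q d1 d2; field.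
  by rewrite d1 d2.
rewrite /cauchyT; under [in LHS]eq_cintegral do rewrite pf.
rewrite cintegralD; [|exact: cintegrableZ..].
rewrite !cintegralZ// mulrDr; congr (_ + _).
  rewrite /hcoef mulrA; congr (_ * _).
  have i0 : 'i%C != 0 :> R[i] by rewrite -normc_eq0 normc_i oner_eq0.
  have p0 := @twopiC_neq0 R.
  have -> : ((2 * pi)^-1)%:C%C = ((2 * pi)%:C%C)^-1 :> R[i] by exact: fmorphV.
  move: ((2 * pi)%:C%C : R[i]) p0 => q q0.
  by field; rewrite i0 q0.
by rewrite mulrCA.
Qed.

Lemma hankel1_ae : exists2 h, L2 h & represents h (hcoef (fun t => symb t * basis_fun 0 t)) /\
  ae_same (hankel phi (fun=> 1)) (fun x => hcoef symb 0 + (2^-1%:C%C + 'i%C * upt x 0) * h x).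
Proof.
have Le := L2_symb phi_cont (@L2_basis_fun R 0).
have [h Lh hr] := riesz_fischer (fun n => hcoef_bessel n Le).
exists h => //; split => //.
apply: aeS (cauchyT_ae Lh (L2_cmeasurable Le) (L2_cintegrable0 Le) hr) => x c.
rewrite hankelE; apply: cvg_lim; first exact: norm_hausdorff.
have e : (fun t => symb t * 1) = symb by apply/funext => t; rewrite mulr1.
rewrite e.
have l : (2^-1%:C%C + 'i%C * upt x y) @[y --> 0^'+] --> (2^-1%:C%C + 'i%C * upt x 0 : R[i]).
  apply/cvg_normcP.
  have yc : (y : R) @[y --> 0^'+] --> (0 : R) by exact: cvg_at_right_filter.
  apply: cvg_trans yc; apply: near_eq_cvg; near=> y.
  have y0 : 0 < y by near: y; exact: nbhs_right_gt.
  rewrite (_ : _ - _ = (- y)%:C%C) ?normc_real ?normrN ?ger0_norm ?ltW//.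
  by apply/eqP; rewrite eq_complex /=; apply/andP; split; apply/eqP; ring.
have c2 : hcoef symb 0 + (2^-1%:C%C + 'i%C * upt x y) *
    cauchyT (fun t => symb t * basis_fun 0 t) x y @[y --> 0^'+] -->
    hcoef symb 0 + (2^-1%:C%C + 'i%C * upt x 0) * h x.
  exact: cvg_affine l c.
apply: cvg_trans c2; apply: near_eq_cvg; near=> y.
by rewrite /= cauchyT_symb//; near: y; exact: nbhs_right_gt.
Unshelve. all: by end_near. Qed.

(** e_0 e_k = (1 + z) e_k = e_k + e_(k+1). *)
Lemma hcoef_basis0 k : hcoef (fun t => symb t * basis_fun 0 t) k = hcoef symb k + hcoef symb k.+1.
Proof.
rewrite /hcoef -mulrDr -cintegralD//; congr (_ * _); apply: eq_cintegral => t.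
by rewrite -mulrDr -mulrA; congr (_ * _); rewrite basis_funS -zmap_basis0; ring.
Qed.

(** Multiplication by b = e_0 = 1 + z, used with s = 1/2 + i rho, for which b s = z; it is
    reversible because e_0 has no zero. *)
Lemma scale_equation (v k g z b q s : R[i]) : b != 0 -> 1 + z = b -> b * s = z -> k = q + s * g ->
  v = - k <-> v + z * v = - q * b + - 1 * (z * g).
Proof.
move=> b0 zb bs ->; have -> : v + z * v = b * v by rewrite -zb; ring.
have -> : - q * b + -1 * (z * g) = b * - (q + s * g) by rewrite -bs; ring.
by split=> [->|/(mulfI b0)].
Qed.

(** Multiplying by 1 + z turns coefficients into sums of neighbours; the equality at 0 starts the
    induction that undoes this. *)
Lemma alternating_unique (w b : nat -> R[i]) : w 0%N = b 0%N ->
  (forall k, w k + w k.+1 = b k + b k.+1) -> forall k, w k = b k.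
Proof.
move=> w0 ws; elim=> [//|k IH]; have := ws k; rewrite IH => /eqP.
by rewrite (inj_eq (addrI _)) => /eqP.
Qed.

(** After scaling by e_0 both sides lie in L_2. With w the coefficients of A y and q_k =
    [hcoef symb k], comparison gives w_0 = -q_0 and w_k + w_(k+1) = -(q_k + q_(k+1)), which is
    equivalent to w = -q. *)
Lemma coordinate_form y c : L2plus y -> represents y c ->
  ae_same (A y) (fun x => - hankel phi (fun=> 1) x) <->
  forall m, c m + hankel_coef phi y m = - hcoef symb m.
Proof.
move=> Hy ry; have Ly := L2plus_L2 Hy; have LA := L2plus_L2 (A_stable Hy).
have cy k : c k = fcoef y k := represents_fcoef Ly ry k.
have [h Lh [rh hh]] := hankel1_ae.
pose w k := fcoef y k + hankel_coef phi y k.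
have rA : represents (A y) w by exact: represents_Au.
have e0 x : basis_fun 0 x != 0 :> R[i].
  by rewrite basis_funE /ebasis expr0 mul1r invr_eq0 den_neq0.
have ez x : basis_fun 0 x * (2^-1%:C%C + 'i%C * upt x 0) = zmap x :> R[i].
  rewrite zmapE basis_funE /ebasis expr0 mul1r /cayley.
  have d0 := den_neq0 x (lexx 0).
  rewrite (_ : 2^-1%:C%C + 'i%C * upt x 0 = 1 - den (upt x 0)).
    by move: (den _) d0 => d d0; field.
  by rewrite den_upt; apply/eqP; rewrite eq_complex /=; apply/andP; split; apply/eqP; field.
have scaled : ae_same (A y) (fun x => - hankel phi (fun=> 1) x) <->
    ae_same (fun x => A y x + zmap x * A y x)
      (fun x => - hcoef symb 0 * basis_fun 0 x + (- 1) * (zmap x * h x)).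
  have E x := @scale_equation (A y x) _ _ _ _ _ _ (e0 x) (zmap_basis0 x) (ez x).
  split=> H; apply: aeS (aeI H hh) => x [E1 E2].
    exact: (E _ _ _ x E2).1 E1.
  exact: (E _ _ _ x E2).2 E1.
rewrite scaled.
have zb1 x : normc (zmap x) <= 1 :> R by rewrite normc_zmap.
have LzA : L2 (fun x => zmap x * A y x) := L2_bounded (@cmeasurable_zmap R) zb1 LA.
have Lzh : L2 (fun x => zmap x * h x) := L2_bounded (@cmeasurable_zmap R) zb1 Lh.
have Lb : L2 (fun x => - hcoef symb 0 * basis_fun 0 x) by apply: L2Z; exact: L2_basis_fun.
have Lmh : L2 (fun x => -1 * (zmap x * h x)) by exact: L2Z.
have rL := representsD LA LzA rA (represents_zmap LA rA).
have rb : represents (fun x => - hcoef symb 0 * basis_fun 0 x)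
    (fun k => - hcoef symb 0 * (k == 0%N)%:R).
  have := represents_comb (fun=> - hcoef symb 0) 1.
  rewrite (_ : comb _ 0 1 = fun x => - hcoef symb 0 * basis_fun 0 x); last first.
    by apply/funext => x; rewrite /comb big_nat1.
  rewrite (_ : (fun k => if (k < 1)%N then _ else _) = (fun k => - hcoef symb 0 * (k == 0%N)%:R))//.
  by apply/funext => -[|k]; rewrite /= ?mulr1 ?mulr0.
have rR := representsD Lb Lmh rb (representsZ (-1) Lzh (represents_zmap Lh rh)).
have LL := L2D LA LzA; have LR := L2D Lb Lmh.
split=> [H|H].
  have rL' := ae_represents (L2_cmeasurable LL) (L2_cmeasurable LR) H rR.
  have eq k := etrans (represents_fcoef LL rL k) (esym (represents_fcoef LL rL' k)).
  move=> m; rewrite cy; apply: (@alternating_unique w (fun k => - hcoef symb k)).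
    by have := eq 0%N; rewrite /= addr0 mulr0 addr0 mulr1.
  move=> k; have := eq k.+1; rewrite /= mulr0 add0r hcoef_basis0 mulN1r opprD => <-.
  exact: addrC.
apply: (represents_ae LL LR rL); move: rR; congr represents.
have wE k : w k = - hcoef symb k by rewrite /w -cy H.
apply/funext => -[|k]; rewrite /= !wE; first by rewrite mulr1 mulr0 !addr0.
by rewrite mulr0 add0r mulN1r hcoef_basis0 opprD addrC.
Qed.

(** Each partial row sum is a pairing of a partial sum of [y] with phi e_m. By Cauchy-Schwarz these
    converge, and the limit of the row is (-1)^m times the coefficient of (I + H) y; uniqueness of
    limits gives the equivalence. *)
Lemma solves_systemP y a : L2 y -> represents y (fun n => (-1) ^+ n * a n) ->
  solves_system phi a <-> forall m, (-1) ^+ m * a m + hankel_coef phi y m = - hcoef symb m.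
Proof.
move=> Ly ry; pose c n := (-1) ^+ n * a n.
have lim m : a m + \sum_(0 <= k < n) system_coef phi m k * a k @[n --> \oo] -->
    (-1) ^+ m * (c m + hankel_coef phi y m).
  apply/cvg_normcP.
  have Le := L2_symb phi_cont (@L2_basis_fun R m).
  pose C := (2 * pi)^-1 * nrm (fun t => symb t * basis_fun m t).
  have bc : nrm (fun x => y x - comb c 0 n x) * C @[n --> \oo] --> (0 : R).
    by rewrite -[X in _ --> X](mul0r C); apply: cvgM; [exact: ry|exact: cvg_cst].
  apply: (squeeze_cvgr _ (cvg_cst 0) bc); apply: nearW => n; rewrite normc_ge0 /=.
  have := represents_cintegral c n Ly Le.
  set I := cintegral _; set S := \sum_(0 <= k < n) c k * _ => bnd.
  have hy : hankel_coef phi y m = - ((2 * pi)^-1)%:C%C * I.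
    rewrite /hankel_coef /hcoef; congr (_ * _); apply: eq_cintegral => t.
    by rewrite mulrAC mulrC.
  have hs : \sum_(0 <= k < n) system_coef phi m k * a k = (-1) ^+ m * (- ((2 * pi)^-1)%:C%C * S).
    rewrite /S 2!mulr_sumr; apply: eq_bigr => k _.
    have -> : cintegral (fun x => basis_fun k x * (symb x * basis_fun m x)) =
        cintegral (fun x => symb x * basis_fun k x * basis_fun m x).
      by apply: eq_cintegral => t; rewrite mulrA (mulrC (basis_fun k t)).
    rewrite (mulrCA _ (c k)) -[_ * cintegral _]/(hankel_coef phi (@basis_fun R k) m).
    rewrite hankel_coef_basis /c exprD.
    transitivity ((-1) ^+ k * ((-1) ^+ k * ((-1) ^+ m * ((-1) ^+ m * (system_coef phi m k * a k))))).
      by rewrite !sign_sqr.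
    by ring.
  have sc : (-1) ^+ m * c m = a m by exact: sign_sqr.
  rewrite hs hy (mulrDr ((-1) ^+ m) (c m)) sc opprD addrACA subrr add0r -mulrBr -mulrBr.
  rewrite 2!Normc.normcM normcX normcN Normc.normc1 expr1n mul1r.
  rewrite normcN normc_real ger0_norm; last by rewrite invr_ge0 ltW// twopi_gt0.
  rewrite /C mulrCA ler_wpM2l ?invr_ge0 ?(ltW twopi_gt0)//.
  by rewrite -normcN opprB.
split=> H m.
  have E : (-1) ^+ m * (c m + hankel_coef phi y m) = system_rhs phi m.
    exact: (cvg_unique (@norm_hausdorff _ _) (lim m) (H m)).
  by rewrite -[LHS](sign_sqr _ m) E system_rhsE mulrN sign_sqr.
rewrite system_rhsE; have := lim m.
by rewrite /= (H m : c m + _ = _) mulrN.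
Qed.
End Stable.
End CoordinateForm.

Theorem theorem7p1 (R : realType)
    (phi : one_point_compactification R -> R[i])
    (phi_cont : continuous phi)
    (phi_inv : exists M : R, invertible_on (@L2plus R) (id_plus_hankel phi) M) :
  [/\ (* the finite section method is applicable *)
      finite_section_applicable (@L2plus R) (@section_proj R)
        (id_plus_hankel phi),
      (* in the basis (-1)^k z^k / (1/2 - i rho), the truncated operator is
         the matrix of the system truncated to 0 <= k, m <= n - 1 *)
      forall (n : nat) (a : nat -> R[i]),
        section_proj n (id_plus_hankel phi (section_proj n
          (fun rho => \sum_(k < n) (-1) ^+ k * a k * basis_fun k rho))) =
        (fun rho => \sum_(m < n) (-1) ^+ m *
           (a m + \sum_(k < n) system_coef phi m k * a k) * basis_fun m rho) &
      (* the system is the coordinate form of (I + H) y = - H 1, whenever the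
         integrals of its right-hand side exist *)
      forall (y : R -> R[i]) (a : nat -> R[i]),
        (forall m, cintegrable (system_rhs_integrand phi m)) ->
        L2plus y -> expansion y (fun n => (-1) ^+ n * a n) ->
        (ae_same (id_plus_hankel phi y)
                 (fun rho => - hankel phi (fun=> 1) rho)
         <-> solves_system phi a)].
Proof.
have [M0 [stable _ _ below]] := phi_inv.
(* The given bound is not assumed positive; it is enlarged to at least 1 so that 1 / (2 M) makes
   sense as a tail size. *)
have below' u : L2plus u -> nrm u <= Num.max 1 M0 * nrm (id_plus_hankel phi u).
  move=> Hu; have := below u Hu.
  rewrite (L2normE (L2plus_L2 Hu)) (L2normE (L2plus_L2 (stable u Hu))) lee_fin => h.
  by apply: (le_trans h); rewrite ler_wpM2r ?nrm_ge0// le_max lexx orbT.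
have M1 : 1 <= Num.max 1 M0 by rewrite le_max lexx.
split; first exact: (finite_section phi_cont stable M1 below').
  by move=> n a; exact: section_system.
move=> y a rhs_int Hy /(expansionP _ (L2plus_L2 Hy)) ry.
apply: iff_trans (coordinate_form phi_cont stable rhs_int Hy ry) _.
by apply: iff_sym; apply: solves_systemP => //; exact: L2plus_L2.
Qed.
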